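(* Identify $\mathcal{S}'(\mathbb{R}^n)$ with its image in $\mathcal{G}_{\tau,\mathcal{S}}(\mathbb{R}^n)$ under the embedding $\imath(w)=(w\ast\varphi_\epsilon)_\epsilon+\mathcal{N}_{\mathcal{S}}(\mathbb{R}^n)$. Then $$\mathcal{G}^\infty_{\mathcal{S}}(\mathbb{R}^n)\cap\mathcal{S}'(\mathbb{R}^n)=\mathcal{S}(\mathbb{R}^n),$$ i.e. for $w\in\mathcal{S}'(\mathbb{R}^n)$ one has $\imath(w)\in\mathcal{G}^\infty_{\mathcal{S}}(\mathbb{R}^n)$ if and only if $w\in\mathcal{S}(\mathbb{R}^n)$.
   Context: Notation: $\langle x\rangle=(1+|x|^2)^{1/2}$. $\mathcal{E}[\mathbb{R}^n]$ is the algebra of all nets $(u_\epsilon)_{\epsilon\in(0,1]}$ with $u_\epsilon\in\mathcal{C}^\infty(\mathbb{R}^n)$. $\mathcal{E}_\tau(\mathbb{R}^n)$: all $(u_\epsilon)_\epsilon\in\mathcal{E}[\mathbb{R}^n]$ such that for all $\alpha\in\mathbb{N}^n$ there is $N\in\mathbb{N}$ with $\sup_{\epsilon\in(0,1]}\epsilon^N\|\langle x\rangle^{-N}\partial^\alpha u_\epsilon\|_{L^\infty(\mathbb{R}^n)}<\infty$. $\mathcal{N}_{\mathcal{S}}(\mathbb{R}^n)$: all $(u_\epsilon)_\epsilon\in\mathcal{E}[\mathbb{R}^n]$ such that for all $\alpha,\beta\in\mathbb{N}^n$ and all $q\in\mathbb{N}$, $\sup_{\epsilon\in(0,1]}\epsilon^{-q}\|x^\alpha\partial^\beta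 u_\epsilon\|_{L^\infty(\mathbb{R}^n)}<\infty$. $\mathcal{G}_{\tau,\mathcal{S}}(\mathbb{R}^n)=\mathcal{E}_\tau(\mathbb{R}^n)/\mathcal{N}_{\mathcal{S}}(\mathbb{R}^n)$. $\mathcal{E}^\infty_{\mathcal{S}}(\mathbb{R}^n)$: all $(u_\epsilon)_\epsilon\in\mathcal{E}[\mathbb{R}^n]$ for which there is $N\in\mathbb{N}$ such that for all $\alpha,\beta\in\mathbb{N}^n$, $\sup_{\epsilon\in(0,1]}\epsilon^{N}\|x^\alpha\partial^\beta u_\epsilon\|_{L^\infty(\mathbb{R}^n)}<\infty$. $\mathcal{G}^\infty_{\mathcal{S}}(\mathbb{R}^n)=\mathcal{E}^\infty_{\mathcal{S}}(\mathbb{R}^n)/\mathcal{N}_{\mathcal{S}}(\mathbb{R}^n)\subset\mathcal{G}_{\tau,\mathcal{S}}(\mathbb{R}^n)$ (the $\mathcal{S}$-regular generalized functions). Mollifier: $\varphi\in\mathcal{S}(\mathbb{R}^n)$ is fixed with $\int\varphi\,dx=1$ and $\int x^\alpha\varphi(x)\,dx=0$ for all $\alpha\in\mathbb{N}^n$, $\alpha\ne0$; $\varphi_\epsilon(x)=\epsilon^{-n}\varphi(x/\epsilon)$. For $f\in\mathcal{S}(\mathbb{R}^n)$, $\imath(f)$ equals the class of the constant net $(f)_\epsilon$. *)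

(* Defs.v *)
From HB Require Import structures.
From mathcomp Require Import all_boot all_order all_algebra.
From mathcomp Require Import complex.
From mathcomp Require Import all_classical all_reals all_analysis.

Set Implicit Arguments.
Unset Strict Implicit.
Unset Printing Implicit Defensive.
Import Order.TTheory GRing.Theory Num.Theory.
Import numFieldNormedType.Exports.

Local Open Scope classical_set_scope.
Local Open Scope ring_scope.
Local Open Scope complex_scope.

Section lebesgue_cons.
Context (R : realType) (n : nat).
Variable mu : {sigma_finite_measure set (n.-tuple (measurableTypeR R)) -> \bar R}.

Definition cons_pair (p : measurableTypeR R * n.-tuple (measurableTypeR R)) :
  n.+1.-tuple (measurableTypeR R) := [tuple of p.1 :: p.2].

Lemma measurable_cons_pair : measurable_fun setT cons_pair.
Proof. by apply: measurable_cons. Qed.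

Definition lebesgue_cons : set (n.+1.-tuple (measurableTypeR R)) -> \bar R :=
  pushforward (@lebesgue_measure R \x mu)%E cons_pair.

(* The general instance has to be named: [measurable_cons_pair] is not found by
   unification. *)
HB.instance Definition _ := Measure.copy lebesgue_cons
  (measure_function_pushforward__canonical__measure_function_Measure
     (lebesgue_measure \x mu)%E measurable_cons_pair).

(* Proved by hand: the only canonical sigma-finite instance on [m1 \x m2] that
   unification finds is the one for finite [m1] and [m2]. *)
Lemma sigma_finite_lebesgue_cons : sigma_finite setT lebesgue_cons.
Proof.
have /sigma_finiteP[F [TF ndF Foo]] := sigma_finiteT (@lebesgue_measure R).
have /sigma_finiteP[G [TG ndG Goo]] := sigma_finiteT mu.
have mf : measurable_fun [set: n.+1.-tuple (measurableTypeR R)]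
    (fun t => (thead t, [tuple of behead t])).
  by apply: measurable_fun_pair; [exact: measurable_tnth|exact: measurable_behead].
have fK : cancel cons_pair (fun t => (thead t, [tuple of behead t])).
  by move=> [x t]; congr pair; exact: val_inj.
exists (fun k => (fun t => (thead t, [tuple of behead t])) @^-1` (F k `*` G k)).
  apply/seteqP; split => // t _.
  have [i _ Fi] : (\bigcup_k F k) (thead t) by rewrite -TF.
  have [j _ Gj] : (\bigcup_k G k) [tuple of behead t] by rewrite -TG.
  exists (maxn i j) => //; split => /=.
  - by move: Fi; exact/subsetPset/ndF/leq_maxl.
  - by move: Gj; exact/subsetPset/ndG/leq_maxr.
move=> k; have [mF Fk] := Foo k; have [mG Gk] := Goo k; split.
  by rewrite -[X in measurable X]setTI; apply: mf => //; exact: measurableX.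
rewrite /lebesgue_cons /pushforward -comp_preimage.
rewrite (_ : _ \o _ = id) ?preimage_id; last by apply/funext => p; exact: fK.
by rewrite product_measure1E// lte_mul_pinfty// ge0_fin_numE.
Qed.

HB.instance Definition _ := Measure_isSigmaFinite.Build _ _ _ lebesgue_cons
  sigma_finite_lebesgue_cons.

End lebesgue_cons.

(* Lebesgue measure on the Borel sets of R^n: the n-fold product of
   [lebesgue_measure], on tuples because matrices have no sigma-algebra. *)
Fixpoint lebesgue_tuple (R : realType) (n : nat) :
    {sigma_finite_measure set (n.-tuple (measurableTypeR R)) -> \bar R} :=
  match n with
  | 0 => dirac [tuple]
  | m.+1 => lebesgue_cons (lebesgue_tuple R m)
  end.

Section integral.
Context (R : realType) (n : nat).

Definition integral_rV (f : 'rV[R]_n -> R) : R :=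
  \int[lebesgue_tuple R n]_t f (\row_i tnth t i).

Definition cintegral (f : 'rV[R]_n -> R[i]) : R[i] :=
  integral_rV (fun x => complex.Re (f x)) +i* integral_rV (fun x => complex.Im (f x)).

End integral.

Section smooth_functions.
Context (R : realType) (n : nat).
Implicit Types (g : 'rV[R]_n -> R) (f : 'rV[R]_n -> R[i]).
Implicit Types (alpha beta : {ffun 'I_n -> nat}) (x : 'rV[R]_n).

Definition partial (i : 'I_n) g : 'rV[R]_n -> R :=
  fun x => 'D_(delta_mx 0 i) g x.

Definition partials (s : seq 'I_n) g : 'rV[R]_n -> R := foldr partial g s.

(* C^infinity: all iterated partial derivatives, taken in any order, exist and
   are continuous. *)
Definition smooth_real g : Prop := forall s : seq 'I_n,
  continuous (partials s g) /\
  forall i x, derivable (partials s g) x (delta_mx 0 i).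

Definition smooth f : Prop :=
  smooth_real (fun x => complex.Re (f x)) /\ smooth_real (fun x => complex.Im (f x)).

Definition multi_seq alpha : seq 'I_n :=
  flatten [seq nseq (alpha i) i | i <- enum 'I_n].

Definition mderive alpha f : 'rV[R]_n -> R[i] := fun x =>
  partials (multi_seq alpha) (fun y => complex.Re (f y)) x +i*
  partials (multi_seq alpha) (fun y => complex.Im (f y)) x.

Definition monomial alpha x : R := \prod_i x 0 i ^+ alpha i.

Definition japanese x : R := Num.sqrt (1 + \sum_i x 0 i ^+ 2).

(* The L^infinity norm, which is the plain supremum on the continuous functions
   it is applied to; it may be +oo. *)
Definition sup_norm f : \bar R := ereal_sup [set (Normc.normc (f x))%:E | x in setT].

Definition seminorm alpha beta f : \bar R :=
  sup_norm (fun x => (monomial alpha x)%:C * mderive beta f x).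

Definition tau_seminorm (N : nat) alpha f : \bar R :=
  sup_norm (fun x => (japanese x ^- N)%:C * mderive alpha f x).

Definition schwartz f : Prop :=
  smooth f /\ forall alpha beta, (seminorm alpha beta f < +oo)%E.

(* A tempered distribution is given by a function on all of [_ -> R[i]] of which
   only the values on Schwartz functions matter. The second clause is continuity
   at every point of S(R^n) for the topology defined by the seminorms. *)
Definition tempered (w : ('rV[R]_n -> R[i]) -> R[i]) : Prop :=
  (forall (c : R[i]) f1 f2, schwartz f1 -> schwartz f2 ->
     w (fun x => c * f1 x + f2 x) = c * w f1 + w f2) /\
  (forall f, schwartz f -> forall e : R, 0 < e ->
     exists (m : nat) (d : R), 0 < d /\
       forall f', schwartz f' ->
         (forall alpha beta, (\sum_i alpha i <= m)%N -> (\sum_i beta i <= m)%N ->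
            (seminorm alpha beta (fun x => f' x - f x)%R < d%:E)%E) ->
         Normc.normc (w f' - w f) < e).

(* [w] is the distribution defined by some Schwartz function. *)
Definition is_schwartz_distribution (w : ('rV[R]_n -> R[i]) -> R[i]) : Prop :=
  exists2 f, schwartz f &
    forall h, schwartz h -> w h = cintegral (fun x => f x * h x).

Definition mollifier f : Prop :=
  [/\ schwartz f, cintegral f = 1 &
      forall alpha, alpha != [ffun=> 0%N] ->
        cintegral (fun x => (monomial alpha x)%:C * f x) = 0].

End smooth_functions.

Definition eps_index (R : realType) := {e : R | 0 < e <= 1}.

Section colombeau.
Context (R : realType) (n : nat).

Definition net := eps_index R -> 'rV[R]_n -> R[i].

Implicit Types u v : net.

Definition E_net : set net := [set u | forall eps, smooth (u eps)].

Definition sup_finite (F : eps_index R -> \bar R) : Prop :=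
  (ereal_sup (range F) < +oo)%E.

Definition E_tau : set net := [set u | E_net u /\
  forall alpha, exists N : nat, sup_finite (fun eps =>
    (((val eps ^+ N)%R)%:E * tau_seminorm N alpha (u eps))%E)].

Definition N_S : set net := [set u | E_net u /\
  forall alpha beta (q : nat), sup_finite (fun eps =>
    (((val eps ^- q)%R)%:E * seminorm alpha beta (u eps))%E)].

Definition E_S_infty : set net := [set u | E_net u /\
  exists N : nat, forall alpha beta, sup_finite (fun eps =>
    (((val eps ^+ N)%R)%:E * seminorm alpha beta (u eps))%E)].

(* The class of [u] in E_tau / N_S. *)
Definition gclass u : set net :=
  [set v | E_tau v /\ N_S (fun eps x => v eps x - u eps x)].

Definition G_tau_S : set (set net) := [set gclass u | u in E_tau].

Definition G_S_infty : set (set net) := [set gclass u | u in E_S_infty].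

Definition mollify (phi : 'rV[R]_n -> R[i]) (eps : eps_index R) :
    'rV[R]_n -> R[i] :=
  fun x => (val eps ^- n)%:C * phi ((val eps)^-1 *: x).

Definition convolution (w : ('rV[R]_n -> R[i]) -> R[i]) (f : 'rV[R]_n -> R[i]) :
    'rV[R]_n -> R[i] :=
  fun x => w (fun y => f (x - y)).

Definition embed (phi : 'rV[R]_n -> R[i]) (w : ('rV[R]_n -> R[i]) -> R[i]) :
    set net :=
  gclass (fun eps => convolution w (mollify phi eps)).

End colombeau.

(* Main.v *)
(* Write phi_eps for the rescaled mollifier and h_eps = w * phi_eps.  If w is given
   by a Schwartz function f, then h_eps(x) is the integral of f(x - eps z) phi(z) dz,
   whose Schwartz seminorms are bounded uniformly in eps: the net (h_eps) is itself a
   regular representative, with N = 0.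
   Conversely, regularity bounds every seminorm of h_eps by O(eps^-N) with N fixed.
   Since the moments of phi vanish, h * phi_del - h is O(del^K) in every seminorm, for
   each K, the constant involving finitely many seminorms of h.  Convolutions commute,
   h_eps * phi_del = h_del * phi_eps, so that taking K = N + 1 and del = eps / 2 gives
   h_eps - h_del = O(eps) in every seminorm: h_{2^-j} converges in S to some f.
   Finally <w, psi> is the limit of <w, psi * phi_eps^> = <h_eps, psi>, where phi_eps^
   is the reflected mollifier, hence equal to <f, psi>. *)
Require Import Defs.
From mathcomp Require Import all_boot all_order all_algebra.
From mathcomp Require Import complex.
From mathcomp Require Import all_classical all_reals all_analysis.
From mathcomp Require Import measurable_realfun.
From mathcomp Require Import ring lra.

Set Implicit Arguments.
Unset Strict Implicit.
Unset Printing Implicit Defensive.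
Import Order.TTheory GRing.Theory Num.Theory.
Import numFieldNormedType.Exports.

Local Open Scope classical_set_scope.
Local Open Scope ring_scope.

(** * Calculus on R^n *)

Section weight.
Context (R : realType) (n : nat).
Implicit Types (x y : 'rV[R]_n).

(** Approximation to order K costs K derivatives of h. The choice K = N + 1 is therefore possible
    only because N is the same for all derivatives, and this is where the uniformity of N in the
    definition of regularity is used. Halving keeps both errors under control: del^K eps^-N and
    eps^K del^-N are O(eps) when the two scales are comparable, and a fixed ratio makes the
    increments a geometric series. Commuting the convolutions and the duality with psi both require
    moving w under an integral. This is done by comparison with sums over a finite grid, with
    explicit errors. Likewise, differentiation under integrals and limits is replaced by
    quantitative Taylor estimates. Every bound is therefore stated with a constant, for real
    functions, lists of directions and one polynomial weight; complex functions enter through their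
    real and imaginary parts. A regular class is known only through some representative u; as u_eps
    - h_eps is negligible, h_eps inherits the bounds of u_eps. *)

Definition l1 x : R := \sum_i `|x 0 i|.
(** Submultiplicative with constant 1, since [W x * W y - W (x + y) = l1 x * l1 y]: powers of this
    weight move from one point to another without extra constants. *)
Definition W x : R := 1 + l1 x.

Lemma l1_ge0 x : 0 <= l1 x. Proof. exact: sumr_ge0. Qed.

Lemma W_ge1 x : 1 <= W x. Proof. by rewrite lerDl l1_ge0. Qed.

Lemma W_gt0 x : 0 < W x. Proof. exact: lt_le_trans (W_ge1 x). Qed.

Lemma W_ge0 x : 0 <= W x. Proof. exact/ltW/W_gt0. Qed.

Lemma l1_le_W x : l1 x <= W x. Proof. by rewrite lerDr. Qed.

Lemma WX_ge0 x M : 0 <= W x ^+ M. Proof. exact/exprn_ge0/W_ge0. Qed.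

Lemma WX_gt0 x M : 0 < W x ^+ M. Proof. exact/exprn_gt0/W_gt0. Qed.

Lemma WX_ge1 x M : 1 <= W x ^+ M. Proof. exact/exprn_ege1/W_ge1. Qed.

Lemma coord_le_l1 x i : `|x 0 i| <= l1 x.
Proof. by rewrite /l1 (bigD1 i)//= lerDl sumr_ge0. Qed.

Lemma l1D x y : l1 (x + y) <= l1 x + l1 y.
Proof.
by rewrite /l1 -big_split/= ler_sum// => i _; rewrite mxE ler_normD.
Qed.

Lemma l1Z (c : R) x : l1 (c *: x) = `|c| * l1 x.
Proof. by rewrite /l1 mulr_sumr; apply: eq_bigr => i _; rewrite mxE normrM. Qed.

Lemma l1N x : l1 (- x) = l1 x.
Proof. by rewrite -scaleN1r l1Z normrN1 mul1r. Qed.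

Lemma l10 : l1 0 = 0.
Proof. by rewrite -(scale0r 0) l1Z normr0 mul0r. Qed.

Lemma WN x : W (- x) = W x. Proof. by rewrite /W l1N. Qed.

Lemma W_le x y : l1 x <= l1 y -> W x <= W y.
Proof. by rewrite lerD2l. Qed.

Lemma WX_le x y M : l1 x <= l1 y -> W x ^+ M <= W y ^+ M.
Proof. by move=> xy; rewrite lerXn2r ?nnegrE ?W_ge0// W_le. Qed.

Lemma W_scale_le (c : R) x M : `|c| <= 1 -> W (c *: x) ^+ M <= W x ^+ M.
Proof. by move=> c1; apply: WX_le; rewrite l1Z ler_piMl// l1_ge0. Qed.

Lemma WD x y : W (x + y) <= W x * W y.
Proof.
apply: (@le_trans _ _ (1 + (l1 x + l1 y))); first by rewrite lerD2l l1D.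
rewrite -subr_ge0 (_ : _ - _ = l1 x * l1 y) ?mulr_ge0 ?l1_ge0//.
by rewrite /W; ring.
Qed.

Lemma WXD x y M : W (x + y) ^+ M <= W x ^+ M * W y ^+ M.
Proof. by rewrite -exprMn lerXn2r ?nnegrE ?mulr_ge0 ?W_ge0// WD. Qed.

Lemma WX_homo x M N : (M <= N)%N -> W x ^+ M <= W x ^+ N.
Proof. by move=> MN; rewrite ler_weXn2l// W_ge1. Qed.

Lemma l1_delta i (t : R) : l1 (t *: delta_mx 0 i) = `|t|.
Proof.
rewrite l1Z /l1 (bigD1 i)//= mxE !eqxx normr1 big1 ?addr0 ?mulr1// => j ji.
by rewrite mxE (negPf ji) andbF normr0.
Qed.

End weight.

(** * Mean value and Taylor estimates along coordinate directions *)

Section directional_calculus.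
Context (R : realType) (n : nat).
Implicit Types (g : 'rV[R]_n -> R) (x u v : 'rV[R]_n).
Local Notation e i := (delta_mx 0 i : 'rV[R]_n).

(** Dividing by [t] leaves an error of at most [B * |t|]. The quadratic inequality is the form of
    differentiability that can be integrated. The domain is a general normed space because the lemma
    serves both partial derivatives and the derivative in a scale parameter. *)
Lemma quad_is_derive (V : normedModType R) (g : V -> R) (x v : V) (G B : R) :
  (forall t : R, `|g (t *: v + x) - g x - t * G| <= B * t ^+ 2) ->
  is_derive x v g G.
Proof.
move=> H.
have H' : h^-1 *: ((g \o shift x) (h *: v) - g x) @[h --> 0^'] --> G.
  apply/cvgrPdist_le => /= eps eps0.
  have B0 : 0 <= B.
    by have := H 1; rewrite expr1n mulr1; apply: le_trans; exact: normr_ge0.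
  have B1 : 0 < B + 1 by rewrite ltr_wpDl.
  near=> h.
  have h0 : h != 0 by near: h; exact: nbhs_dnbhs_neq.
  rewrite distrC.
  have -> : h^-1 *: (g (h *: v + x) - g x) - G =
      h^-1 * (g (h *: v + x) - g x - h * G).
    by rewrite [RHS]mulrBr mulrA mulVf// mul1r.
  rewrite normrM normfV ler_pdivrMl ?normr_gt0//.
  apply: le_trans (H h) _; rewrite -real_normK ?num_real// expr2.
  rewrite mulrCA ler_wpM2l//.
  have : `|h| <= eps / (B + 1).
    near: h; apply: dnbhs0_le; exact: divr_gt0.
  rewrite ler_pdivlMr// => /(le_trans _); apply.
  by rewrite mulrC ler_wpM2l// lerDl.
by apply: DeriveDef; [apply/cvg_ex; exists G|exact: cvg_lim].
Unshelve. all: by end_near. Qed.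

Lemma is_derive_line g i x (t : R) : derivable g (t *: e i + x) (e i) ->
  is_derive t 1 (fun h => g (h *: e i + x)) (partial i g (t *: e i + x)).
Proof.
move=> dg.
have E : (fun h => h^-1 *: (((fun h => g (h *: e i + x)) \o shift t) (h *: (1 : R))
      - g (t *: e i + x))) =
    (fun h => h^-1 *: ((g \o shift (t *: e i + x)) (h *: e i) - g (t *: e i + x))).
  by apply/funext => h /=; rewrite [h *: _]mulr1 scalerDl addrA.
apply: DeriveDef; first by rewrite /derivable E.
by rewrite /derive E.
Qed.

Lemma MVT_line g i x (t : R) : (forall y, derivable g y (e i)) ->
  exists2 c, `|c| <= `|t| &
    g (t *: e i + x) - g x = t * partial i g (c *: e i + x).
Proof.
move=> dg; pose f h := g (h *: e i + x).
have df (h : R) : is_derive h 1 f (partial i g (h *: e i + x)) by exact: is_derive_line.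
have cf (a b : R) : {within `[a, b], continuous f}.
  apply: continuous_subspaceT => y; apply: differentiable_continuous.
  by apply/derivable1_diffP; have [] := df y.
have f0 : f 0 = g x by rewrite /f scale0r add0r.
case: (leP 0 t) => t0.
  have [c /andP[]] := @MVT_segment R f _ 0 t t0 (fun h _ => df h) (cf 0 t).
  rewrite !bnd_simp => c0 ct; rewrite subr0 f0 => E; exists c.
    by rewrite !ger0_norm.
  by rewrite E mulrC.
have [c /andP[]] := @MVT_segment R f _ t 0 (ltW t0) (fun h _ => df h) (cf t 0).
rewrite !bnd_simp => ct c0; rewrite sub0r f0 => E; exists c.
  by rewrite !ler0_norm ?lerN2// ltW.
by rewrite -[LHS]opprB E; ring.
Qed.

Lemma rV_sum_delta v : v = \sum_i v 0 i *: e i.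
Proof. exact: row_sum_delta. Qed.

(** The path from [u] to [v + u] changes one coordinate at a time, and the mean value theorem
    applies to each edge. The weight at [u] is compared with the weight at the intermediate point,
    whose offset from [u] has [l1] norm at most [l1 v]. *)
Lemma lipschitz_weighted g M B u v :
  (forall i x, derivable g x (e i)) ->
  (forall i x, W x ^+ M * `|partial i g x| <= B) ->
  W u ^+ M * `|g (v + u) - g u| <= B * (W v ^+ M * l1 v).
Proof.
move=> dg Bg.
pose p s := \sum_(i <- s) v 0 i *: e i; pose L s := \sum_(i <- s) `|v 0 i|.
have L0 s : 0 <= L s by exact: sumr_ge0.
have pL s : l1 (p s) <= L s.
  elim: s => [|i s IH]; first by rewrite /p /L !big_nil l10.
  rewrite /p /L !big_cons; apply: le_trans (l1D _ _) _.
  by rewrite l1_delta lerD2l.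
(* Induction over the coordinates already moved: [p s] is the partial displacement and [L s] the
   length of the path so far, which dominates [l1 (p s)] for any list, repetitions included. *)
suff H s : W u ^+ M * `|g (p s + u) - g u| <= B * ((1 + L s) ^+ M * L s).
  by move: (H (index_enum _)); rewrite /p -rV_sum_delta.
elim: s => [|i s IH].
  by rewrite /p /L !big_nil add0r subrr normr0 !mulr0.
have -> : p (i :: s) = v 0 i *: e i + p s by rewrite /p big_cons.
have LE : L (i :: s) = `|v 0 i| + L s by rewrite /L big_cons.
have [c cv E] := MVT_line (p s + u) (v 0 i) (dg i).
rewrite -addrA.
have -> : g (v 0 i *: e i + (p s + u)) - g u =
  v 0 i * partial i g (c *: e i + (p s + u)) + (g (p s + u) - g u).
  by rewrite -E; ring.
apply: le_trans (ler_wpM2l (WX_ge0 _ _) (ler_normD _ _)) _; rewrite mulrDr.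
have B0 : 0 <= B by apply: le_trans (Bg i 0); rewrite mulr_ge0 ?WX_ge0.
have L1 : (1 + L s) ^+ M <= (1 + L (i :: s)) ^+ M.
  by rewrite lerXn2r ?nnegrE ?addr_ge0// LE lerD2l lerDr.
rewrite {2}LE mulrDr mulrDr lerD//; last first.
  apply: le_trans IH _; rewrite ler_wpM2l// ler_wpM2r//.
rewrite normrM.
set z := c *: e i + (p s + u).
have Wu : W u ^+ M <= (1 + L (i :: s)) ^+ M * W z ^+ M.
  have -> : u = - (c *: e i + p s) + z.
    by rewrite /z (addrA (c *: _)) addKr.
  apply: le_trans (WXD _ _ _) _; rewrite ler_wpM2r ?WX_ge0//.
  rewrite WN lerXn2r ?nnegrE ?W_ge0 ?addr_ge0// /W lerD2l.
  apply: le_trans (l1D _ _) _; rewrite l1_delta LE lerD//.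
apply: le_trans (ler_wpM2r _ Wu) _; first by rewrite mulr_ge0.
rewrite [leLHS](_ : _ = (1 + L (i :: s)) ^+ M * `|v 0 i| * (W z ^+ M * `|partial i g z|)); last by ring.
by rewrite mulrC ler_wpM2r ?mulr_ge0 ?exprn_ge0 ?addr_ge0//.
Qed.

(** Along the same coordinate path, the mean value theorem gives [partial i g] at a point of the
    edge instead of at [u]; the discrepancy is controlled by the Lipschitz bound of
    [partial i g]. *)
Lemma taylor2 g B u v :
  (forall i x, derivable g x (e i)) ->
  (forall i j x, derivable (partial i g) x (e j)) ->
  (forall i j x, `|partial j (partial i g) x| <= B) ->
  `|g (v + u) - g u - \sum_i v 0 i * partial i g u| <= B * (l1 v) ^+ 2.
Proof.
move=> dg ddg Bg.
pose p s := \sum_(i <- s) v 0 i *: e i; pose L s := \sum_(i <- s) `|v 0 i|.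
have L0 s : 0 <= L s by exact: sumr_ge0.
have pL s : l1 (p s) <= L s.
  elim: s => [|i s IH]; first by rewrite /p /L !big_nil l10.
  rewrite /p /L !big_cons; apply: le_trans (l1D _ _) _.
  by rewrite l1_delta lerD2l.
suff H s : `|g (p s + u) - g u - \sum_(i <- s) v 0 i * partial i g u|
    <= B * (L s) ^+ 2.
  by move: (H (index_enum _)); rewrite /p -rV_sum_delta.
elim: s => [|i s IH].
  by rewrite /p /L !big_nil add0r subrr subr0 normr0 expr0n mulr0.
have B0 : 0 <= B by apply: le_trans (Bg i i 0).
have -> : p (i :: s) = v 0 i *: e i + p s by rewrite /p big_cons.
have LE : L (i :: s) = `|v 0 i| + L s by rewrite /L big_cons.
have [c cv E] := MVT_line (p s + u) (v 0 i) (dg i).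
rewrite -(addrA (v 0 i *: e i)) big_cons.
set S := \sum_(j <- s) _ in IH *.
have -> : g (v 0 i *: e i + (p s + u)) - g u - (v 0 i * partial i g u + S) =
  v 0 i * (partial i g ((c *: e i + p s) + u) - partial i g u) +
  (g (p s + u) - g u - S).
  by rewrite -[c *: _ + _ + _]addrA mulrBr -E; ring.
apply: le_trans (ler_normD _ _) _.
have H : `|partial i g (c *: e i + p s + u) - partial i g u| <= B * L (i :: s).
  have := @lipschitz_weighted (partial i g) 0 B u (c *: e i + p s) (ddg i).
  rewrite !expr0 !mul1r => H; apply: le_trans (H _) _.
    by move=> j y; rewrite mul1r.
  rewrite ler_wpM2l// LE; apply: le_trans (l1D _ _) _.
  by rewrite l1_delta lerD.
rewrite normrM; apply: le_trans (lerD (ler_wpM2l _ H) IH) _ => //.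
(* The slack is the cross term [|v_i| * L s], so the constant [B] reproduces itself. *)
rewrite LE -subr_ge0.
have -> : B * (`|v 0 i| + L s) ^+ 2 - (`|v 0 i| * (B * (`|v 0 i| + L s)) + B * L s ^+ 2) =
  B * (`|v 0 i| * L s) by ring.
by rewrite !mulr_ge0.
Qed.

Lemma l1_le_norm v : l1 v <= n%:R * `|v|.
Proof.
rewrite /l1 -[X in X%:R]card_ord -sum1_card natr_sum mulr_suml ler_sum// => i _.
rewrite mul1r [leRHS]/Num.norm/= mx_normrE; apply/bigmax_geP; right => /=.
by exists (0, i).
Qed.

Lemma norm_le_l1 v : `|v| <= l1 v.
Proof.
rewrite /Num.norm/= mx_normrE; apply/bigmax_leP; split => [|[p q] _] /=.
  exact: l1_ge0.
by rewrite (ord1 p) coord_le_l1.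
Qed.

Lemma lipschitz_continuous g B :
  (forall x v, `|g (v + x) - g x| <= B * l1 v) -> continuous g.
Proof.
move=> H x; apply/(@cvgrPdist_le _ _ _ (nbhs x) (nbhs_filter x)) => /= eps eps0.
have B0 : 0 < `|B| * n%:R + 1 by rewrite ltr_wpDl// mulr_ge0.
near=> y; have := H x (y - x); rewrite subrK distrC => Hy.
apply: le_trans Hy _.
apply: (@le_trans _ _ (`|B| * n%:R * `|x - y|)).
  apply: (@le_trans _ _ (`|B| * l1 (y - x))).
    by rewrite ler_wpM2r ?l1_ge0 ?ler_norm.
  by rewrite -mulrA distrC ler_wpM2l ?l1_le_norm.
have : `|x - y| <= eps / (`|B| * n%:R + 1).
  by near: y; apply: cvgr_dist_le; [exact: cvg_id|exact: divr_gt0].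
rewrite ler_pdivlMr// => /(le_trans _); apply.
by rewrite mulrC ler_wpM2l// lerDl.
Unshelve. all: by end_near. Qed.

(** Naming the candidate derivatives in advance yields smoothness and the formula for each of them
    by one induction on the list; sums, affine substitutions, integrals and limits all go through
    this. *)
Lemma smooth_family (F : seq 'I_n -> 'rV[R]_n -> R) :
  (forall s, continuous (F s)) ->
  (forall s i x, is_derive x (e i) (F s) (F (i :: s) x)) ->
  smooth_real (F [::]) /\ forall s, partials s (F [::]) = F s.
Proof.
move=> cF dF; have E s : partials s (F [::]) = F s.
  elim: s => //= i s ->; apply/funext => x.
  by have [_ ] := dF s i x; rewrite /partial.
by split=> // s; rewrite E; split => // i x; have [] := dF s i x.
Qed.

(* Bounds on all candidate derivatives replace any interchange theorem: smoothness
   of integrals and of limits follows from passing the first order Taylor estimate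
   to the integral or to the limit. *)
Lemma smooth_criterion (F : seq 'I_n -> 'rV[R]_n -> R) :
  (forall s, exists B, forall x v, `|F s (v + x) - F s x| <= B * l1 v) ->
  (forall s i, exists B, forall x t,
     `|F s (t *: e i + x) - F s x - t * F (i :: s) x| <= B * t ^+ 2) ->
  smooth_real (F [::]) /\ forall s, partials s (F [::]) = F s.
Proof.
move=> lipF dF; apply: smooth_family => s.
  by have [B] := lipF s; exact: lipschitz_continuous.
by move=> i x; have [B HB] := dF s i; exact: quad_is_derive (HB x).
Qed.

End directional_calculus.

(** * Operations on smooth functions and symmetry of mixed derivatives *)

Section smooth_closure.
Context (R : realType) (n : nat).
Implicit Types (g : 'rV[R]_n -> R) (x u v : 'rV[R]_n) (s t : seq 'I_n).
Local Notation e i := (delta_mx 0 i : 'rV[R]_n).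

Lemma smooth_is_derive g : smooth_real g ->
  forall s i x, is_derive x (e i) (partials s g) (partials (i :: s) g x).
Proof. by move=> sg s i x; apply: DeriveDef => //; have [_ ] := sg s; exact. Qed.

Lemma smooth_derivable g : smooth_real g ->
  forall s i x, derivable (partials s g) x (e i).
Proof. by move=> sg s i x; have [_ ] := sg s; exact. Qed.

Lemma partials_cat s t g : partials (s ++ t) g = partials s (partials t g).
Proof. exact: foldr_cat. Qed.

Lemma smooth_partials g t : smooth_real g -> smooth_real (partials t g).
Proof. by move=> sg s; rewrite -partials_cat. Qed.

Lemma smooth_linear (a b : R) g1 g2 : smooth_real g1 -> smooth_real g2 ->
  let g x := a * g1 x + b * g2 x in
  smooth_real g /\
  forall s, partials s g = fun x => a * partials s g1 x + b * partials s g2 x.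
Proof.
move=> s1 s2 g.
apply: (@smooth_family _ _ (fun s x => a * partials s g1 x + b * partials s g2 x)).
  move=> s x; apply: (@cvgD _ _ _ (nbhs x) (nbhs_filter x));
    apply: (@cvgMl_tmp _ _ (nbhs x) (nbhs_filter x)).
    by have [c1 _] := s1 s; exact: c1.
  by have [c2 _] := s2 s; exact: c2.
move=> s i x.
have d1 := smooth_is_derive s1 s i x; have d2 := smooth_is_derive s2 s i x.
exact: (is_deriveD (is_deriveZ a d1) (is_deriveZ b d2)).
Qed.

(** Restriction to a line makes the one-variable chain rule available for affine substitutions. *)
Lemma is_derive_lineP g i x (d : R) :
  is_derive x (e i) g d <-> is_derive (0 : R) 1 (fun h : R => g (h *: e i + x)) d.
Proof.
have E : (fun h : R => h^-1 *: (((fun h => g (h *: e i + x)) \o shift 0) (h *: (1 : R))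
      - g (0 *: e i + x))) =
    (fun h => h^-1 *: ((g \o shift x) (h *: e i) - g x)).
  by apply/funext => h /=; rewrite [h *: _]mulr1 addr0 scale0r add0r.
by split=> -[H1 H2]; apply: DeriveDef; move: H1 H2; rewrite /derivable /derive E.
Qed.

Lemma is_derive_affine g i v (c : R) x (d : R) :
  is_derive (v + c *: x) (e i) g d ->
  is_derive x (e i) (fun y => g (v + c *: y)) (c * d).
Proof.
move=> /is_derive_lineP dg; apply/is_derive_lineP.
have -> : (fun h : R => g (v + c *: (h *: e i + x))) =
    (fun h : R => g (h *: e i + (v + c *: x))) \o ( *%R c).
  apply/funext => h /=; congr g.
  by rewrite scalerDr scalerA addrCA.
rewrite mulrC; apply: is_derive1_comp; first by rewrite mulr0.
by have := is_deriveZ c (is_derive_id (0 : R) 1); rewrite [c *: _]mulr1.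
Qed.

Lemma smooth_affine g v (c : R) : smooth_real g ->
  let h x := g (v + c *: x) in
  smooth_real h /\
  forall s, partials s h = fun x => c ^+ size s * partials s g (v + c *: x).
Proof.
move=> sg h.
have H := @smooth_family _ _ (fun s x => c ^+ size s * partials s g (v + c *: x)).
have hE : h = fun x => c ^+ 0 * g (v + c *: x).
  by apply/funext => x; rewrite mul1r.
rewrite hE; apply: H.
  move=> s x; apply: (@cvgMl_tmp _ _ (nbhs x) (nbhs_filter x)).
  have [cs _] := sg s.
  apply: (@continuous_comp _ _ _ (fun x => v + c *: x) (partials s g)); last exact: cs.
  apply: (@cvgD _ _ _ (nbhs x) (nbhs_filter x)); first exact: cvg_cst.
  by apply: (@cvgZl_tmp _ _ _ (nbhs x) (nbhs_filter x)); exact: cvg_id.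
move=> s i x; rewrite /= exprSr -mulrA.
apply: is_deriveZ; apply: is_derive_affine; exact: smooth_is_derive.
Qed.

(** Schwarz's theorem: the second difference over a square of side [d] is symmetric in the two
    directions and equals [d ^+ 2] times either mixed derivative at some nearby point; continuity
    then forces equality at [x]. *)
Lemma partial_comm g i j : smooth_real g ->
  partials [:: i; j] g = partials [:: j; i] g.
Proof.
move=> sg; apply/funext => x.
apply/eqP; rewrite -subr_eq0 -normr_le0; apply/ler_addgt0Pl => eps eps0.
rewrite addr0.
have cont s : continuous (partials s g) by have [] := sg s.
have near s : exists2 r : R, 0 < r & forall (a b : R) k l, `|a| <= r -> `|b| <= r ->
    `|partials s g x - partials s g (a *: e k + (b *: e l + x))| <= eps / 2.
  have := @cvgrPdist_le _ _ _ (nbhs x) (nbhs_filter x) (partials s g) (partials s g x).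
  move=> [/(_ (cont s x))/(_ (eps / 2))]; rewrite divr_gt0// => /(_ isT) + _.
  move=> /nbhs_ballP[r /= r0 Hr]; exists (r / 3); first by rewrite divr_gt0.
  move=> a b k l ar br; apply: Hr.
  rewrite -ball_normE/=.
  have -> : x - (a *: e k + (b *: e l + x)) = - (a *: e k + b *: e l).
    by rewrite addrA opprD addrCA subrr addr0.
  rewrite normrN.
  apply: le_lt_trans (norm_le_l1 _) _; apply: le_lt_trans (l1D _ _) _.
  by rewrite !l1_delta; lra.
(* A mean value step in direction [k] is applied to the difference [psi] of [g] in direction [l]; a
   second step, in direction [l], removes the remaining difference. *)
have key k l (t : R) : exists a b : R, [/\ `|a| <= `|t|, `|b| <= `|t| &
    g (t *: e l + (t *: e k + x)) - g (t *: e k + x) - (g (t *: e l + x) - g x)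
    = t * (t * partials [:: l; k] g (a *: e l + (b *: e k + x)))].
  pose psi y := g (t *: e l + y) - g y.
  have dpsi y : is_derive y (e k) psi
      (partial k g (t *: e l + y) - partial k g y).
    have d1 : is_derive y (e k) (fun y => g (t *: e l + 1 *: y)) (1 * partial k g (t *: e l + y)).
      by apply: is_derive_affine; rewrite scale1r; exact: (smooth_is_derive sg [::]).
    have d2 : is_derive y (e k) g (partial k g y) by exact: (smooth_is_derive sg [::]).
    have := is_deriveB d1 d2.
    rewrite mul1r (_ : (_ - _ : _ -> _) = psi)//.
    by apply/funext => z; rewrite /psi !fctE scale1r.
  have [b bt E1] := @MVT_line _ _ psi k x t (fun y => let: DeriveDef d _ := dpsi y in d).
  have dk y : derivable (partial k g) y (e l) by exact: (@smooth_derivable g sg [:: k]).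
  have [a at_ E2] := @MVT_line _ _ (partial k g) l (b *: e k + x) t dk.
  exists a, b; split => //.
  transitivity (psi (t *: e k + x) - psi x); first by [].
  rewrite E1; congr (t * _); rewrite -[RHS]E2.
  by have [_ ] := dpsi (b *: e k + x).
have [r1 r10 Hr1] := near [:: i; j].
have [r2 r20 Hr2] := near [:: j; i].
pose d := Num.min r1 r2.
have d0 : 0 < d by rewrite lt_min r10 r20.
have dr1 : d <= r1 by rewrite ge_min lexx.
have dr2 : d <= r2 by rewrite ge_min lexx orbT.
have [a [b [ad bd E1]]] := key j i d.
have [a' [b' [ad' bd' E2]]] := key i j d.
rewrite (gtr0_norm d0) in ad bd ad' bd'.
have : partials [:: i; j] g (a *: e i + (b *: e j + x)) =
       partials [:: j; i] g (a' *: e j + (b' *: e i + x)).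
  apply: (mulfI (lt0r_neq0 d0)); apply: (mulfI (lt0r_neq0 d0)).
  apply: etrans (esym E1) _; apply: etrans _ E2.
  have swap4 (p q r t : R) : p - q - (r - t) = p - r - (q - t) by ring.
  by rewrite (addrCA (d *: e i)); exact: swap4.
have H1 := Hr1 a b i j (le_trans ad dr1) (le_trans bd dr1).
have H2 := Hr2 a' b' j i (le_trans ad' dr2) (le_trans bd' dr2).
move=> E; rewrite E in H1.
rewrite (splitr eps).
apply: le_trans (lerD H1 H2).
rewrite [X in _ <= _ + X]distrC; apply: le_trans (ler_normD _ _).
by rewrite addrA subrK.
Qed.

End smooth_closure.

(** * Lists of directions against multi-indices *)

Section multi_index.
Context (R : realType) (n : nat).
Implicit Types (g : 'rV[R]_n -> R) (s t : seq 'I_n).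

Lemma partials_cat_cons g s i t : smooth_real g ->
  partials (s ++ i :: t) g = partials (i :: s ++ t) g.
Proof.
move=> sg; elim: s => //= j s ->.
have /= := partial_comm i j (smooth_partials (s ++ t) sg).
by move=> ->.
Qed.

(** Smoothness quantifies over lists of directions in any order, while the seminorms only see the
    sorted lists [multi_seq]. *)
Lemma partials_perm g s t : smooth_real g -> perm_eq s t ->
  partials s g = partials t g.
Proof.
move=> sg; elim: s t => [|i s IH] t st.
  by move: st; rewrite perm_sym => /perm_nilP ->.
have it : i \in t by rewrite -(perm_mem st) mem_head.
case/path.splitPr: it st => t1 t2 st; rewrite partials_cat_cons//=; congr partial.
apply: IH; rewrite -(perm_cons i); apply: perm_trans st _.
by rewrite -cat1s perm_catCA cat1s.
Qed.

Lemma count_multi_seq (alpha : {ffun 'I_n -> nat}) i :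
  count_mem i (multi_seq alpha) = alpha i.
Proof.
rewrite /multi_seq count_flatten -map_comp sumnE big_map.
rewrite (eq_bigr (fun j => (j == i) * alpha j)%N); last first.
  by move=> j _ /=; rewrite count_nseq.
rewrite big_enum/= (bigD1 i)//= eqxx mul1n big1 ?addn0// => j /negPf ->.
by rewrite mul0n.
Qed.

Definition count_index s : {ffun 'I_n -> nat} := [ffun i => count_mem i s].

Lemma perm_count_index s : perm_eq s (multi_seq (count_index s)).
Proof.
by apply/allP => i _ /=; rewrite count_multi_seq ffunE.
Qed.

Lemma size_multi_seq (alpha : {ffun 'I_n -> nat}) :
  size (multi_seq alpha) = (\sum_i alpha i)%N.
Proof.
rewrite /multi_seq size_flatten /shape -map_comp sumnE big_map big_enum/=.
by apply: eq_bigr => i _ /=; rewrite size_nseq.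
Qed.

Lemma partials_count_index g s : smooth_real g ->
  partials s g = partials (multi_seq (count_index s)) g.
Proof. by move=> sg; apply: partials_perm => //; exact: perm_count_index. Qed.

(** There are finitely many such lists: the head is peeled off and the finitely many constants are
    combined into a sum of absolute values, which dominates each of them. *)
Lemma uniform_over_seq (P : seq 'I_n -> R -> Prop) :
  (forall s C D, C <= D -> P s C -> P s D) -> (forall s, exists C, P s C) ->
  forall k, exists C, forall s, (size s <= k)%N -> P s C.
Proof.
move=> homoP PC k; elim: k P homoP PC => [|k IH] P homoP PC.
  by have [C PnC] := PC [::]; exists C => -[].
have H i : exists C, forall s, (size s <= k)%N -> P (i :: s) C.
  by apply: IH => [s|s]; [exact: homoP|exact: PC].
have [C0 P0] := PC [::]; have [C HC] := fin_all_exists H.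
have le_sum i : C i <= `|C0| + \sum_i `|C i|.
  rewrite (bigD1 i)//=; apply: le_trans (ler_norm _) _.
  by rewrite addrCA lerDl addr_ge0// sumr_ge0.
exists (`|C0| + \sum_i `|C i|) => -[_|i s /= sk].
  apply: homoP P0; apply: le_trans (ler_norm _) _.
  by rewrite lerDl sumr_ge0.
exact: homoP (le_sum i) (HC i s sk).
Qed.

End multi_index.

(** * Real Schwartz functions *)

Section real_schwartz.
Context (R : realType) (n : nat).
Implicit Types (g : 'rV[R]_n -> R) (x u v : 'rV[R]_n) (s t : seq 'I_n) (M : nat).
Local Notation e i := (delta_mx 0 i : 'rV[R]_n).

(** Plays the role of the seminorms. With lists of directions, differentiation is concatenation, and
    the explicit constant keeps its dependence on parameters visible. *)
Definition weighted_bound g M s (C : R) := forall x, W x ^+ M * `|partials s g x| <= C.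

Definition rschwartz g := smooth_real g /\ forall M s, exists C, weighted_bound g M s C.

Lemma bnd_ge0 g M s C : weighted_bound g M s C -> 0 <= C.
Proof. by move=> /(_ 0); apply: le_trans; rewrite mulr_ge0 ?WX_ge0. Qed.

Lemma bnd_le g M s (C D : R) : C <= D -> weighted_bound g M s C -> weighted_bound g M s D.
Proof. by move=> CD H x; exact: le_trans (H x) CD. Qed.

Lemma rsch_uniform g : rschwartz g -> forall M k,
  exists C, forall s, (size s <= k)%N -> weighted_bound g M s C.
Proof.
move=> [_ Hg] M k.
by apply: (@uniform_over_seq _ _ (weighted_bound g M)) => // s C D; exact: bnd_le.
Qed.

Lemma rsch_partials g t : rschwartz g -> rschwartz (partials t g).
Proof.
move=> [sg Hg]; split; first exact: smooth_partials.
by move=> M s; have [C HC] := Hg M (s ++ t); exists C; rewrite /weighted_bound -partials_cat.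
Qed.

Lemma bnd_linear (a b : R) g1 g2 M s C1 C2 :
  smooth_real g1 -> smooth_real g2 -> weighted_bound g1 M s C1 -> weighted_bound g2 M s C2 ->
  weighted_bound (fun x => a * g1 x + b * g2 x) M s (`|a| * C1 + `|b| * C2).
Proof.
move=> s1 s2 H1 H2 x.
have [_ ->] := smooth_linear a b s1 s2.
apply: le_trans (ler_wpM2l (WX_ge0 _ _) (ler_normD _ _)) _.
rewrite !normrM mulrDr (mulrCA _ `|a|) (mulrCA _ `|b|).
by apply: lerD; rewrite ler_wpM2l// ?H1 ?H2.
Qed.

Lemma rsch_linear (a b : R) g1 g2 : rschwartz g1 -> rschwartz g2 ->
  rschwartz (fun x => a * g1 x + b * g2 x).
Proof.
move=> [s1 H1] [s2 H2]; split; first by have [] := smooth_linear a b s1 s2.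
move=> M s; have [C1 B1] := H1 M s; have [C2 B2] := H2 M s.
by exists (`|a| * C1 + `|b| * C2); exact: bnd_linear.
Qed.

Let zero : 'rV[R]_n -> R := fun=> 0.

Lemma smooth_zero : smooth_real zero /\ forall s, partials s zero = zero.
Proof.
by apply: (@smooth_family _ _ (fun=> zero)) => s; exact: cst_continuous.
Qed.

Lemma rsch0 : rschwartz (fun=> 0 : R).
Proof.
split=> [|M s]; first by case: smooth_zero.
by exists 0 => x; case: smooth_zero => _ ->; rewrite normr0 mulr0.
Qed.

Lemma rschB g1 g2 : rschwartz g1 -> rschwartz g2 -> rschwartz (fun x => g1 x - g2 x).
Proof.
move=> /(rsch_linear 1 (-1)) H /H; congr rschwartz; apply/funext => x.
by rewrite mul1r mulN1r.
Qed.

Lemma rschD g1 g2 : rschwartz g1 -> rschwartz g2 -> rschwartz (fun x => g1 x + g2 x).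
Proof.
move=> /(rsch_linear 1 1) H /H; congr rschwartz; apply/funext => x.
by rewrite !mul1r.
Qed.

Lemma rschZ (c : R) g : rschwartz g -> rschwartz (fun x => c * g x).
Proof.
move=> /(rsch_linear c 0) /(_ rsch0); congr rschwartz; apply/funext => x.
by rewrite mul0r addr0.
Qed.

Lemma rsch_sum (I : Type) (r : seq I) (c : I -> R) (F : I -> 'rV[R]_n -> R) :
  (forall i, rschwartz (F i)) -> rschwartz (fun x => \sum_(i <- r) c i * F i x).
Proof.
move=> HF; elim: r => [|i r IH].
  by under eq_fun do rewrite big_nil; exact: rsch0.
by under eq_fun do rewrite big_cons; apply: rschD => //; exact: rschZ.
Qed.

Lemma partials_sum (I : Type) (r : seq I) (c : I -> R) F s :
  (forall i, rschwartz (F i)) -> forall x : 'rV[R]_n,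
  partials s (fun x => \sum_(i <- r) c i * F i x) x = \sum_(i <- r) c i * partials s (F i) x.
Proof.
move=> HF; elim: r => [|i r IH] x.
  under eq_fun do rewrite big_nil.
  by rewrite big_nil; have [_ /(_ s) ->] := smooth_zero.
have [_ E] := smooth_linear (c i) 1 (HF i).1 (rsch_sum r c HF).1.
rewrite big_cons -IH -[X in _ + X]mul1r -[RHS](congr1 (@^~ x) (E s)).
by congr partials; apply/funext => y; rewrite big_cons mul1r.
Qed.

Lemma partialsB g1 g2 s x : smooth_real g1 -> smooth_real g2 ->
  partials s (fun x => g1 x - g2 x) x = partials s g1 x - partials s g2 x.
Proof.
move=> s1 s2; have [_ /(_ s)] := smooth_linear 1 (-1) s1 s2.
under eq_fun do rewrite mul1r mulN1r.
by move=> ->; rewrite mul1r mulN1r.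
Qed.

Lemma smoothB g1 g2 : smooth_real g1 -> smooth_real g2 ->
  smooth_real (fun x => g1 x - g2 x).
Proof.
move=> s1 s2; have [+ _] := smooth_linear 1 (-1) s1 s2.
by under eq_fun do rewrite mul1r mulN1r.
Qed.

(** Decay is known in terms of [u = v + c x]. Since [x = c^-1 (u - v)], the weight at [x] is at most
    a constant times the weight at [u]. *)
Lemma rsch_affine g v (c : R) : c != 0 -> rschwartz g -> rschwartz (fun x => g (v + c *: x)).
Proof.
move=> c0 [sg Hg]; have [sh hE] := smooth_affine v c sg.
split=> // M s; have [C HC] := Hg M s.
exists ((1 + `|c^-1|) ^+ M * W v ^+ M * (`|c| ^+ size s * C)) => x.
rewrite hE normrM normrX; set u := v + c *: x.
have Wx : W x ^+ M <= (1 + `|c^-1|) ^+ M * W v ^+ M * W u ^+ M.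
  have -> : x = c^-1 *: (- v + u).
    by rewrite /u addKr scalerA mulVf// scale1r.
  rewrite -mulrA -exprMn -exprMn lerXn2r ?nnegrE ?W_ge0 ?mulr_ge0 ?W_ge0//.
  apply: (@le_trans _ _ ((1 + `|c^-1|) * W (- v + u))).
    set z := - v + u; rewrite /W l1Z -subr_ge0.
    rewrite (_ : _ - _ = l1 z + `|c^-1|); last by ring.
    by rewrite addr_ge0// l1_ge0.
  by rewrite ler_wpM2l ?addr_ge0// -(WN v) WD.
apply: le_trans (ler_wpM2r _ Wx) _; first by rewrite mulr_ge0 ?exprn_ge0.
rewrite -[leLHS]mulrA (mulrCA (W u ^+ M)) ler_wpM2l ?mulr_ge0 ?exprn_ge0 ?W_ge0 ?addr_ge0//.
by rewrite ler_wpM2l ?exprn_ge0.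
Qed.

Lemma rsch_lipschitz g M s B u v : smooth_real g ->
  (forall i, weighted_bound g M (i :: s) B) ->
  W u ^+ M * `|partials s g (v + u) - partials s g u| <= B * (W v ^+ M * l1 v).
Proof.
move=> sg HB; apply: lipschitz_weighted => [i x|i x].
  exact: (@smooth_derivable _ _ g sg).
exact: HB.
Qed.

Lemma rsch_taylor2 g s B u v : smooth_real g ->
  (forall i j, weighted_bound g 0 (j :: i :: s) B) ->
  `|partials s g (v + u) - partials s g u - \sum_i v 0 i * partials (i :: s) g u|
    <= B * l1 v ^+ 2.
Proof.
move=> sg HB; apply: taylor2 => [i x|i j x|i j x].
- exact: (@smooth_derivable _ _ g sg).
- exact: (@smooth_derivable _ _ g sg (i :: s)).
- by have := HB i j x; rewrite mul1r.
Qed.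

Lemma rsch_lipschitz_bound g s : rschwartz g -> exists B, forall x v,
  `|partials s g (v + x) - partials s g x| <= B * l1 v.
Proof.
move=> /[dup] -[sg _] /rsch_uniform /(_ 0 (size s).+1)[B HB].
exists B => x v.
have := @rsch_lipschitz g 0 s B x v sg; rewrite !expr0 !mul1r; apply => i.
exact: HB.
Qed.

Lemma rsch_taylor2_bound g s : rschwartz g -> exists2 B, 0 <= B & forall u v,
  `|partials s g (v + u) - partials s g u - \sum_i v 0 i * partials (i :: s) g u|
    <= B * l1 v ^+ 2.
Proof.
move=> /[dup] -[sg _] /rsch_uniform /(_ 0 (size s).+2)[B HB].
exists B; first by apply: bnd_ge0 (HB [::] _).
by move=> u v; apply: rsch_taylor2 => // i j; exact: HB.
Qed.

Lemma sum_delta_coord (t : R) i (F : 'I_n -> R) :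
  \sum_j (t *: e i) 0 j * F j = t * F i.
Proof.
rewrite (bigD1 i)//= big1 ?addr0; first by rewrite !mxE !eqxx mulr1.
by move=> j ji; rewrite !mxE (negPf ji) andbF mulr0 mul0r.
Qed.

Lemma rsch_taylor2_line g s i : rschwartz g -> exists B, forall x (t : R),
  `|partials s g (t *: e i + x) - partials s g x - t * partials (i :: s) g x|
    <= B * t ^+ 2.
Proof.
move=> /(@rsch_taylor2_bound g s)[B _ HB]; exists B => x t.
have := HB x (t *: e i); rewrite sum_delta_coord l1_delta.
by rewrite real_normK ?num_real.
Qed.

End real_schwartz.

(** * Integration over R^n *)

Section affine_change_of_variable.
Context (R : realType).
Local Open Scope ereal_scope.
Local Notation leb := (@lebesgue_measure R).

Lemma measurable_affine (v c : R) :
  measurable_fun setT (fun x : measurableTypeR R => (v + c * x)%R : measurableTypeR R).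
Proof.
apply: (@continuous_measurable_fun R (fun x : R => (v + c * x)%R)) => x.
by apply: cvgD; [exact: cvg_cst|apply: cvgMl_tmp; exact: cvg_id].
Qed.

Let affine_measure (v c : R) := mscale (NngNum (normr_ge0 c))
  (measure_function_pushforward__canonical__measure_function_Measure leb
     (measurable_affine v c)).

(** Lebesgue measure is determined by its values on half-open intervals. A negative [c] swaps the
    ends, so the preimage is closed on the other side, but its length is the same. *)
Lemma lebesgue_measure_affine (v c : R) : c != 0%R ->
  forall A, measurable A -> leb A = affine_measure v c A.
Proof.
move=> c0; apply: (@lebesgue_measure_unique _ (affine_measure v c)).
move=> _ [[a b]] _ <-.
change (leb `]a, b] = `|c|%:E * leb ((fun x : R => v + c * x)%R @^-1` `]a, b]%classic)).
have [cp|cn] := ltP 0%R c.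
  rewrite (_ : _ @^-1` _ = `](a - v) / c, (b - v) / c]%classic)%R; last first.
    apply/seteqP; split => x /=; rewrite !in_itv/=;
      by rewrite ltr_pdivrMr// ler_pdivlMr// ltrBlDl lerBrDl [(c * x)%R]mulrC.
  rewrite gtr0_norm// !lebesgue_measure_itv /= !lte_fin ltr_pM2r ?invr_gt0//.
  rewrite ltrD2r; case: ifPn => _; last by rewrite mule0.
  by rewrite -!EFinB -EFinM; congr EFin; field.
have {}cn : (c < 0)%R by rewrite lt_neqAle c0.
rewrite (_ : _ @^-1` _ = `[(b - v) / c, (a - v) / c[%classic)%R; last first.
  apply/seteqP; split => x /=; rewrite !in_itv/=;
    by rewrite ltr_ndivlMr// ler_ndivrMr// ltrBlDl lerBrDl [(c * x)%R]mulrC andbC.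
rewrite ltr0_norm// !lebesgue_measure_itv /= !lte_fin ltr_nM2r ?invr_lt0//.
rewrite ltrD2r; case: ifPn => _; last by rewrite mule0.
by rewrite -!EFinB -EFinM; congr EFin; field.
Qed.

Lemma ge0_integral_affine (v c : R) (g : R -> \bar R) : c != 0%R ->
  measurable_fun setT g -> (forall x, 0 <= g x) ->
  \int[leb]_x g x = `|c|%:E * \int[leb]_x g (v + c * x)%R.
Proof.
move=> c0 mg g0.
transitivity (\int[affine_measure v c]_x g x).
  by apply: eq_measure_integral => A mA _; exact: lebesgue_measure_affine.
rewrite ge0_integral_mscale//=.
congr (_ * _).
rewrite (@ge0_integral_pushforward _ _ _ _ _ _ (measurable_affine v c))//=.
Qed.

End affine_change_of_variable.

(** * Product integrals: Tonelli, affine substitution, an integrable majorant *)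

Section tuple_integral.
Context (R : realType).
Local Open Scope ereal_scope.
Local Notation leb := (@lebesgue_measure R).
Local Notation tup n := (n.-tuple (measurableTypeR R)).

Lemma ge0_integral_lebesgue_tupleS n (F : tup n.+1 -> \bar R) :
  measurable_fun setT F -> (forall t, 0 <= F t) ->
  \int[lebesgue_tuple R n.+1]_t F t =
  \int[leb]_x \int[lebesgue_tuple R n]_t F (cons_pair (x, t)).
Proof.
move=> mF F0; rewrite [LHS](@ge0_integral_pushforward _ _ _ _ _ _ (@measurable_cons_pair R n))//.
rewrite preimage_setT (@fubini_tonelli1 _ _ _ _ _ leb (lebesgue_tuple R n))//.
  by apply: measurableT_comp => //; exact: measurable_cons_pair.
by move=> x /=; exact: F0.
Qed.

End tuple_integral.

Section tuple_affine.
Context (R : realType).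
Local Open Scope ereal_scope.
Local Notation leb := (@lebesgue_measure R).
Local Notation tup n := (n.-tuple (measurableTypeR R)).

Definition affine_tuple n (v : 'I_n -> R) (c : R) (t : tup n) : tup n :=
  mktuple (fun i => (v i + c * tnth t i)%R : measurableTypeR R).

Lemma tnth_cons_pair0 n (x : R) (t : tup n) : tnth (cons_pair (x, t)) ord0 = x.
Proof. by []. Qed.

Lemma tnth_cons_pairS n (x : R) (t : tup n) i :
  tnth (cons_pair (x, t)) (lift ord0 i) = tnth t i.
Proof. exact: tnthS. Qed.

Lemma affine_tuple_cons n (v : 'I_n.+1 -> R) (c x : R) (t : tup n) :
  affine_tuple v c (cons_pair (x, t)) =
  cons_pair ((v ord0 + c * x)%R, affine_tuple (v \o lift ord0) c t).
Proof.
apply: eq_from_tnth => i; rewrite tnth_mktuple.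
case: (unliftP ord0 i) => [j ->|->]; last by rewrite !tnth_cons_pair0.
by rewrite !tnth_cons_pairS tnth_mktuple.
Qed.

Lemma measurable_affine_tuple n (v : 'I_n -> R) (c : R) :
  measurable_fun setT (affine_tuple v c).
Proof.
apply/measurable_fun_tnthP => i.
rewrite (_ : _ \o _ = (fun x : measurableTypeR R => (v i + c * x)%R : measurableTypeR R)
    \o (fun t : tup n => tnth t i)).
  by apply: measurableT_comp; [exact: measurable_affine|exact: measurable_tnth].
by apply/funext => t /=; rewrite tnth_mktuple.
Qed.

Lemma measurable_integral_cons_pair n (F : tup n.+1 -> \bar R) :
  measurable_fun setT F -> (forall t, 0 <= F t) ->
  measurable_fun setT (fun x => \int[lebesgue_tuple R n]_t F (cons_pair (x, t))).
Proof.
move=> mF F0.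
apply: (@measurable_fun_fubini_tonelli_F _ _ _ _ _ (lebesgue_tuple R n)
  (fun p => F (cons_pair p))) => //.
by apply: measurableT_comp => //; exact: measurable_cons_pair.
Qed.

(** Induction on the dimension with Tonelli: each coordinate contributes a factor [|c|]. *)
Lemma ge0_integral_affine_tuple n (v : 'I_n -> R) (c : R) (F : tup n -> \bar R) :
  c != 0%R -> measurable_fun setT F -> (forall t, 0 <= F t) ->
  \int[lebesgue_tuple R n]_t F t =
  (`|c| ^+ n)%:E * \int[lebesgue_tuple R n]_t F (affine_tuple v c t).
Proof.
move=> c0; elim: n v F => [|n IH] v F mF F0.
  rewrite expr0 mul1e; apply: eq_integral => t _; congr F.
  by rewrite [RHS]tuple0 [LHS]tuple0.
have mFa : measurable_fun setT (fun t => F (affine_tuple v c t)).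
  by apply: measurableT_comp => //; exact: measurable_affine_tuple.
have mFx x : measurable_fun setT (fun t => F (cons_pair (x, t))).
  apply: measurableT_comp => //.
  apply: measurableT_comp; [exact: measurable_cons_pair|exact: pair1_measurable].
rewrite !ge0_integral_lebesgue_tupleS//.
rewrite (ge0_integral_affine (v ord0) c0); last 2 first.
- exact: measurable_integral_cons_pair.
- by move=> x; exact: integral_ge0.
rewrite exprS EFinM -muleA; congr (_ * _).
rewrite -ge0_integralZl_EFin//; last 2 first.
- by move=> x _; exact: integral_ge0.
- exact: (@measurable_integral_cons_pair n (fun t => F (affine_tuple v c t))).
apply: eq_integral => x _.
rewrite (IH (v \o lift ord0))//; congr (_ * _).
by apply: eq_integral => t _; rewrite affine_tuple_cons.
Qed.

Let oneDsqrV_ge0 (x : R) : (0 <= (oneDsqr x)^-1)%R.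
Proof. by rewrite invr_ge0; exact: (le_trans ler01 (oneDsqr_ge1 x)). Qed.

Lemma measurable_oneDsqrV : measurable_fun setT (fun x : R => ((oneDsqr x)^-1)%:E).
Proof.
apply/measurable_EFinP; apply: continuous_measurable_fun.
exact: continuous_oneDsqrV.
Qed.

Lemma integral_oneDsqrV_lty : \int[leb]_x ((oneDsqr x)^-1)%:E < +oo.
Proof.
rewrite ge0_symfun_integralT//=.
- rewrite (_ : [set x | _] = `[0%R, +oo[%classic); last first.
    by apply/seteqP; split => x/=; rewrite in_itv/= andbT.
  by rewrite integral0y_oneDsqr -EFinM ltry.
- exact: continuous_oneDsqrV.
- by move=> x; rewrite /= /oneDsqr sqrrN.
Qed.

Lemma measurable_prod_oneDsqrV n : measurable_fun setT
  (fun t : tup n => (\prod_i (oneDsqr (tnth t i : R))^-1)%:E).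
Proof.
apply/measurable_EFinP; apply: measurable_prod => i _.
apply: (@measurableT_comp _ _ _ _ _ _ (fun x : R => (oneDsqr x)^-1)%R).
  by apply/measurable_EFinP; exact: measurable_oneDsqrV.
exact: measurable_tnth.
Qed.

(** The integral factorises into [n] copies of the finite integral of [1 / (1 + x^2)]. The product
    is the majorant behind the integrability of the inverse weight. *)
Lemma integral_prod_oneDsqrV_lty n :
  \int[lebesgue_tuple R n]_t (\prod_i (oneDsqr (tnth t i : R))^-1)%:E < +oo.
Proof.
have p0 m (t : tup m) : (0 <= \prod_i (oneDsqr (tnth t i : R))^-1)%R.
  by exact: prodr_ge0.
elim: n => [|n IH].
  under eq_integral do rewrite big_ord0.
  by rewrite integral_cst//= mul1e diracE in_setT ltry.
rewrite ge0_integral_lebesgue_tupleS; last 2 first.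
- exact: measurable_prod_oneDsqrV.
- by move=> t; rewrite lee_fin.
set J := \int[lebesgue_tuple R n]_t _ in IH.
have J0 : 0 <= J by apply: integral_ge0 => t _; rewrite lee_fin.
rewrite [ltLHS](_ : _ = \int[leb]_x (J * ((oneDsqr x)^-1)%:E)); last first.
  apply: eq_integral => x _; rewrite muleC -ge0_integralZl_EFin//; last 2 first.
  - by move=> t _; rewrite lee_fin.
  - exact: measurable_prod_oneDsqrV.
  apply: eq_integral => t _; rewrite big_ord_recl EFinM tnth_cons_pair0.
  by congr (_ * (_)%:E); apply: eq_bigr => i _; rewrite tnth_cons_pairS.
have Jf : J \is a fin_num by rewrite ge0_fin_numE.
have J0' : (0 <= fine J)%R by exact: fine_ge0.
rewrite -(fineK Jf) ge0_integralZl_EFin//; last exact: measurable_oneDsqrV.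
by rewrite lte_mul_pinfty// integral_oneDsqrV_lty.
Qed.

End tuple_affine.

(** * Measurability through rounding to a finite grid *)

Section rV_measurability.
Context (R : realType) (n : nat).
Implicit Types (f g : 'rV[R]_n -> R) (x v : 'rV[R]_n).
Local Notation tup := (n.-tuple (measurableTypeR R)).

Definition row_of_tuple (t : tup) : 'rV[R]_n := \row_i tnth t i.

Definition measurable_rV f := measurable_fun [set: tup] (f \o row_of_tuple).

Lemma mrv_cst (c : R) : measurable_rV (fun=> c). Proof. exact: measurable_cst. Qed.

Lemma mrvD f g : measurable_rV f -> measurable_rV g -> measurable_rV (fun x => f x + g x).
Proof. exact: measurable_funD. Qed.

Lemma mrvB f g : measurable_rV f -> measurable_rV g -> measurable_rV (fun x => f x - g x).
Proof. exact: measurable_funB. Qed.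

Lemma mrvM f g : measurable_rV f -> measurable_rV g -> measurable_rV (fun x => f x * g x).
Proof. exact: measurable_funM. Qed.

Lemma mrv_norm f : measurable_rV f -> measurable_rV (fun x => `|f x|).
Proof. by move=> mf; apply: (measurableT_comp _ mf). Qed.

Lemma mrv_coord i : measurable_rV (fun x => x 0 i).
Proof.
rewrite /measurable_rV (_ : _ \o _ = fun t : tup => tnth t i : R); first exact: measurable_tnth.
by apply/funext => t; rewrite /= mxE.
Qed.

Lemma mrv_sum (I : Type) (r : seq I) (F : I -> 'rV[R]_n -> R) :
  (forall i, measurable_rV (F i)) -> measurable_rV (fun x => \sum_(i <- r) F i x).
Proof.
move=> mF; elim: r => [|i r IH].
  by under eq_fun do rewrite big_nil; exact: mrv_cst.
by under eq_fun do rewrite big_cons; exact: mrvD.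
Qed.

Lemma mrv_prod (I : Type) (r : seq I) (F : I -> 'rV[R]_n -> R) :
  (forall i, measurable_rV (F i)) -> measurable_rV (fun x => \prod_(i <- r) F i x).
Proof.
move=> mF; elim: r => [|i r IH].
  by under eq_fun do rewrite big_nil; exact: mrv_cst.
by under eq_fun do rewrite big_cons; exact: mrvM.
Qed.

Lemma mrvX f k : measurable_rV f -> measurable_rV (fun x => f x ^+ k).
Proof.
move=> mf; elim: k => [|k IH].
  by under eq_fun do rewrite expr0; exact: mrv_cst.
by under eq_fun do rewrite exprS; exact: mrvM.
Qed.

Lemma mrv_l1 : measurable_rV (@l1 R n).
Proof.
apply: (@mrv_sum _ (index_enum _) (fun i x => `|x 0 i|)) => i.
by apply: (@mrv_norm (fun x => x 0 i)); exact: mrv_coord.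
Qed.

Lemma mrv_WX M : measurable_rV (fun x => W x ^+ M).
Proof. by apply: mrvX; apply: mrvD; [exact: mrv_cst|exact: mrv_l1]. Qed.

Lemma row_affine_tuple v (c : R) t :
  row_of_tuple (affine_tuple (v 0) c t) = v + c *: row_of_tuple t.
Proof. by apply/rowP => i; rewrite /row_of_tuple !mxE tnth_mktuple. Qed.

Lemma mrv_affine f v (c : R) : measurable_rV f -> measurable_rV (fun x => f (v + c *: x)).
Proof.
move=> mf; rewrite /measurable_rV.
rewrite (_ : _ \o _ = (f \o row_of_tuple) \o affine_tuple (v 0) c).
  by apply: measurableT_comp mf _; exact: measurable_affine_tuple.
by apply/funext => t /=; rewrite row_affine_tuple.
Qed.

(* [k] is both the inverse of the mesh and the cut-off, so that [round1 k] takes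
   finitely many values. *)
Definition round1 (k : nat) (s : R) : R :=
  if `|s| <= k%:R then (Num.floor (k%:R * s))%:~R / k%:R else 0.

(** The multiples of [1 / k] between [-k] and [k]; the shift by [k * k] lets an ordinal index
    them. *)
Definition grid_point k (j : 'I_(k * k + k * k).+1) : R :=
  (j%:R - (k * k)%:R) / k%:R.

Arguments grid_point : clear implicits.

Definition round k x : 'rV[R]_n := \row_i round1 k (x 0 i).

Lemma measurable_round1 k : measurable_fun [set: R] (round1 k).
Proof.
apply: measurable_fun_ifT; last exact: measurable_cst.
- by apply: measurable_fun_ler => //; exact: measurable_cst.
- apply: nondecreasing_measurable => // s t st.
  rewrite ler_wpM2r ?invr_ge0// ler_int le_floor// ler_wpM2l//.
Qed.

Lemma round1_grid k s : (0 < k)%N -> exists j, round1 k s = grid_point k j.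
Proof.
move=> k0; have k0' : 0 < k%:R :> R by rewrite ltr0n.
rewrite /round1 /grid_point; case: ifPn => sk; last first.
  have kk : (k * k < (k * k + k * k).+1)%N by rewrite ltnS leq_addr.
  by exists (Ordinal kk); rewrite subrr mul0r.
set z := Num.floor _.
have zl : - (k * k)%:Z <= z.
  rewrite floor_ge_int rmorphN/= -pmulrn natrM -mulrN ler_pM2l//.
  by rewrite lerNl; move: sk; rewrite ler_norml lerNl => /andP[].
have zu : z <= (k * k)%:Z.
  rewrite -(ler_int R) (le_trans (floor_le _))// -pmulrn natrM ler_pM2l//.
  by move: sk; rewrite ler_norml => /andP[].
have /gez0_abs zE : 0 <= z + (k * k)%:Z by rewrite -lerBlDr sub0r.
have zk : (`|(z + (k * k)%:Z)%R|%N < (k * k + k * k).+1)%N.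
  by rewrite ltnS -lez_nat zE PoszD lerD2r.
exists (Ordinal zk) => /=; congr (_ / _).
by rewrite -[X in X - _]/((Posz `|(z + (k * k)%:Z)%R|%N)%:~R) zE intrD addrK.
Qed.

Lemma grid_point_inj k : (0 < k)%N -> injective (grid_point k).
Proof.
move=> k0 i j /(mulIf _) ij; apply/val_inj/eqP; rewrite -(eqr_nat R); apply/eqP.
by apply: (addIr (- (k * k)%:R)); apply: ij; rewrite invr_eq0 pnatr_eq0 -lt0n.
Qed.

(** Within the cut-off the floor errs by at most [1 / k]. Beyond it the rounded value is 0, and
    [|s| > k] gives [|s| <= |s|^2 / k]: the quadratic weight pays for the cut-off. *)
Lemma round1_dist k s : (0 < k)%N -> `|s - round1 k s| <= (1 + `|s|) ^+ 2 / k%:R.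
Proof.
move=> k0; have k0' : 0 < k%:R :> R by rewrite ltr0n.
rewrite ler_pdivlMr// /round1; case: ifPn => sk.
  rewrite -[X in _ * X <= _](gtr0_norm k0') -normrM mulrBl divfK ?gt_eqF// [s * _]mulrC.
  have /andP[h1 h2] := floor_itv (k%:R * s).
  rewrite ger0_norm ?subr_ge0//.
  apply: (@le_trans _ _ 1); first by move: h2; rewrite intrD; lra.
  by rewrite exprn_ege1// lerDl.
rewrite subr0 expr2; apply: ler_pM => //; first by rewrite lerDr.
by rewrite -ltNge in sk; rewrite (le_trans (ltW sk))// lerDr.
Qed.

Lemma round_dist k x : (0 < k)%N -> l1 (x - round k x) <= n%:R / k%:R * W x ^+ 2.
Proof.
move=> k0; have k0' : 0 < k%:R :> R by rewrite ltr0n.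
rewrite -mulrA mulr_natl -[X in _ *+ X]card_ord -sumr_const ler_sum// => i _.
rewrite !mxE; apply: le_trans (round1_dist _ k0) _.
rewrite mulrC ler_pM2l ?invr_gt0// lerXn2r ?nnegrE ?W_ge0 ?addr_ge0//.
by rewrite lerD2l coord_le_l1.
Qed.

(** The indicator of the points rounded to [grid_row k j], as a product so that measurability can be
    checked coordinate by coordinate. *)
Definition grid_cell k (j : {ffun 'I_n -> 'I_(k * k + k * k).+1}) x : R :=
  \prod_i (if round1 k (x 0 i) == grid_point k (j i) then 1 else 0).

Definition grid_row k (j : {ffun 'I_n -> 'I_(k * k + k * k).+1}) : 'rV[R]_n :=
  \row_i grid_point k (j i).

Arguments grid_cell : clear implicits.
Arguments grid_row : clear implicits.

(** Rounding takes finitely many values, so any [F] whatsoever becomes a finite combination of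
    indicators. *)
Lemma comp_roundE (F : 'rV[R]_n -> R) k x : (0 < k)%N ->
  F (round k x) = \sum_j grid_cell k j x * F (grid_row k j).
Proof.
move=> k0; have [j jE] := fin_all_exists (fun i => round1_grid (x 0 i) k0).
rewrite (bigD1 (finfun j))//= [X in _ + X]big1 ?addr0.
  rewrite /grid_cell big1 ?mul1r; last by move=> i _; rewrite ffunE jE eqxx.
  by congr F; apply/rowP => i; rewrite !mxE ffunE jE.
move=> j' jj'; have [i ij] : exists i, j' i != j i.
  apply/existsP; rewrite -negb_forall; apply: contra jj' => /forallP H.
  by apply/eqP/ffunP => i; rewrite ffunE; exact/eqP.
rewrite /grid_cell (bigD1 i)//= jE ifN ?mul0r//.
by rewrite (inj_eq (grid_point_inj k0)) eq_sym.
Qed.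

Lemma mrv_grid_cell k j : measurable_rV (grid_cell k j).
Proof.
apply: mrv_prod => i; apply: measurable_fun_ifT; [|exact: measurable_cst..].
apply: measurable_fun_eqr; last exact: measurable_cst.
apply: (measurableT_comp (measurable_round1 k)); exact: mrv_coord.
Qed.

Lemma grid_cell_le1 k j x : `|grid_cell k j x| <= 1.
Proof.
rewrite normr_prod; apply: prodr_ile1 => i _; rewrite normr_ge0/=.
by case: ifP => _; rewrite ?normr1 ?normr0.
Qed.

(** [f] is the pointwise limit of its compositions with rounding, each a finite combination of
    measurable indicators. *)
Lemma mrv_continuous f : continuous f -> measurable_rV f.
Proof.
move=> cf; apply: (@measurable_fun_cvg _ _ _ _
    (fun k => (fun x => f (round k.+1 x)) \o row_of_tuple)).
  move=> k; rewrite (_ : (fun x => _) = fun x =>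
    \sum_j grid_cell k.+1 j x * f (grid_row k.+1 j)).
    by apply: mrv_sum => j; apply: mrvM; [exact: mrv_grid_cell|exact: mrv_cst].
  by apply/funext => x; exact: comp_roundE.
move=> t _ /=; set x := row_of_tuple t.
suff H : (fun k : nat => round k.+1 x) @ \oo --> x by exact: (cvg_comp _ _ H (cf x)).
apply/cvgrPdist_le => /= eps eps0.
(* Once the mesh parameter exceeds [c], the rounding error at [x] is below [eps]. *)
pose c := n%:R * W x ^+ 2 / eps.
have c0 : 0 <= c by rewrite /c divr_ge0 ?mulr_ge0 ?exprn_ge0 ?W_ge0 ?(ltW eps0)//.
exists (Num.bound c) => // k /= ck.
apply: le_trans (norm_le_l1 _) _; apply: le_trans (round_dist _ _) _ => //.
rewrite mulrAC ler_pdivrMr ?ltr0n// [eps * _]mulrC -ler_pdivrMr// -/c.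
apply: le_trans (ltW (archi_boundP c0)) _.
by rewrite ler_nat (leq_trans ck).
Qed.

End rV_measurability.
Arguments grid_cell {R n} k j x.
Arguments grid_row {R n} k j.

(** * Integrable functions on R^n and linear changes of variable *)

Section rV_integral.
Context (R : realType) (n : nat).
Implicit Types (f g h k : 'rV[R]_n -> R) (x v z : 'rV[R]_n).
Local Notation I := (@integral_rV R n).
Local Notation tup := (n.-tuple (measurableTypeR R)).
Local Notation lebn := (lebesgue_tuple R n).

Definition integrable_rV f := lebn.-integrable setT (fun t => (f (row_of_tuple t))%:E).

Lemma irv_mrv f : integrable_rV f -> measurable_rV f.
Proof. by move=> /integrableP[/measurable_EFinP]. Qed.

Lemma irvD f g : integrable_rV f -> integrable_rV g -> integrable_rV (fun x => f x + g x).
Proof. by move=> fi gi; exact: (integrableD _ fi gi). Qed.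

Lemma irvZ (c : R) f : integrable_rV f -> integrable_rV (fun x => c * f x).
Proof. by move=> fi; exact: (integrableZl _ c fi). Qed.

Lemma irvB f g : integrable_rV f -> integrable_rV g -> integrable_rV (fun x => f x - g x).
Proof.
move=> fi gi; under eq_fun do rewrite -mulN1r.
by apply: irvD => //; exact: irvZ.
Qed.

Lemma irv_le f g :
  measurable_rV f -> integrable_rV g -> (forall x, `|f x| <= g x) -> integrable_rV f.
Proof.
move=> mf gi fg; apply: le_integrable gi => //.
  exact/measurable_EFinP.
by move=> t _ /=; rewrite lee_fin (le_trans (fg _))// ler_norm.
Qed.

Lemma irv_norm f : integrable_rV f -> integrable_rV (fun x => `|f x|).
Proof. by move=> fi; exact: (integrable_norm fi). Qed.

Lemma irv0 : integrable_rV (fun=> 0).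
Proof. exact: integrable0. Qed.

Lemma irv_sum (J : Type) (r : seq J) (F : J -> 'rV[R]_n -> R) :
  (forall j, integrable_rV (F j)) -> integrable_rV (fun x => \sum_(j <- r) F j x).
Proof.
move=> Fi; elim: r => [|j r IH].
  by under eq_fun do rewrite big_nil; exact: irv0.
by under eq_fun do rewrite big_cons; exact: irvD.
Qed.

Lemma intD f g : integrable_rV f -> integrable_rV g -> I (fun x => f x + g x) = I f + I g.
Proof. by move=> fi gi; exact: RintegralD. Qed.

Lemma intB f g : integrable_rV f -> integrable_rV g -> I (fun x => f x - g x) = I f - I g.
Proof. by move=> fi gi; exact: RintegralB. Qed.

Lemma intZ (c : R) f : integrable_rV f -> I (fun x => c * f x) = c * I f.
Proof. by move=> fi; exact: RintegralZl. Qed.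

Lemma int0 : I (fun=> 0) = 0.
Proof.
rewrite -[RHS](mul0r (I (fun=> 0))) -(intZ 0 irv0).
by congr I; apply/funext => x; rewrite mul0r.
Qed.

Lemma int_sum (J : Type) (r : seq J) (F : J -> 'rV[R]_n -> R) :
  (forall j, integrable_rV (F j)) ->
  I (fun x => \sum_(j <- r) F j x) = \sum_(j <- r) I (F j).
Proof.
move=> Fi; elim: r => [|j r IH].
  by under [in LHS]eq_fun do rewrite big_nil; rewrite int0 big_nil.
under [in LHS]eq_fun do rewrite big_cons.
by rewrite intD ?IH ?big_cons//; exact: irv_sum.
Qed.

Lemma int_le f g : integrable_rV f -> integrable_rV g -> (forall x, f x <= g x) -> I f <= I g.
Proof. by move=> fi gi fg; apply: le_Rintegral => // t _; exact: fg. Qed.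

Lemma int_ge0 f : (forall x, 0 <= f x) -> 0 <= I f.
Proof. by move=> f0; apply: Rintegral_ge0 => t _; exact: f0. Qed.

Lemma int_norm f : integrable_rV f -> `|I f| <= I (fun x => `|f x|).
Proof. by move=> fi; exact: le_normr_Rintegral. Qed.

Lemma int_norm_le f g : measurable_rV f -> integrable_rV g -> (forall x, `|f x| <= g x) ->
  `|I f| <= I g.
Proof.
move=> mf gi fg; have fi := irv_le mf gi fg.
by apply: le_trans (int_norm fi) _; apply: int_le => //; exact: irv_norm.
Qed.

(** Each factor satisfies [1 + x_i^2 <= (1 + |x_i|)^2 <= W x ^+ 2], so two powers of the weight per
    coordinate suffice. *)
Lemma irv_weight : integrable_rV (fun x => (W x ^+ (n + n))^-1).
Proof.
have pi : integrable_rV (fun x => \prod_i (oneDsqr (x 0 i))^-1).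
  apply/integrableP; split.
    rewrite (_ : (fun t => _) =
        fun t : tup => (\prod_i (oneDsqr (tnth t i : R))^-1)%:E).
      exact: measurable_prod_oneDsqrV.
    by apply/funext => t; congr EFin; apply: eq_bigr => i _; rewrite mxE.
  apply: le_lt_trans (integral_prod_oneDsqrV_lty R n).
  apply: ge0_le_integral => //=.
  - apply/measurable_EFinP; apply: (@mrv_norm R n (fun x => \prod_i (oneDsqr (x 0 i))^-1)).
    apply: (@mrv_prod R n _ _ (fun i x => (oneDsqr (x 0 i))^-1)) => i.
    have mo : measurable_fun setT (fun s : R => (oneDsqr s)^-1).
      by apply: continuous_measurable_fun; exact: continuous_oneDsqrV.
    exact: (measurableT_comp mo (mrv_coord i)).
  - exact: measurable_prod_oneDsqrV.
  - move=> t _; rewrite lee_fin ger0_norm.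
      by apply: ler_prod => i _; rewrite mxE invr_ge0 lexx (le_trans ler01 (oneDsqr_ge1 _)).
    by apply: prodr_ge0 => i _; rewrite invr_ge0 (le_trans ler01 (oneDsqr_ge1 _)).
apply: irv_le pi _.
  have mi : measurable_fun [set: R] (fun s => ((1 + `|s|) ^+ (n + n))^-1).
    apply: continuous_measurable_fun => s; apply: cvgV.
      by rewrite expf_neq0// gt_eqF// ltr_pwDl.
    apply: (@continuous_comp _ _ _ (fun s : R => 1 + `|s|) (fun s => s ^+ (n + n))).
      by apply: cvgD; [exact: cvg_cst|exact: norm_continuous].
    exact: exprn_continuous.
  have := measurableT_comp mi (@mrv_l1 R n).
  congr (measurable_fun _ _); apply/funext => t /=.
  by rewrite /W (ger0_norm (l1_ge0 _)).
move=> x; rewrite ger0_norm ?invr_ge0 ?WX_ge0//.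
rewrite prodfV lef_pV2 ?posrE ?WX_gt0//; last first.
  by apply: prodr_gt0 => i _; rewrite (lt_le_trans ltr01 (oneDsqr_ge1 _)).
rewrite addnn -mul2n exprM -[X in _ ^+ X]card_ord -prodr_const.
apply: ler_prod => i _; rewrite (le_trans ler01 (oneDsqr_ge1 _))/= /oneDsqr.
apply: (@le_trans _ _ ((1 + `|x 0 i|) ^+ 2)).
  rewrite sqrrD expr1n mul1r real_normK ?num_real// lerD2r lerDl.
  by rewrite mulrn_wge0.
by rewrite lerXn2r ?nnegrE ?W_ge0 ?addr_ge0// lerD2l coord_le_l1.
Qed.

Lemma irv_decay f C :
  measurable_rV f -> (forall x, W x ^+ (n + n) * `|f x| <= C) -> integrable_rV f.
Proof.
move=> mf fC; apply: (irv_le mf (irvZ C irv_weight)) => x.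
by rewrite ler_pdivlMr ?WX_gt0// mulrC.
Qed.

Lemma irv_affine f v (c : R) :
  c != 0 -> integrable_rV f -> integrable_rV (fun x => f (v + c *: x)).
Proof.
move=> c0 fi; have mf := irv_mrv fi; apply/integrableP; split.
  by apply/measurable_EFinP; exact: mrv_affine.
move/integrableP : fi => [_].
rewrite (ge0_integral_affine_tuple (v 0) c0)//; last first.
  apply: measurableT_comp => //; exact/measurable_EFinP.
under eq_integral do rewrite row_affine_tuple.
set J := (X in (_ * X)%E) => H; rewrite -/J in H *.
(* Were the transformed integral infinite, its product with the positive [|c| ^+ n] would be
   infinite too. *)
rewrite ltey; apply/eqP => Jy; move: H; rewrite Jy.
by rewrite gt0_muley ?lte_fin ?exprn_gt0 ?normr_gt0.
Qed.

Lemma int_affine f v (c : R) : c != 0 -> integrable_rV f ->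
  I f = `|c| ^+ n * I (fun x => f (v + c *: x)).
Proof.
move=> c0.
have ge0 g : integrable_rV g -> (forall x, 0 <= g x) ->
    I g = `|c| ^+ n * I (fun x => g (v + c *: x)).
  move=> gi g0; have gi' := irv_affine v c0 gi.
  rewrite /integral_rV /Rintegral -[`|c| ^+ n]/(fine (`|c| ^+ n)%:E) -fineM//; last first.
    exact: (integrable_fin_num _ gi').
  congr fine; rewrite (ge0_integral_affine_tuple (v 0) c0).
  - by congr (_ * _)%E; apply: eq_integral => t _; rewrite -row_affine_tuple.
  - by apply/measurable_EFinP; exact: irv_mrv gi.
  - by move=> t; rewrite lee_fin.
move=> fi.
(* The formula for nonnegative functions is applied to the positive and the negative part of [f]. *)
pose p x := 2^-1 * (`|f x| + f x); pose q x := 2^-1 * (`|f x| - f x).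
have pi : integrable_rV p by apply: irvZ; apply: irvD => //; exact: irv_norm.
have qi : integrable_rV q by apply: irvZ; apply: irvB => //; exact: irv_norm.
have p0 x : 0 <= p x by rewrite mulr_ge0// -lerBlDr sub0r -normrN ler_norm.
have q0 x : 0 <= q x by rewrite mulr_ge0// subr_ge0 ler_norm.
have fE : f = fun x => p x - q x by apply/funext => x; rewrite /p /q; field.
rewrite fE intB// (ge0 p)// (ge0 q)// -mulrBr intB//; exact: irv_affine.
Qed.

Lemma int_reflect f v : integrable_rV f -> I f = I (fun x => f (v - x)).
Proof.
move=> fi; rewrite (int_affine v (_ : -1 != 0) fi) ?oppr_eq0 ?oner_eq0//.
rewrite normrN1 expr1n mul1r; congr I; apply/funext => x.
by rewrite scaleN1r.
Qed.

End rV_integral.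

(** * Rapidly decreasing kernels and their absolute moments *)

Section rapid_decay.
Context (R : realType) (n : nat).
Implicit Types (f g h k : 'rV[R]_n -> R) (x v z : 'rV[R]_n) (M : nat).
Local Notation I := (@integral_rV R n).

(** No smoothness is asked of a kernel, as derivatives always fall on the other factor. The class is
    therefore stable under multiplication by coordinates and by indicators of grid cells, and under
    absolute values. *)
Definition rapidly_decreasing k :=
  measurable_rV k /\ forall M, exists C, forall x, W x ^+ M * `|k x| <= C.

Lemma rsch_continuous g : rschwartz g -> continuous g.
Proof. by move=> [/(_ [::])[]]. Qed.

Lemma rsch_mrv g : rschwartz g -> measurable_rV g.
Proof. by move=> /rsch_continuous; exact: mrv_continuous. Qed.

Lemma rsch_rd g : rschwartz g -> rapidly_decreasing g.
Proof.
move=> gs; split; first exact: rsch_mrv.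
by move=> M; have [_ /(_ M [::])] := gs.
Qed.

Lemma rd_irv k : rapidly_decreasing k -> integrable_rV k.
Proof. by move=> [mk /(_ (n + n)%N)[C HC]]; exact: irv_decay HC. Qed.

Lemma rdM k h M C :
  rapidly_decreasing k -> measurable_rV h -> (forall x, `|h x| <= C * W x ^+ M) ->
  rapidly_decreasing (fun x => k x * h x).
Proof.
move=> [mk Hk] mh hC; split; first exact: mrvM.
move=> N; have [D HD] := Hk (N + M)%N; exists (D * C) => x.
rewrite normrM mulrA.
apply: le_trans (ler_wpM2l _ (hC x)) _; first by rewrite mulr_ge0 ?WX_ge0.
have C0 : 0 <= C.
  by have := le_trans (normr_ge0 _) (hC x); rewrite pmulr_lge0 ?WX_gt0.
by rewrite mulrCA [leRHS]mulrC ler_wpM2l// mulrAC -exprD.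
Qed.

Lemma rdM_bounded k h C : rapidly_decreasing k -> measurable_rV h -> (forall x, `|h x| <= C) ->
  rapidly_decreasing (fun x => k x * h x).
Proof.
by move=> kd mh hC; apply: (@rdM k h 0 C) => // x; rewrite expr0 mulr1.
Qed.

Lemma rd_norm k : rapidly_decreasing k -> rapidly_decreasing (fun x => `|k x|).
Proof.
move=> [mk Hk]; split; first exact: mrv_norm.
by move=> M; have [C HC] := Hk M; exists C => x; rewrite normr_id.
Qed.

Lemma rdW k M : rapidly_decreasing k -> rapidly_decreasing (fun x => `|k x| * W x ^+ M).
Proof.
move=> /rd_norm kd; apply: (rdM (C := 1) kd (mrv_WX M)) => x.
by rewrite mul1r ger0_norm ?WX_ge0.
Qed.

Lemma rd_coord k i : rapidly_decreasing k -> rapidly_decreasing (fun x => k x * x 0 i).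
Proof.
move=> kd; apply: (rdM (C := 1) (M := 1) kd (mrv_coord i)) => x.
by rewrite mul1r expr1 (le_trans (coord_le_l1 _ _)) ?l1_le_W.
Qed.

Definition moment k M := I (fun x => `|k x| * W x ^+ M).

Lemma moment_ge0 k M : 0 <= moment k M.
Proof. by apply: int_ge0 => x; rewrite mulr_ge0 ?WX_ge0. Qed.

Lemma moment_coord k i M :
  rapidly_decreasing k -> moment (fun x => k x * x 0 i) M <= moment k M.+1.
Proof.
move=> kd; apply: int_le => [||x].
- exact/rd_irv/rdW/rd_coord.
- exact/rd_irv/rdW.
rewrite normrM -mulrA ler_wpM2l// exprS ler_wpM2r ?WX_ge0//.
by rewrite (le_trans (coord_le_l1 _ _)) ?l1_le_W.
Qed.

Lemma int_le_moment k h M C : rapidly_decreasing k -> measurable_rV h ->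
  (forall x, `|h x| <= C * W x ^+ M) ->
  `|I (fun x => k x * h x)| <= C * moment k M.
Proof.
move=> kd mh hC.
have kMi := rd_irv (rdW M kd).
rewrite -intZ//; apply: int_norm_le.
- by apply: mrvM => //; case: kd.
- exact: irvZ.
- by move=> x; rewrite normrM mulrCA ler_wpM2l.
Qed.

End rapid_decay.

(** * Regularisation by a rapidly decreasing kernel *)

Section conv.
Context (R : realType) (n : nat).
Implicit Types (f g h k : 'rV[R]_n -> R) (x v z : 'rV[R]_n) (M : nat).
Local Notation I := (@integral_rV R n).
Local Notation e i := (delta_mx 0 i : 'rV[R]_n).

(** For [d != 0] this is convolution with the kernel rescaled by [d]. With the scale placed in the
    argument of [g], it still makes sense at [d = 0], where it is [I k * g x], and a negative [d]
    reflects the kernel. *)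
Definition kconv (d : R) k g x := I (fun z => k z * g (x - d *: z)).

Lemma rsch_bounded g : rschwartz g -> exists2 B, 0 <= B & forall x, `|g x| <= B.
Proof.
move=> [_ /(_ 0 [::])[B HB]]; exists B; first exact: bnd_ge0 HB.
by move=> x; have := HB x; rewrite mul1r.
Qed.

Lemma mrv_shift (d : R) g x : measurable_rV g -> measurable_rV (fun z => g (x - d *: z)).
Proof.
by move=> mg; have := mrv_affine x (- d) mg; under eq_fun do rewrite scaleNr.
Qed.

Lemma rsch_mrv_shift (d : R) g x : rschwartz g -> measurable_rV (fun z => g (x - d *: z)).
Proof. by move=> gs; apply: mrv_shift; exact: rsch_mrv. Qed.

Lemma rd_conv (d : R) k g x :
  rapidly_decreasing k -> rschwartz g -> rapidly_decreasing (fun z => k z * g (x - d *: z)).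
Proof.
move=> kd gs; have [B _ HB] := rsch_bounded gs.
by apply: (rdM_bounded (C := B) kd) => //; exact: rsch_mrv_shift.
Qed.

Lemma irv_conv (d : R) k g x :
  rapidly_decreasing k -> rschwartz g -> integrable_rV (fun z => k z * g (x - d *: z)).
Proof. by move=> kd gs; exact/rd_irv/rd_conv. Qed.

(** The Lipschitz and Taylor bounds of [g] are integrated against [|k|]; the constants involve only
    the zeroth absolute moment of the kernel. *)
Lemma smooth_conv (d : R) k g : rapidly_decreasing k -> rschwartz g ->
  smooth_real (kconv d k g) /\
  forall s, partials s (kconv d k g) = kconv d k (partials s g).
Proof.
move=> kd gs; pose F s := kconv d k (partials s g).
have gps s : rschwartz (partials s g) by exact: rsch_partials.
apply: (@smooth_criterion _ _ F) => [s|s i].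
  have [B HB] := rsch_lipschitz_bound s gs; exists (B * moment k 0) => x v.
  rewrite /F /kconv -intB; [|exact: irv_conv..].
  under eq_fun do rewrite -mulrBr.
  rewrite mulrAC; apply: int_le_moment => //.
    by apply: mrvB; exact: rsch_mrv_shift.
  by move=> z; rewrite mulr1 -addrA; exact: HB.
have [B HB] := rsch_taylor2_line s i gs; exists (B * moment k 0) => x t.
rewrite /F /kconv -intB; [|exact: irv_conv..].
rewrite -intZ; last exact: (@irv_conv d k (partials (i :: s) g)).
rewrite -intB; last 2 first.
- by apply: irvB; exact: irv_conv.
- by apply: irvZ; exact: (@irv_conv d k (partials (i :: s) g)).
under eq_fun do rewrite -mulrBr mulrCA -mulrBr.
rewrite mulrAC; apply: int_le_moment => //.
  apply: mrvB; first by apply: mrvB; exact: rsch_mrv_shift.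
  apply: mrvM; first exact: mrv_cst.
  exact: (@rsch_mrv_shift d (partials (i :: s) g)).
by move=> z; rewrite mulr1 -(addrA (t *: _) x); exact: HB.
Qed.

Lemma partials_conv (d : R) k g s : rapidly_decreasing k -> rschwartz g ->
  partials s (kconv d k g) = kconv d k (partials s g).
Proof. by move=> kd gs; have [_ ->] := smooth_conv d kd gs. Qed.

(** The weight splits as [W x <= W (x - d z) * W (d z)]: the first factor goes to [g], the second to
    the kernel, and [|d| <= 1] makes the bound independent of [d]. *)
Lemma conv_weighted (d : R) k g M C : rapidly_decreasing k -> rschwartz g -> `|d| <= 1 ->
  weighted_bound g M [::] C -> forall x, W x ^+ M * `|kconv d k g x| <= C * moment k M.
Proof.
move=> kd gs d1 HC x.
rewrite mulrC -ler_pdivlMr ?WX_gt0// mulrAC; apply: int_le_moment => //.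
  exact: rsch_mrv_shift.
move=> z; rewrite mulrAC ler_pdivlMr ?WX_gt0//.
have C0 := bnd_ge0 HC.
apply: (@le_trans _ _ (`|g (x - d *: z)| * (W (x - d *: z) ^+ M * W z ^+ M))).
  rewrite ler_wpM2l//; apply: (@le_trans _ _ (W ((x - d *: z) + d *: z) ^+ M)).
    by rewrite subrK.
  by apply: le_trans (WXD _ _ _) _; rewrite ler_wpM2l ?WX_ge0// W_scale_le.
rewrite mulrA ler_wpM2r ?WX_ge0// mulrC; exact: HC.
Qed.

Lemma bnd_conv (d : R) k g M s C : rapidly_decreasing k -> rschwartz g -> `|d| <= 1 ->
  weighted_bound g M s C -> weighted_bound (kconv d k g) M s (C * moment k M).
Proof.
move=> kd gs d1 HC x; rewrite partials_conv//.
by apply: conv_weighted => //; exact: rsch_partials.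
Qed.

Lemma rsch_conv (d : R) k g :
  rapidly_decreasing k -> rschwartz g -> `|d| <= 1 -> rschwartz (kconv d k g).
Proof.
move=> kd gs d1; split; first by have [] := smooth_conv d kd gs.
move=> M s; have [_ /(_ M s)[C HC]] := gs.
by exists (C * moment k M); exact: bnd_conv.
Qed.

Lemma conv0 k g x : rapidly_decreasing k -> kconv 0 k g x = I k * g x.
Proof.
move=> kd; rewrite mulrC -intZ; last exact: rd_irv.
by congr I; apply/funext => z; rewrite scale0r subr0 mulrC.
Qed.

(** Lists are used instead of multi-indices so that multiplying the kernel by a coordinate only
    lengthens the list. *)
Definition vanishing_moments k :=
  forall s, s != [::] -> I (fun z => k z * \prod_(i <- s) z 0 i) = 0.

(** The Taylor estimate of [g] at [x - t d z] with increment [- r d z] is integrated in [z]. Its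
    remainder is quadratic in [z], hence the second moment in the constant. *)
Lemma is_derive_conv_scale (d : R) k g x (t : R) : rapidly_decreasing k -> rschwartz g ->
  is_derive t 1 (fun t => kconv (t * d) k g x)
    (- d * \sum_i kconv (t * d) (fun z => k z * z 0 i) (partial i g) x).
Proof.
move=> kd gs; have [B B0 HB] := rsch_taylor2_bound [::] gs.
have gps i : rschwartz (partial i g) by exact: (rsch_partials [:: i]).
have irvi i : integrable_rV (fun z => k z * z 0 i * partial i g (x - (t * d) *: z)).
  by apply: irv_conv => //; exact: rd_coord.
apply: (@quad_is_derive _ _ _ _ _ _ (B * d ^+ 2 * moment k 2)) => r.
rewrite -int_sum// -intZ; last exact: irv_sum.
rewrite /kconv -intB; [|exact: irv_conv..].
rewrite -intZ; last by apply: irvZ; exact: irv_sum.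
rewrite -intB; last 2 first.
- by apply: irvB; exact: irv_conv.
- by do 2 apply: irvZ; exact: irv_sum.
rewrite [X in `|I X|](_ : _ = fun z => k z * (g ((- (r * d)) *: z + (x - (t * d) *: z))
    - g (x - (t * d) *: z)
    - \sum_i (- (r * d)) * (z 0 i * partial i g (x - (t * d) *: z)))); last first.
  apply/funext => z; rewrite !mulrBr mulr_sumr; congr (k z * g _ - _ - _).
    by rewrite [r *: _]mulr1 mulrDl scalerDl opprD addrCA scaleNr.
  rewrite mulr_sumr mulr_sumr; apply: eq_bigr => i _; ring.
rewrite (_ : B * d ^+ 2 * moment k 2 * r ^+ 2 = B * (r * d) ^+ 2 * moment k 2); last by ring.
apply: int_le_moment => //.
  apply: mrvB.
    apply: mrvB; last exact: rsch_mrv_shift.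
    rewrite (_ : (fun z => _) = fun z => g (x - (r * d + t * d) *: z)).
      exact: rsch_mrv_shift.
    by apply/funext => z; rewrite [in RHS]scalerDl opprD addrCA scaleNr.
  apply: mrv_sum => i; apply: mrvM; first exact: mrv_cst.
  by apply: mrvM; [exact: mrv_coord|exact: rsch_mrv_shift].
move=> z; have := HB (x - (t * d) *: z) ((- (r * d)) *: z).
under eq_bigr do rewrite mxE -mulrA.
move=> /le_trans; apply; rewrite -mulrA ler_wpM2l//.
rewrite l1Z exprMn normrN real_normK ?num_real// ler_wpM2l ?sqr_ge0//.
by rewrite lerXn2r ?nnegrE ?W_ge0 ?l1_ge0 ?l1_le_W.
Qed.

(* Differentiating in [d] replaces [k] by the kernels [k z_i], all of whose moments
   vanish, the zeroth one included: hence an induction on the order [K]. *)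
Lemma conv_vanishing_moments K k g M B :
  rapidly_decreasing k -> rschwartz g -> vanishing_moments k ->
  0 <= B -> (forall s, size s = K -> weighted_bound g M s B) ->
  forall (d : R) x, `|d| <= 1 ->
  W x ^+ M * `|kconv d k g x - I k * g x| <=
    2 * `|d| ^+ K * n%:R ^+ K * B * moment k (M + K).
Proof.
elim: K k g => [|K IH] k g kd gs k0 B0 HB d x d1.
  (* At order 0 there is no cancellation: the factor 2 comes from bounding the two terms
     separately. *)
  have HB0 := HB [::] erefl.
  rewrite !expr0 !mulr1 addn0 -mulrA mulr2n mulrDl mul1r.
  apply: le_trans (ler_wpM2l (WX_ge0 _ _) (ler_normB _ _)) _.
  rewrite mulrDr lerD//; first exact: conv_weighted.
  rewrite normrM mulrCA mulrC; apply: ler_pM => //.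
  - by rewrite mulr_ge0 ?WX_ge0.
  - apply: le_trans (int_norm (rd_irv kd)) _; apply: int_le => [||z].
    + exact/irv_norm/rd_irv.
    + exact/rd_irv/rdW.
    + by rewrite ler_peMr ?WX_ge1.
(* [E] runs from [I k * g x] at 0 to the convolution at 1, so their difference is the derivative of
   [E] at some [c] in between. *)
pose E (t : R) := kconv (t * d) k g x.
have dE (t : R) := is_derive_conv_scale d x t kd gs.
have cE : {within `[0, 1], continuous E}.
  apply: continuous_subspaceT => t; apply: differentiable_continuous.
  by apply/derivable1_diffP; have [] := dE t.
have [c /andP[]] := @MVT_segment R E _ 0 1 ler01 (fun t _ => dE t) cE.
rewrite !bnd_simp => c0 c1.
rewrite /E mul0r conv0// mul1r subr0 mulr1 => ->.
rewrite normrM normrN mulrCA.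
have cd : `|c * d| <= `|d| by rewrite normrM (ger0_norm c0) ler_piMl.
have bound i : W x ^+ M * `|kconv (c * d) (fun z => k z * z 0 i) (partial i g) x| <=
    2 * `|d| ^+ K * n%:R ^+ K * B * moment k (M + K.+1).
  have kid := rd_coord i kd.
  have gis : rschwartz (partial i g) by exact: (rsch_partials [:: i]).
  have ki0 : vanishing_moments (fun z => k z * z 0 i).
    move=> s _; have := k0 (i :: s) isT.
    by under eq_fun do rewrite big_cons mulrA.
  have Iki0 : I (fun z => k z * z 0 i) = 0.
    have := k0 [:: i] isT.
    by under eq_fun do rewrite big_seq1.
  have HBi s : size s = K -> weighted_bound (partial i g) M s B.
    move=> sK; rewrite /weighted_bound -(partials_cat s [:: i]); apply: HB.
    by rewrite size_cat addn1 sK.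
  have := IH _ _ kid gis ki0 B0 HBi (c * d) x (le_trans cd d1).
  rewrite Iki0 mul0r subr0 => /le_trans; apply.
  rewrite addnS; apply: ler_pM => //.
  - by rewrite !mulr_ge0 ?exprn_ge0.
  - exact: moment_ge0.
  - rewrite ler_wpM2r// ler_wpM2r ?exprn_ge0// ler_wpM2l//.
    by rewrite lerXn2r ?nnegrE.
  - exact: moment_coord.
(* The [n] summands and the factor [d] of the derivative supply the missing power of [n] and of
   [|d|]. *)
apply: (@le_trans _ _ (`|d| * \sum_(i < n) (2 * `|d| ^+ K * n%:R ^+ K * B * moment k (M + K.+1)))).
  rewrite ler_wpM2l//.
  apply: (@le_trans _ _ (W x ^+ M *
      \sum_i `|kconv (c * d) (fun z => k z * z 0 i) (partial i g) x|)).
    by rewrite ler_wpM2l ?WX_ge0// ler_norm_sum.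
  by rewrite mulr_sumr ler_sum.
rewrite sumr_const card_ord -mulr_natr.
by rewrite !exprS le_eqVlt; apply/orP; left; apply/eqP; ring.
Qed.

End conv.

(** * Tempered distributions *)

Section real_functional.
Context (R : realType) (n : nat).
Implicit Types (f g h k : 'rV[R]_n -> R) (x v y z : 'rV[R]_n) (M : nat).
Local Notation I := (@integral_rV R n).

Lemma bnd_conv_approx K k g M B s (d : R) : rapidly_decreasing k -> rschwartz g ->
  vanishing_moments k -> 0 <= B ->
  (forall t, size t = K -> weighted_bound g M (t ++ s) B) -> `|d| <= 1 ->
  weighted_bound (fun x => kconv d k g x - I k * g x) M s
    (2 * `|d| ^+ K * n%:R ^+ K * B * moment k (M + K)).
Proof.
move=> kd gs k0 B0 HB d1 x.
have := smooth_linear 1 (- I k) (smooth_conv d kd gs).1 gs.1.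
under eq_fun do rewrite mul1r mulNr.
move=> [_ ->]; rewrite mul1r mulNr partials_conv//.
apply: conv_vanishing_moments => //; first exact: rsch_partials.
by move=> t tK; rewrite /weighted_bound -partials_cat; exact: HB.
Qed.

Definition translate g x : 'rV[R]_n -> R := fun y => g (y - x).

Lemma smooth_translate g x : smooth_real g ->
  smooth_real (translate g x) /\
  forall s, partials s (translate g x) = translate (partials s g) x.
Proof.
move=> sg.
have E h : translate h x = fun y => h (- x + 1 *: y).
  by apply/funext => y; rewrite scale1r addrC.
have [s1 s2] := smooth_affine (- x) 1 sg.
split=> [|s]; first by rewrite E.
by rewrite !E s2; apply/funext => y; rewrite expr1n mul1r.
Qed.

Lemma bnd_translate g x M s C : smooth_real g -> weighted_bound g M s C ->
  weighted_bound (translate g x) M s (C * W x ^+ M).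
Proof.
move=> sg HC y; have [_ ->] := smooth_translate x sg; rewrite /translate.
apply: (@le_trans _ _ (W x ^+ M * W (y - x) ^+ M * `|partials s g (y - x)|)).
  rewrite ler_wpM2r//; have := WXD x (y - x) M.
  by rewrite addrC subrK.
by rewrite -mulrA mulrC ler_wpM2r ?WX_ge0.
Qed.

Lemma rsch_translate g x : rschwartz g -> rschwartz (translate g x).
Proof.
move=> [sg Hg]; split; first by have [] := smooth_translate x sg.
move=> M s; have [C HC] := Hg M s.
by exists (C * W x ^+ M); exact: bnd_translate.
Qed.

Lemma partials_translate g x s : rschwartz g ->
  partials s (translate g x) = translate (partials s g) x.
Proof. by move=> [sg _]; have [_ ->] := smooth_translate x sg. Qed.

(** The weight passes from [y] to [y - x] at the price [W x ^+ M]; there the weighted Lipschitz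
    bound applies with increment [x - r]. *)
Lemma translate_lipschitz g M s B x r y : rschwartz g ->
  (forall i, weighted_bound g M (i :: s) B) ->
  W y ^+ M * `|translate (partials s g) x y - translate (partials s g) r y| <=
    B * (W x ^+ M * (W (x - r) ^+ M * l1 (x - r))).
Proof.
move=> [sg _] HB; rewrite distrC /translate.
have := rsch_lipschitz (y - x) (x - r) sg HB.
have -> : x - r + (y - x) = y - r by rewrite addrC addrA subrK.
move=> H.
apply: (@le_trans _ _ (W x ^+ M * (W (y - x) ^+ M *
    `|partials s g (y - r) - partials s g (y - x)|))).
  rewrite mulrA ler_wpM2r//; have := WXD x (y - x) M.
  by rewrite addrC subrK.
by rewrite [leRHS]mulrCA ler_wpM2l ?WX_ge0.
Qed.

Definition real_linear (l : ('rV[R]_n -> R) -> R) :=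
  forall (a b : R) g1 g2, rschwartz g1 -> rschwartz g2 ->
    l (fun x => a * g1 x + b * g2 x) = a * l g1 + b * l g2.

Definition real_bounded (l : ('rV[R]_n -> R) -> R) (m : nat) (C : R) :=
  forall g P, rschwartz g -> (forall s, (size s <= m)%N -> weighted_bound g m s P) ->
    `|l g| <= C * P.

Section swap.
Variables (l : ('rV[R]_n -> R) -> R) (m : nat) (C : R).
Hypothesis (l_linear : real_linear l) (l_bounded : real_bounded l m C).
Hypothesis C_ge0 : 0 <= C.

Lemma real_linear0 : l (fun=> 0) = 0.
Proof.
have := l_linear 0 0 (@rsch0 R n) (@rsch0 R n).
by under eq_fun do rewrite mulr0 addr0; rewrite !mul0r addr0.
Qed.

Lemma real_linear_sum (J : Type) (r : seq J) (c : J -> R) F :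
  (forall j, rschwartz (F j)) ->
  l (fun x => \sum_(j <- r) c j * F j x) = \sum_(j <- r) c j * l (F j).
Proof.
move=> HF; elim: r => [|j r IH].
  by rewrite big_nil -[RHS]real_linear0; congr l; apply/funext => x; rewrite big_nil.
have := l_linear (c j) 1 (HF j) (rsch_sum r c HF).
rewrite IH mul1r big_cons => <-; congr l; apply/funext => x.
by rewrite big_cons mul1r.
Qed.

Lemma real_linearB g1 g2 : rschwartz g1 -> rschwartz g2 ->
  l (fun x => g1 x - g2 x) = l g1 - l g2.
Proof.
move=> s1 s2; have := l_linear 1 (-1) s1 s2; rewrite mul1r mulN1r => <-.
by congr l; apply/funext => x; rewrite mul1r mulN1r.
Qed.

Lemma real_linearD g1 g2 : rschwartz g1 -> rschwartz g2 ->
  l (fun x => g1 x + g2 x) = l g1 + l g2.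
Proof.
move=> s1 s2; have := l_linear 1 1 s1 s2; rewrite !mul1r => <-.
by congr l; apply/funext => x; rewrite !mul1r.
Qed.

Lemma functional_translate_lipschitz g : rschwartz g -> exists2 D, 0 <= D &
  forall x r, `|l (translate g x) - l (translate g r)| <=
    D * (W x ^+ m * (W (x - r) ^+ m * l1 (x - r))).
Proof.
move=> gs; have [B HB] := rsch_uniform gs m m.+1.
have B0 : 0 <= B by exact: bnd_ge0 (HB [::] isT).
exists (C * B); first exact: mulr_ge0.
move=> x r; rewrite -real_linearB; [|exact: rsch_translate..].
rewrite -mulrA; apply: l_bounded.
  by apply: rschB; exact: rsch_translate.
move=> s sm y; rewrite partialsB; [|exact: (rsch_translate _ gs).1..].
rewrite !partials_translate//; apply: translate_lipschitz => // i.
exact: HB.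
Qed.

Lemma functional_translate_growth g : rschwartz g -> exists2 D, 0 <= D &
  forall x, `|l (translate g x)| <= D * W x ^+ m.
Proof.
move=> gs; have [B HB] := rsch_uniform gs m m.
have B0 : 0 <= B by exact: bnd_ge0 (HB [::] isT).
exists (C * B); first exact: mulr_ge0.
move=> x; rewrite -mulrA; apply: l_bounded; first exact: rsch_translate.
by move=> s sm; apply: bnd_translate; [case: gs|exact: HB].
Qed.

Lemma mrv_functional_translate g : rschwartz g -> measurable_rV (fun x => l (translate g x)).
Proof.
move=> gs; have [D D0 HD] := functional_translate_lipschitz gs.
apply: mrv_continuous => x.
apply/(@cvgrPdist_le _ _ _ (nbhs x) (nbhs_filter x)) => /= eps eps0.
(* Within distance 1 of [x] the weight of the increment is at most [1 + n], and a factor [n]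
   converts [l1] into the norm. So [c] bounds the local Lipschitz constant; the added 1 keeps it
   positive. *)
pose c := D * (W x ^+ m * ((1 + n%:R) ^+ m * n%:R)) + 1.
have c0 : 0 < c.
  by rewrite ltr_wpDl// !mulr_ge0 ?WX_ge0 ?exprn_ge0 ?addr_ge0.
apply/nbhs_ballP; exists (Num.min 1 (eps / c)).
  by rewrite /= lt_min ltr01 divr_gt0.
move=> y; rewrite -ball_normE/= lt_min => /andP[xy1 xyc].
have l1n : l1 (x - y) <= n%:R * `|x - y| by exact: l1_le_norm.
apply: le_trans (HD _ _) _.
apply: (@le_trans _ _ (c * `|x - y|)); last first.
  by rewrite mulrC -ler_pdivlMr// ltW.
rewrite mulrDl mul1r -[leLHS]addr0; apply: lerD => //.
rewrite -!mulrA; do 2 (rewrite ler_wpM2l ?WX_ge0//).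
apply: ler_pM => //; [exact: WX_ge0|exact: l1_ge0|].
rewrite lerXn2r ?nnegrE ?W_ge0 ?addr_ge0// lerD2l (le_trans l1n)//.
by rewrite ler_piMr// ltW.
Qed.

Lemma rd_functional_translate k g : rapidly_decreasing k -> rschwartz g ->
  rapidly_decreasing (fun x => k x * l (translate g x)).
Proof.
move=> kd gs; have [D _ HD] := functional_translate_growth gs.
exact: (rdM kd (mrv_functional_translate gs) HD).
Qed.

(** The rounding error is at most [n / K * W x ^+ 2]. Under the power [m] the gain [1 / K] is given
    up; only the last factor keeps it. *)
Lemma round_weight K x : (0 < K)%N ->
  W (x - round K x) ^+ m * l1 (x - round K x) <=
  (1 + n%:R) ^+ m * n%:R / K%:R * W x ^+ (2 * m + 2).
Proof.
move=> K0; have H := round_dist x K0.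
have K1 : 1 <= K%:R :> R by rewrite ler1n.
have K0' : 0 < K%:R :> R by rewrite ltr0n.
apply: (@le_trans _ _ (((1 + n%:R) * W x ^+ 2) ^+ m * (n%:R / K%:R * W x ^+ 2))).
  apply: ler_pM => //; [exact: WX_ge0|exact: l1_ge0|].
  have p0 : 0 <= (1 + n%:R) * W x ^+ 2.
    by apply: mulr_ge0; [rewrite addr_ge0|exact: WX_ge0].
  rewrite lerXn2r ?nnegrE ?W_ge0//.
  rewrite mulrDl mul1r lerD ?WX_ge1//; apply: le_trans H _.
  by rewrite ler_wpM2r ?WX_ge0// ler_pdivrMr// ler_peMr.
rewrite exprMn -exprM exprD le_eqVlt; apply/orP; left; apply/eqP; ring.
Qed.

Lemma irv_comp_round k (F : 'rV[R]_n -> R) K : (0 < K)%N -> rapidly_decreasing k ->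
  integrable_rV (fun x => k x * F (round K x)).
Proof.
move=> K0 kd; under eq_fun do rewrite (comp_roundE F _ K0) mulr_sumr.
apply: irv_sum => j; apply: rd_irv.
apply: (@rdM_bounded _ _ k (fun x => grid_cell K j x * F (grid_row K j))
    `|F (grid_row K j)| kd).
  by apply: mrvM; [exact: mrv_grid_cell|exact: mrv_cst].
by move=> x; rewrite normrM ler_piMl// grid_cell_le1.
Qed.

Lemma int_comp_round k (F : 'rV[R]_n -> R) K : (0 < K)%N -> rapidly_decreasing k ->
  I (fun x => k x * F (round K x)) =
  \sum_j I (fun x => k x * grid_cell K j x) * F (grid_row K j).
Proof.
move=> K0 kd.
have ki j : integrable_rV (fun x => k x * grid_cell K j x).
  apply: rd_irv; apply: (@rdM_bounded _ _ k (grid_cell K j) 1 kd); first exact: mrv_grid_cell.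
  by move=> x; exact: grid_cell_le1.
under [in LHS]eq_fun do rewrite (comp_roundE F _ K0) mulr_sumr.
rewrite int_sum => [|j].
  apply: eq_bigr => j _; rewrite mulrC -intZ//; congr I; apply/funext => x; ring.
under eq_fun do rewrite mulrA mulrC.
exact: irvZ.
Qed.

(* Replacing the integration variable by its rounding turns both sides into the
   same finite sum, with an error of order 1/K. *)
Lemma functional_conv k g : rapidly_decreasing k -> rschwartz g ->
  l (kconv 1 k g) = I (fun x => k x * l (translate g x)).
Proof.
move=> kd gs; have [D D0 HD] := functional_translate_lipschitz gs.
have [B HB] := rsch_uniform gs m m.+1.
have B0 : 0 <= B by exact: bnd_ge0 (HB [::] isT).
pose A := (1 + n%:R) ^+ m * n%:R : R.
have A0 : 0 <= A by rewrite mulr_ge0 ?exprn_ge0 ?addr_ge0.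
(* The order of the moment: [m] from moving a translate by [x], and [2 * m + 2] from the weight of
   the rounding error. *)
pose mo := moment k (m + (2 * m + 2)).
have mo0 : 0 <= mo by exact: moment_ge0.
have kL := rd_functional_translate kd gs.
have main K : (0 < K)%N ->
    `|l (kconv 1 k g) - I (fun x => k x * l (translate g x))| <=
    (C * B + D) * A * mo / K%:R.
  move=> K0; have K0' : 0 < K%:R :> R by rewrite ltr0n.
  pose c j := I (fun x => k x * grid_cell K j x).
  pose S y := \sum_j c j * translate g (grid_row K j) y.
  have SE (h : 'rV[R]_n -> R) y :
      \sum_j c j * translate h (grid_row K j) y = I (fun x => k x * h (y - round K x)).
    by rewrite (int_comp_round (fun v => h (y - v)) K0 kd).
  have Ss : rschwartz S by apply: rsch_sum => j; exact: rsch_translate.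
  have lS : l S = I (fun x => k x * l (translate g (round K x))).
    rewrite (int_comp_round (fun v => l (translate g v)) K0 kd).
    by apply: real_linear_sum => j; exact: rsch_translate.
  have pS s y : partials s S y = I (fun x => k x * partials s g (y - round K x)).
    rewrite -SE; have := partials_sum (index_enum _) c s (fun j => rsch_translate (grid_row K j) gs).
    move=> /(_ y) ->; apply: eq_bigr => j _; by rewrite partials_translate.
  have convs : rschwartz (kconv 1 k g) by apply: rsch_conv => //; rewrite normr1.
  have err x r0 : r0 = round K x -> B * (W x ^+ m * (W (x - r0) ^+ m * l1 (x - r0))) <=
      B * A / K%:R * W x ^+ (m + (2 * m + 2)).
    move=> ->; rewrite exprD [leRHS](_ : _ = B * (W x ^+ m * (A / K%:R * W x ^+ (2 * m + 2)))).
      by rewrite ler_wpM2l// ler_wpM2l ?WX_ge0// round_weight.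
    by rewrite [in RHS](mulrCA (W x ^+ m)) !mulrA.
  (* Boundedness of [l] reduces this to the derivatives up to order [m] of the difference. Each is
     estimated under the integral by the Lipschitz bound of translates, which costs one more
     derivative: hence [m.+1] in the choice of [B]. *)
  have h1 : `|l (kconv 1 k g) - l S| <= C * (B * A / K%:R * mo).
    rewrite -real_linearB//; apply: l_bounded; first exact: rschB.
    move=> s sm y; rewrite partialsB ?pS ?partials_conv//; [|by case: convs|by case: Ss].
    have gps : rschwartz (partials s g) by exact: rsch_partials.
    have -> : kconv 1 k (partials s g) y = I (fun x => k x * partials s g (y - x)).
      by congr I; apply/funext => x; rewrite scale1r.
    have irv1 : integrable_rV (fun x => k x * partials s g (y - x)).
      have := irv_conv 1 y kd gps.
      by under eq_fun do rewrite scale1r.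
    rewrite -intB//; last exact: (irv_comp_round (fun v => partials s g (y - v)) K0 kd).
    under eq_fun do rewrite -mulrBr.
    rewrite mulrC -ler_pdivlMr ?WX_gt0//.
    rewrite [leRHS](_ : _ = B * A / K%:R / W y ^+ m * mo); last by rewrite mulrAC.
    apply: int_le_moment => //.
      apply: mrvB.
        have := @rsch_mrv_shift R n 1 _ y gps.
        by under eq_fun do rewrite scale1r.
      under eq_fun do rewrite (comp_roundE (fun v => partials s g (y - v)) _ K0).
      by apply: mrv_sum => j; apply: mrvM; [exact: mrv_grid_cell|exact: mrv_cst].
    move=> x; rewrite mulrAC ler_pdivlMr ?WX_gt0// mulrC.
    apply: le_trans (err x _ erefl).
    by apply: translate_lipschitz => // i; exact: HB.
  (* Here both integrands are numbers, and the Lipschitz bound [HD] of [l (translate g x)] in [x] is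
     enough. *)
  have h2 : `|l S - I (fun x => k x * l (translate g x))| <= D * A / K%:R * mo.
    rewrite lS -intB//; last by apply: rd_irv.
      under eq_fun do rewrite -mulrBr.
      apply: int_le_moment => //.
        apply: mrvB; last exact: mrv_functional_translate.
        under eq_fun do rewrite (comp_roundE (fun v => l (translate g v)) _ K0).
        by apply: mrv_sum => j; apply: mrvM; [exact: mrv_grid_cell|exact: mrv_cst].
      move=> x; rewrite distrC; apply: le_trans (HD _ _) _.
      rewrite exprD [leRHS](_ : _ = D * (W x ^+ m * (A / K%:R * W x ^+ (2 * m + 2)))).
        by rewrite ler_wpM2l// ler_wpM2l ?WX_ge0// round_weight.
      by rewrite [in RHS](mulrCA (W x ^+ m)) !mulrA.
    exact: (irv_comp_round (fun v => l (translate g v)) K0 kd).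
  rewrite -(subrK (l S) (l (kconv 1 k g))) -addrA.
  apply: le_trans (ler_normD _ _) _; apply: le_trans (lerD h1 h2) _.
  rewrite le_eqVlt; apply/orP; left; apply/eqP; ring.
apply/eqP; rewrite -subr_eq0 -normr_le0; apply/ler_addgt0Pl => eps eps0.
rewrite addr0; set c := (C * B + D) * A * mo in main.
have c0 : 0 <= c by rewrite !mulr_ge0// addr_ge0// mulr_ge0.
have e0 : 0 <= c / eps by rewrite divr_ge0// ltW.
apply: le_trans (main (Num.bound (c / eps)).+1 isT) _.
rewrite ler_pdivrMr ?ltr0n// mulrC -ler_pdivrMr//.
by apply: le_trans (ltW (archi_boundP e0)) _; rewrite ler_nat.
Qed.

End swap.
End real_functional.

(** * Completeness of the Schwartz space, with a geometric rate *)

Section limit.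
Context (R : realType) (n : nat).
Implicit Types (f g : 'rV[R]_n -> R) (x v : 'rV[R]_n) (M : nat) (s : seq 'I_n).
Local Notation e i := (delta_mx 0 i : 'rV[R]_n).

Lemma geometric_squeeze (a b c : R) : (forall j : nat, a <= b + c / 2 ^+ j) -> a <= b.
Proof.
move=> H; rewrite leNgt; apply/negP => ba.
have c0 : 0 < c by have := H 0; rewrite expr0 divr1; lra.
have := H (Num.bound (c / (a - b))); apply/negP; rewrite -ltNge.
rewrite -ltrBrDl ltr_pdivrMr ?exprn_gt0// mulrC -ltr_pdivrMr ?subr_gt0//.
apply: lt_le_trans (archi_boundP _) _.
  by rewrite divr_ge0 ?subr_ge0// ltW.
by rewrite -natrX ler_nat ltnW// ltn_expl.
Qed.

(** The intervals of radius [2 * C / 2 ^+ j] about [a j] are nested, the radius being the sum of the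
    remaining increments. The limit is the supremum of their left ends, which gives the rate at
    once. *)
Lemma geometric_limit (a : nat -> R) (C : R) :
  (forall j, `|a j.+1 - a j| <= C / 2 ^+ j) ->
  exists L, forall j, `|L - a j| <= 2 * C / 2 ^+ j.
Proof.
move=> aC; pose lo j := a j - 2 * C / 2 ^+ j; pose hi j := a j + 2 * C / 2 ^+ j.
have half j : 2 * C / 2 ^+ j.+1 = C / 2 ^+ j.
  by rewrite exprS invfM; field; rewrite expf_neq0.
have lo_homo : {homo lo : i j / (i <= j)%N >-> i <= j}.
  apply: homo_leq => [//|? ? ?|j]; first exact: le_trans.
  have := aC j; rewrite /lo half ler_norml => /andP[h _].
  by rewrite -mulrA; lra.
have hi_homo i j : (i <= j)%N -> hi j <= hi i.
  elim: j => [|j IH]; first by rewrite leqn0 => /eqP ->.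
  rewrite leq_eqVlt ltnS => /predU1P[->//|/IH]; apply: le_trans.
  have := aC j; rewrite /hi half ler_norml => /andP[_ h].
  by rewrite -mulrA; lra.
have C0 : 0 <= C by have := le_trans (normr_ge0 _) (aC 0); rewrite expr0 divr1.
have lohi i j : lo i <= hi j.
  apply: le_trans (lo_homo _ _ (leq_maxl i j)) _.
  apply: le_trans _ (hi_homo _ _ (leq_maxr i j)).
  rewrite lerD2l; apply: (@le_trans _ _ 0); first rewrite oppr_le0;
  by rewrite !mulr_ge0 ?invr_ge0 ?exprn_ge0.
exists (sup (range lo)) => j.
have lo_sup : lo j <= sup (range lo).
  by apply: ub_le_sup; [exists (hi 0) => _ [i _ <-]|exists j].
have sup_hi : sup (range lo) <= hi j.
  by apply: ge_sup; [exists (lo 0), 0|move=> _ [i _ <-]].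
by move: lo_sup sup_hi; rewrite /lo /hi ler_norml => h1 h2; apply/andP; lra.
Qed.

(** All derivatives converge pointwise; [smooth_criterion] identifies the limits with the
    derivatives of the limit, as its inequalities pass from [g j] to the limit. *)
Lemma rsch_limit (g : nat -> 'rV[R]_n -> R) :
  (forall j, rschwartz (g j)) ->
  (forall M s, exists C, forall j,
     weighted_bound (fun x => g j.+1 x - g j x) M s (C / 2 ^+ j)) ->
  exists2 f, rschwartz f & forall M s, exists C, forall j,
     weighted_bound (fun x => f x - g j x) M s (C / 2 ^+ j).
Proof.
move=> gs gC.
have gd M s C x : (forall j, weighted_bound (fun x => g j.+1 x - g j x) M s (C / 2 ^+ j)) ->
    forall j, `|partials s (g j.+1) x - partials s (g j) x| <= (C / W x ^+ M) / 2 ^+ j.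
  move=> HC j; rewrite mulrAC ler_pdivlMr ?WX_gt0// mulrC.
  by have := HC j x; rewrite partialsB//; [exact: (gs _).1..].
have [F HF] : exists F : seq 'I_n -> 'rV[R]_n -> R, forall M s, exists C, forall j x,
    W x ^+ M * `|F s x - partials s (g j) x| <= C / 2 ^+ j.
  (* The limit must not depend on the weight. It is taken from exponent 0, and uniqueness of limits
     gives it the rate of every other exponent. *)
  have /choice[F HF] (p : seq 'I_n * 'rV[R]_n) : exists L, forall M C,
      (forall j, weighted_bound (fun x => g j.+1 x - g j x) M p.1 (C / 2 ^+ j)) ->
      forall j, `|L - partials p.1 (g j) p.2| <= 2 * (C / W p.2 ^+ M) / 2 ^+ j.
    case: p => s x /=; have [C0 HC0] := gC 0 s.
    have [L HL] := geometric_limit (gd 0 s C0 x HC0).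
    exists L => M C HC j; have [L' HL'] := geometric_limit (gd M s C x HC).
    suff -> : L = L' by [].
    apply/eqP; rewrite -subr_eq0 -normr_le0.
    apply: (@geometric_squeeze _ _ (2 * (C0 / W x ^+ 0) + 2 * (C / W x ^+ M))) => i.
    rewrite add0r mulrDl; apply: le_trans (lerD (HL i) (HL' i)).
    rewrite (distrC L'); apply: le_trans (ler_normD _ _).
    by rewrite addrA subrK.
  exists (fun s x => F (s, x)) => M s; have [C HC] := gC M s.
  exists (2 * C) => j x; have := HF (s, x) M C HC j => /=.
  by rewrite mulrA mulrAC ler_pdivlMr ?WX_gt0// mulrC.
(* Bounds uniform in [j] are the constants that survive in the inequalities passed to the limit. *)
have gB M s : exists B, forall j, weighted_bound (g j) M s B.
  have [C HC] := HF M s; have [_ /(_ M s)[B HB]] := gs 0.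
  exists (C + C + B) => j x.
  have C0 : 0 <= C.
    have := HC 0 x; rewrite expr0 divr1; apply: le_trans.
    by rewrite mulr_ge0 ?WX_ge0.
  have C2 : C / 2 ^+ j <= C.
    by rewrite ler_pdivrMr ?exprn_gt0// ler_peMr// exprn_ege1// ler1n.
  have -> : partials s (g j) x = - (F s x - partials s (g j) x) +
    (F s x - partials s (g 0) x) + partials s (g 0) x by ring.
  apply: le_trans (ler_wpM2l (WX_ge0 _ _) (ler_normD _ _)) _.
  rewrite mulrDr lerD//; apply: le_trans (ler_wpM2l (WX_ge0 _ _) (ler_normD _ _)) _.
  rewrite mulrDr normrN lerD//; first exact: le_trans (HC j x) C2.
  by have := HC 0 x; rewrite expr0 divr1.
have gBu M k : exists B, forall s, (size s <= k)%N -> forall j, weighted_bound (g j) M s B.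
  apply: (@uniform_over_seq _ _ (fun s B => forall j, weighted_bound (g j) M s B)).
    by move=> s B D BD HB j; exact: bnd_le (HB j).
  exact: gB.
have Fg s : exists C, forall j x, `|F s x - partials s (g j) x| <= C / 2 ^+ j.
  by have [C HC] := HF 0 s; exists C => j x; have := HC j x; rewrite mul1r.
have [sF FE] : smooth_real (F [::]) /\ forall s, partials s (F [::]) = F s.
  apply: smooth_criterion => [s|s i].
    have [B HB] := gBu 0 (size s).+1; have [C HC] := Fg s.
    exists B => x v; apply: (@geometric_squeeze _ _ (C + C)) => j.
    have -> : F s (v + x) - F s x = (partials s (g j) (v + x) - partials s (g j) x) +
      ((F s (v + x) - partials s (g j) (v + x)) - (F s x - partials s (g j) x)) by ring.
    apply: le_trans (ler_normD _ _) _; apply: lerD.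
      have := @rsch_lipschitz _ _ (g j) 0 s B x v (gs j).1.
      by rewrite !expr0 !mul1r; apply => i; exact: HB.
    by apply: le_trans (ler_normB _ _) _; rewrite mulrDl lerD.
  have [B HB] := gBu 0 (size s).+2; have [C HC] := Fg s; have [D HD] := Fg (i :: s).
  exists B => x t; apply: (@geometric_squeeze _ _ (C + C + `|t| * D)) => j.
  set dj := partials s (g j) (t *: e i + x) - partials s (g j) x - t * partials (i :: s) (g j) x.
  have -> : F s (t *: e i + x) - F s x - t * F (i :: s) x = dj +
    ((F s (t *: e i + x) - partials s (g j) (t *: e i + x)) - (F s x - partials s (g j) x)
     - t * (F (i :: s) x - partials (i :: s) (g j) x)) by rewrite /dj; ring.
  apply: le_trans (ler_normD _ _) _; apply: lerD.
    have := @rsch_taylor2 _ _ (g j) s B x (t *: e i) (gs j).1.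
    rewrite sum_delta_coord l1_delta real_normK ?num_real//; apply => k l.
    exact: HB.
  apply: le_trans (ler_normB _ _) _; rewrite !mulrDl lerD//.
    by apply: le_trans (ler_normB _ _) _; rewrite lerD.
  by rewrite normrM -mulrA ler_wpM2l.
have Fs : rschwartz (F [::]).
  split=> // M s; have [C HC] := HF M s; have [B HB] := gB M s.
  exists (C + B) => x; rewrite FE -(subrK (partials s (g 0) x) (F s x)).
  apply: le_trans (ler_wpM2l (WX_ge0 _ _) (ler_normD _ _)) _.
  rewrite mulrDr lerD//; last exact: HB.
  by have := HC 0 x; rewrite expr0 divr1.
exists (F [::]) => // M s; have [C HC] := HF M s; exists C => j x.
by rewrite partialsB ?FE//; exact: (gs j).1.
Qed.

End limit.

Local Open Scope complex_scope.

(** * Complex-valued functions and their seminorms *)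

Section complex_norm.
Context (R : realType).
Implicit Types (z : R[i]).

Lemma normc_Re z : `|complex.Re z| <= Normc.normc z.
Proof.
case: z => a b /=; rewrite -(sqrtr_sqr a) ler_sqrt ?addr_ge0 ?sqr_ge0//.
by rewrite lerDl sqr_ge0.
Qed.

Lemma normc_Im z : `|complex.Im z| <= Normc.normc z.
Proof.
case: z => a b /=; rewrite -(sqrtr_sqr b) ler_sqrt ?addr_ge0 ?sqr_ge0//.
by rewrite lerDr sqr_ge0.
Qed.

Lemma normc_le z : Normc.normc z <= `|complex.Re z| + `|complex.Im z|.
Proof.
case: z => a b /=; rewrite -[leRHS]ger0_norm ?addr_ge0// -sqrtr_sqr.
rewrite ler_sqrt ?sqr_ge0// sqrrD !real_normK ?num_real// lerD2r lerDl.
by rewrite mulrn_wge0// mulr_ge0.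
Qed.

Lemma normc_ge0 z : 0 <= Normc.normc z.
Proof. by case: z => a b /=; exact: sqrtr_ge0. Qed.

Lemma normc_real (a : R) z : Normc.normc (a%:C * z) = `|a| * Normc.normc z.
Proof. by rewrite Normc.normcM /= expr0n/= addr0 sqrtr_sqr. Qed.

Lemma eq_complex_parts z1 z2 : complex.Re z1 = complex.Re z2 ->
  complex.Im z1 = complex.Im z2 -> z1 = z2.
Proof. by case: z1 z2 => [a b] [c d] /= -> ->. Qed.

End complex_norm.

Section seminorms.
Context (R : realType) (n : nat).
Implicit Types (f : 'rV[R]_n -> R[i]) (g : 'rV[R]_n -> R) (x : 'rV[R]_n).
Implicit Types (alpha beta : {ffun 'I_n -> nat}) (s : seq 'I_n) (M : nat).

Definition re_fun f : 'rV[R]_n -> R := fun x => complex.Re (f x).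
Definition im_fun f : 'rV[R]_n -> R := fun x => complex.Im (f x).

Lemma seminorm_leP alpha beta f (C : R) :
  (seminorm alpha beta f <= C%:E)%E <->
  forall x, `|monomial alpha x| * Normc.normc (mderive beta f x) <= C.
Proof.
split=> [H x|H].
  rewrite -lee_fin -normc_real; apply: le_trans H.
  by apply: ereal_sup_ubound; exists x.
by apply: ge_ereal_sup => _ [x _ <-]; rewrite lee_fin normc_real.
Qed.

Lemma seminorm_ge0 alpha beta f : (0 <= seminorm alpha beta f)%E.
Proof.
apply: (@le_trans _ _ (Normc.normc ((monomial alpha 0)%:C * mderive beta f 0))%:E).
  by rewrite lee_fin normc_ge0.
by apply: ereal_sup_ubound; exists 0.
Qed.

Lemma seminorm_lty alpha beta f : (seminorm alpha beta f < +oo)%E ->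
  exists C : R, (seminorm alpha beta f <= C%:E)%E.
Proof.
move=> foo; exists (fine (seminorm alpha beta f)).
by rewrite fineK// ge0_fin_numE// seminorm_ge0.
Qed.

Lemma monomial_le_W alpha x : `|monomial alpha x| <= W x ^+ (\sum_i alpha i).
Proof.
rewrite normr_prod (big_morph _ (exprD (W x)) (expr0 (W x))).
apply: ler_prod => i _; rewrite normr_ge0/= normrX lerXn2r ?nnegrE ?W_ge0//.
exact: le_trans (coord_le_l1 _ _) (l1_le_W _).
Qed.

Definition pure_index M (i : 'I_n) : {ffun 'I_n -> nat} :=
  [ffun j => if j == i then M else 0%N].

Lemma monomial0 x : monomial [ffun=> 0%N] x = 1.
Proof. by rewrite /monomial big1// => i _; rewrite ffunE expr0. Qed.

Lemma monomial_pure M i x : monomial (pure_index M i) x = x 0 i ^+ M.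
Proof.
rewrite /monomial (bigD1 i)//= ffunE eqxx big1 ?mulr1// => j /negPf ji.
by rewrite ffunE ji expr0.
Qed.

(** With [m] the maximum of 1 and the [|x_i|], one has [W x <= (1 + n) * m], and [m ^+ M] is 1 or a
    single [|x_i| ^+ M]. Pure powers thus control every weight. *)
Lemma WX_le_monomials x M :
  W x ^+ M <= (1 + n%:R) ^+ M * (1 + \sum_i `|x 0 i| ^+ M).
Proof.
pose m := \big[Num.max/1]_i `|x 0 i|.
have m1 : 1 <= m by apply/bigmax_geP; left.
have xm i : `|x 0 i| <= m by apply: le_bigmax.
have S0 : 0 <= \sum_i `|x 0 i| ^+ M by apply: sumr_ge0 => i _; rewrite exprn_ge0.
have mS : m ^+ M <= 1 + \sum_i `|x 0 i| ^+ M.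
  rewrite /m; elim/big_ind: _ => [|y z yS zS|i _].
  - by rewrite expr1n lerDl.
  - by rewrite /Num.max; case: ifP.
  - rewrite (bigD1 i)//= addrCA lerDl addr_ge0//.
    by apply: sumr_ge0 => j _; exact: exprn_ge0.
apply: le_trans (ler_wpM2l _ mS); last by rewrite exprn_ge0// addr_ge0.
rewrite -exprMn lerXn2r ?nnegrE ?W_ge0 ?mulr_ge0 ?addr_ge0//.
  exact: le_trans m1.
rewrite /W mulrDl mul1r lerD// mulr_natl -[X in _ *+ X]card_ord -sumr_const.
by rewrite /l1 ler_sum.
Qed.

(** The constant is linear in the bounds on the seminorms, so a common factor such as [eps ^- N] can
    be pulled out when the function varies with [eps]. *)
Lemma bnd_of_seminorms f M s (C0 : R) (C : 'I_n -> R) : smooth f ->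
  (seminorm [ffun=> 0%N] (count_index s) f <= C0%:E)%E ->
  (forall i, seminorm (pure_index M i) (count_index s) f <= (C i)%:E)%E ->
  weighted_bound (re_fun f) M s ((1 + n%:R) ^+ M * (C0 + \sum_i C i)) /\
  weighted_bound (im_fun f) M s ((1 + n%:R) ^+ M * (C0 + \sum_i C i)).
Proof.
move=> [s1 s2] /seminorm_leP H0 H.
have key x (y : R) : `|y| <= Normc.normc (mderive (count_index s) f x) ->
    W x ^+ M * `|y| <= (1 + n%:R) ^+ M * (C0 + \sum_i C i).
  move=> yf; apply: le_trans (ler_wpM2l (WX_ge0 _ _) yf) _.
  apply: le_trans (ler_wpM2r (normc_ge0 _) (WX_le_monomials _ _)) _.
  rewrite -mulrA ler_wpM2l ?exprn_ge0 ?addr_ge0// mulrDl lerD//.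
    by have := H0 x; rewrite monomial0 normr1.
  rewrite mulr_suml ler_sum// => i _; have /seminorm_leP/(_ x) := H i.
  by rewrite monomial_pure normrX.
split=> x; apply: key.
  rewrite (partials_count_index s s1); exact: (normc_Re (mderive _ _ _)).
rewrite (partials_count_index s s2); exact: (normc_Im (mderive _ _ _)).
Qed.

Lemma seminorm_of_bnd f alpha beta M (C1 C2 : R) :
  (\sum_i alpha i <= M)%N ->
  weighted_bound (re_fun f) M (multi_seq beta) C1 ->
  weighted_bound (im_fun f) M (multi_seq beta) C2 ->
  (seminorm alpha beta f <= (C1 + C2)%:E)%E.
Proof.
move=> aM H1 H2; apply/seminorm_leP => x.
apply: le_trans (ler_pM _ _ (le_trans (monomial_le_W _ _) (WX_homo _ aM)) (normc_le _)) _ => //.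
  exact: normc_ge0.
by rewrite mulrDr lerD//.
Qed.

Lemma schwartzP f : schwartz f <-> rschwartz (re_fun f) /\ rschwartz (im_fun f).
Proof.
split=> [[sf Hf]|[[s1 H1] [s2 H2]]].
  have H M s : exists C, weighted_bound (re_fun f) M s C /\ weighted_bound (im_fun f) M s C.
    have [C0 HC0] := seminorm_lty (Hf [ffun=> 0%N] (count_index s)).
    have [C HC] := fin_all_exists (fun i =>
      seminorm_lty (Hf (pure_index M i) (count_index s))).
    by eexists; exact: bnd_of_seminorms HC0 HC.
  by split; (split=> [|M s]; [by case: sf|have [C [? ?]] := H M s; exists C]).
split=> // alpha beta.
have [C1 HC1] := H1 (\sum_i alpha i)%N (multi_seq beta).
have [C2 HC2] := H2 (\sum_i alpha i)%N (multi_seq beta).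
by apply: le_lt_trans (seminorm_of_bnd (leqnn _) HC1 HC2) _; exact: ltry.
Qed.

Lemma schwartz_linear (c : R[i]) f1 f2 : schwartz f1 -> schwartz f2 ->
  schwartz (fun x => c * f1 x + f2 x).
Proof.
move=> /schwartzP[r1 i1] /schwartzP[r2 i2]; apply/schwartzP; case: c => a b; split.
  have := rschD (rsch_linear a (- b) r1 i1) r2.
  congr rschwartz; apply/funext => x; rewrite /re_fun /im_fun.
  by case: (f1 x) (f2 x) => [? ?] [? ?] /=; ring.
have := rschD (rsch_linear a b i1 r1) i2.
congr rschwartz; apply/funext => x; rewrite /re_fun /im_fun.
by case: (f1 x) (f2 x) => [? ?] [? ?] /=; ring.
Qed.

Lemma schwartzB f1 f2 : schwartz f1 -> schwartz f2 ->
  schwartz (fun x => f1 x - f2 x).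
Proof.
move=> s1 s2; have := schwartz_linear (-1) s2 s1.
by congr schwartz; apply/funext => x; rewrite mulN1r addrC.
Qed.

Lemma schwartz0 : schwartz ((fun=> 0) : 'rV[R]_n -> R[i]).
Proof. by apply/schwartzP; split; exact: rsch0. Qed.

Lemma schwartz_real g : rschwartz g -> schwartz (fun x => (g x)%:C).
Proof.
by move=> gs; apply/schwartzP; split; [exact: gs|exact: rsch0].
Qed.

End seminorms.

(** * Tempered distributions as functionals of finite order *)

Section tempered_bound.
Context (R : realType) (n : nat).
Implicit Types (f : 'rV[R]_n -> R[i]) (g : 'rV[R]_n -> R) (x : 'rV[R]_n).
Variable w : ('rV[R]_n -> R[i]) -> R[i].
Hypothesis w_tempered : tempered w.

Lemma tempered0 : w (fun=> 0) = 0.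
Proof.
have s0 := @schwartz0 R n.
have := w_tempered.1 1 _ _ s0 s0.
under eq_fun do rewrite mulr0 addr0.
by rewrite mul1r => /eqP; rewrite -subr_eq subrr => /eqP <-.
Qed.

Lemma temperedZ c f : schwartz f -> w (fun x => c * f x) = c * w f.
Proof.
move=> sf; have s0 := @schwartz0 R n.
have := w_tempered.1 c _ _ sf s0.
by under eq_fun do rewrite addr0; rewrite tempered0 addr0.
Qed.

Lemma temperedB f1 f2 : schwartz f1 -> schwartz f2 ->
  w (fun x => f1 x - f2 x) = w f1 - w f2.
Proof.
move=> s1 s2; have := w_tempered.1 (-1) _ _ s2 s1.
under eq_fun do rewrite mulN1r addrC.
by rewrite mulN1r addrC.
Qed.

(** Continuity at 0 with tolerance 1 yields finitely many seminorms and a radius [d]; scaling [f]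
    into that neighbourhood turns this into a linear bound. *)
Lemma tempered_bound : exists m (C : R), 0 <= C /\ forall f P, schwartz f ->
  (forall s, (size s <= m)%N ->
     weighted_bound (re_fun f) m s P /\ weighted_bound (im_fun f) m s P) ->
  Normc.normc (w f) <= C * P.
Proof.
have s0 := @schwartz0 R n.
have [m [d [d0 Hd]]] := w_tempered.2 _ s0 1 ltr01.
exists m, (4 / d); split; first by rewrite divr_ge0// ltW.
move=> f P sf HP.
have P0 : 0 <= P by have [+ _] := HP [::] isT; exact: bnd_ge0.
(* [P] may be 0, and the scaling divides by it; the bound is shown for every larger [Q] and then
   passes to [P]. *)
suff H Q : P < Q -> Normc.normc (w f) <= 4 / d * Q.
  apply/ler_addgt0Pr => eps eps0; have d4 : 0 < 4 / d by rewrite divr_gt0.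
  have := H (P + eps / (4 / d)); rewrite ltrDl divr_gt0// => /(_ isT).
  by rewrite mulrDr mulrCA divff ?mulr1// gt_eqF.
move=> PQ; have Q0 : 0 < Q by exact: le_lt_trans PQ.
(* The real and imaginary parts of [c f] are then bounded by [c * Q = d / 4] each, so its seminorms
   stay below [d]. *)
pose c := d / (4 * Q).
have c0 : 0 < c by rewrite divr_gt0// mulr_gt0.
have scf : schwartz (fun x => c%:C * f x).
  have := schwartz_linear c%:C sf s0.
  by under eq_fun do rewrite addr0.
have := Hd _ scf.
rewrite temperedZ// tempered0 subr0 normc_real (gtr0_norm c0) => H.
have {}H : c * Normc.normc (w f) < 1.
  apply: H => alpha beta am bm.
  have [sr si] := (schwartzP f).1 sf.
  have /HP[b1 b2] : (size (multi_seq beta) <= m)%N by rewrite size_multi_seq.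
  apply: (@le_lt_trans _ _ ((c * P + c * P)%:E)).
    apply: (seminorm_of_bnd am).
      move=> x; have [_ E] := smooth_linear c 0 sr.1 sr.1.
      rewrite (_ : re_fun _ = fun x => c * re_fun f x + 0 * re_fun f x); last first.
        by apply/funext => y; rewrite /re_fun; case: (f y) => a b /=; ring.
      rewrite E mul0r addr0 normrM (gtr0_norm c0) mulrCA ler_pM2l//; exact: b1.
    move=> x; have [_ E] := smooth_linear c 0 si.1 si.1.
    rewrite (_ : im_fun _ = fun x => c * im_fun f x + 0 * im_fun f x); last first.
      by apply/funext => y; rewrite /im_fun; case: (f y) => a b /=; ring.
    rewrite E mul0r addr0 normrM (gtr0_norm c0) mulrCA ler_pM2l//; exact: b2.
  rewrite lte_fin; apply: (@lt_le_trans _ _ (c * Q + c * Q)).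
    by rewrite ltrD// ltr_pM2l.
  rewrite /c (_ : _ + _ = d / 2); first by rewrite ler_pdivrMr// ler_peMr ?ler1n// ltW.
  by field; rewrite gt_eqF.
have -> : 4 / d * Q = c^-1 by rewrite /c invfM invrK; field; rewrite gt_eqF.
by rewrite -[leRHS]mulr1 -ler_pdivrMl ?invr_gt0// invrK ltW.
Qed.

(** With its companion [im_functional] it determines [w], by [tempered_parts]; the interchange with
    integrals is available for such real functionals. *)
Definition re_functional g := complex.Re (w (fun x => (g x)%:C)).
Definition im_functional g := complex.Im (w (fun x => (g x)%:C)).

Lemma tempered_real_linear (a b : R) g1 g2 : rschwartz g1 -> rschwartz g2 ->
  w (fun x => (a * g1 x + b * g2 x)%:C) =
  a%:C * w (fun x => (g1 x)%:C) + b%:C * w (fun x => (g2 x)%:C).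
Proof.
move=> s1 s2.
have s3 : schwartz (fun x => b%:C * (g2 x)%:C).
  have := schwartz_real (rschZ b s2).
  by congr schwartz; apply/funext => x; rewrite rmorphM.
rewrite -(temperedZ b%:C (schwartz_real s2)) -(w_tempered.1 _ _ _ (schwartz_real s1) s3).
by congr w; apply/funext => x; rewrite rmorphD !rmorphM.
Qed.

Lemma re_functional_linear : real_linear re_functional.
Proof.
move=> a b g1 g2 s1 s2; rewrite /re_functional tempered_real_linear//.
by case: (w _) (w _) => [? ?] [? ?] /=; ring.
Qed.

Lemma im_functional_linear : real_linear im_functional.
Proof.
move=> a b g1 g2 s1 s2; rewrite /im_functional tempered_real_linear//.
by case: (w _) (w _) => [? ?] [? ?] /=; ring.
Qed.

Lemma functionals_bounded : exists m (C : R), [/\ 0 <= C,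
  real_bounded re_functional m C & real_bounded im_functional m C].
Proof.
have [m [C [C0 HC]]] := tempered_bound.
have H g P : rschwartz g -> (forall s, (size s <= m)%N -> weighted_bound g m s P) ->
    Normc.normc (w (fun x => (g x)%:C)) <= C * P.
  move=> gs HP; apply: HC; first exact: schwartz_real.
  move=> s sm; split; first exact: HP.
  move=> x; rewrite /im_fun/=; have [_ ->] := smooth_zero R n.
  by rewrite normr0 mulr0; exact: bnd_ge0 (HP [::] isT).
exists m, C; split=> // g P gs HP; apply: le_trans (H g P gs HP).
  exact: normc_Re.
exact: normc_Im.
Qed.

Lemma tempered_parts f : schwartz f -> w f =
  (re_functional (re_fun f) - im_functional (im_fun f)) +i*
  (im_functional (re_fun f) + re_functional (im_fun f)).
Proof.
move=> /schwartzP[r i]; have := w_tempered.1 (0 +i* 1) _ _ (schwartz_real i) (schwartz_real r).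
rewrite (_ : (fun x => _) = f); last first.
  apply/funext => x; rewrite /re_fun /im_fun; case: (f x) => a b /=.
  by apply: eq_complex_parts => /=; ring.
move=> ->; rewrite /re_functional /im_functional.
case: (w _) (w _) => [? ?] [? ?] /=.
by apply: eq_complex_parts => /=; ring.
Qed.

End tempered_bound.

(** * Complex convolutions and the interchange of [w] with integrals *)

Section complex_convolution.
Context (R : realType) (n : nat).
Implicit Types (f a b phi : 'rV[R]_n -> R[i]) (g k : 'rV[R]_n -> R) (x y z : 'rV[R]_n).
Local Notation I := (@integral_rV R n).

Lemma rsch_opp g : rschwartz g -> rschwartz (fun z => g (- z)).
Proof.
move=> gs; have := @rsch_affine _ _ g 0 (-1) _ gs; rewrite oppr_eq0 oner_eq0 => /(_ isT).
by congr rschwartz; apply/funext => z; rewrite add0r scaleN1r.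
Qed.

Lemma schwartz_sub f x : schwartz f -> schwartz (fun y => f (x - y)).
Proof.
move=> /schwartzP[r i]; apply/schwartzP.
have E g : (fun y => g (x - y)) = translate (fun z => g (- z)) x.
  by apply/funext => y; rewrite /translate opprB.
split.
  by have := rsch_translate x (rsch_opp r); rewrite -E.
by have := rsch_translate x (rsch_opp i); rewrite -E.
Qed.

Lemma rsch_irvM g1 g2 : rschwartz g1 -> rschwartz g2 -> integrable_rV (fun x => g1 x * g2 x).
Proof.
move=> s1 s2; have [B _ HB] := rsch_bounded s2.
by apply: rd_irv; apply: (rdM_bounded (C := B)) => //; [exact: rsch_rd|exact: rsch_mrv].
Qed.

Lemma cintegral_mulE a b : schwartz a -> schwartz b ->
  cintegral (fun x => a x * b x) =
  (I (fun x => re_fun a x * re_fun b x) - I (fun x => im_fun a x * im_fun b x)) +i*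
  (I (fun x => re_fun a x * im_fun b x) + I (fun x => im_fun a x * re_fun b x)).
Proof.
move=> /schwartzP[ra ia] /schwartzP[rb ib]; rewrite -intB -?intD; [|exact: rsch_irvM..].
by congr (I _ +i* I _); apply/funext => x; rewrite /re_fun /im_fun;
  case: (a x) (b x) => [? ?] [? ?].
Qed.

(** A negative [d] gives the convolution with the reflected mollifier, as the duality requires. *)
Definition cconv (d : R) phi f x := cintegral (fun z => phi z * f (x - d *: z)).

Lemma schwartz_scaled_sub d f x : d != 0 -> schwartz f ->
  schwartz (fun z => f (x - d *: z)).
Proof.
move=> d0 /schwartzP[r i]; apply/schwartzP; rewrite -oppr_eq0 in d0.
split; [have := rsch_affine x d0 r|have := rsch_affine x d0 i].
  by congr rschwartz; apply/funext => z; rewrite scaleNr.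
by congr rschwartz; apply/funext => z; rewrite scaleNr.
Qed.

Lemma cconvE d phi f x : d != 0 -> schwartz phi -> schwartz f ->
  cconv d phi f x =
  (kconv d (re_fun phi) (re_fun f) x - kconv d (im_fun phi) (im_fun f) x) +i*
  (kconv d (re_fun phi) (im_fun f) x + kconv d (im_fun phi) (re_fun f) x).
Proof. by move=> d0 sp sf; rewrite /cconv cintegral_mulE//; exact: schwartz_scaled_sub. Qed.

(** The absolute value extends [mollify] to negative scales, in agreement with [cconv]. *)
Definition rescale (d : R) phi : 'rV[R]_n -> R[i] :=
  fun x => (`|d| ^- n)%:C * phi (d^-1 *: x).

Lemma re_rescale d phi x : re_fun (rescale d phi) x = `|d| ^- n * re_fun phi (d^-1 *: x).
Proof. by rewrite /re_fun /rescale; case: (phi _) => ? ? /=; ring. Qed.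

Lemma im_rescale d phi x : im_fun (rescale d phi) x = `|d| ^- n * im_fun phi (d^-1 *: x).
Proof. by rewrite /im_fun /rescale; case: (phi _) => ? ? /=; ring. Qed.

Lemma schwartz_rescale d phi : d != 0 -> schwartz phi -> schwartz (rescale d phi).
Proof.
rewrite -invr_eq0 => d0 /schwartzP[r i]; apply/schwartzP; split.
  have := rschZ (`|d| ^- n) (rsch_affine 0 d0 r).
  by congr rschwartz; apply/funext => x; rewrite re_rescale add0r.
have := rschZ (`|d| ^- n) (rsch_affine 0 d0 i).
by congr rschwartz; apply/funext => x; rewrite im_rescale add0r.
Qed.

(** The substitution is [u = x - d z], with Jacobian [|d| ^+ n]. *)
Lemma kconv_rescale d k g x : d != 0 -> rschwartz k -> rschwartz g ->
  kconv d k g x = I (fun u => `|d| ^- n * k (d^-1 *: (x - u)) * g u).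
Proof.
move=> d0 ks gs.
have iks : rschwartz (fun u => k (d^-1 *: (x - u))).
  have d0' : - d^-1 != 0 by rewrite oppr_eq0 invr_eq0.
  have := rsch_affine (d^-1 *: x) d0' ks.
  by congr rschwartz; apply/funext => u; rewrite scalerBr scaleNr.
rewrite [RHS](_ : _ = I (fun u => `|d| ^- n * (k (d^-1 *: (x - u)) * g u))); last first.
  by congr I; apply/funext => u; rewrite mulrA.
rewrite intZ; last exact: rsch_irvM.
have dN : - d != 0 by rewrite oppr_eq0.
rewrite (int_affine x dN (rsch_irvM iks gs)) normrN mulrA mulVf ?mul1r; last first.
  by rewrite expf_neq0// normr_eq0.
congr I; apply/funext => z; rewrite scaleNr opprD opprK addNKr.
by rewrite scalerA mulVf// scale1r.
Qed.

Lemma cconv_rescale d phi f x : d != 0 -> schwartz phi -> schwartz f ->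
  cconv d phi f x = cintegral (fun u => rescale d phi (x - u) * f u).
Proof.
move=> d0 sp sf; rewrite cconvE// cintegral_mulE//; last first.
  by apply: schwartz_sub; exact: schwartz_rescale.
have [rp ip] := (schwartzP phi).1 sp; have [rf if_] := (schwartzP f).1 sf.
rewrite !kconv_rescale//.
by congr ((I _ - I _) +i* (I _ + I _)); apply/funext => u;
  rewrite -?re_rescale -?im_rescale.
Qed.

Lemma irv_mul_parts a b : schwartz a -> schwartz b ->
  integrable_rV (re_fun (fun x => a x * b x)) /\ integrable_rV (im_fun (fun x => a x * b x)).
Proof.
move=> /schwartzP[ra ia] /schwartzP[rb ib]; split.
  have := irvB (rsch_irvM ra rb) (rsch_irvM ia ib).
  by congr integrable_rV; apply/funext => x; rewrite /re_fun /im_fun; case: (a x) (b x) => [? ?] [? ?].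
have := irvD (rsch_irvM ra ib) (rsch_irvM ia rb).
by congr integrable_rV; apply/funext => x; rewrite /re_fun /im_fun; case: (a x) (b x) => [? ?] [? ?].
Qed.

(** The substitution of [x + y - u] for [u] exchanges the factors: this is commutativity of
    convolution at the point [x - y]. *)
Lemma cintegral_reflect a b x y : schwartz a -> schwartz b ->
  cintegral (fun u => a (x - u) * b (u - y)) =
  cintegral (fun u => b (x - u) * a (u - y)).
Proof.
move=> sa sb.
have sb' : schwartz (fun u => b (u - y)).
  have /schwartzP[r i] := sb; apply/schwartzP.
  by split; [exact: (rsch_translate y r)|exact: (rsch_translate y i)].
have [ir ii] := irv_mul_parts (schwartz_sub x sa) sb'.
rewrite {1}/cintegral -/(re_fun _) -/(im_fun _) (int_reflect (x + y) ir) (int_reflect (x + y) ii).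
have E u : a (x - (x + y - u)) * b (x + y - u - y) = b (x - u) * a (u - y).
  rewrite mulrC; congr (b _ * a _); first by rewrite addrAC addrK.
  by rewrite opprB addrCA opprD addNKr.
by congr (I _ +i* I _); apply/funext => u; rewrite /re_fun /im_fun E.
Qed.

Variable w : ('rV[R]_n -> R[i]) -> R[i].
Hypothesis w_tempered : tempered w.

(** Splitting [a], [b] and [w] into real and imaginary parts leaves instances of
    [functional_conv]. *)
Lemma tempered_cintegral a b : schwartz a -> schwartz b ->
  w (fun y => cintegral (fun x => a x * b (x - y))) =
  cintegral (fun x => a x * w (fun y => b (x - y))).
Proof.
move=> sa sb; have [ra ia] := (schwartzP a).1 sa; have [rb ib] := (schwartzP b).1 sb.
have [m [C [C0 bl1 bl2]]] := functionals_bounded w_tempered.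
have l1 := re_functional_linear w_tempered.
have l2 := im_functional_linear w_tempered.
(* Reflection turns [b (x - y)], as a function of [y], into a translate by [x], and the integral
   over [x] into a [kconv 1]. *)
pose b1 z := re_fun b (- z); pose b2 z := im_fun b (- z).
have sb1 : rschwartz b1 by exact: rsch_opp.
have sb2 : rschwartz b2 by exact: rsch_opp.
pose L1 := re_functional w; pose L2 := im_functional w.
have swap1 k g : rschwartz k -> rschwartz g ->
    L1 (kconv 1 k g) = I (fun x => k x * L1 (translate g x)).
  by move=> ks gs; apply: (functional_conv l1 bl1) => //; exact: rsch_rd.
have swap2 k g : rschwartz k -> rschwartz g ->
    L2 (kconv 1 k g) = I (fun x => k x * L2 (translate g x)).
  by move=> ks gs; apply: (functional_conv l2 bl2) => //; exact: rsch_rd.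
have cs k g : rschwartz k -> rschwartz g -> rschwartz (kconv 1 k g).
  by move=> ks gs; apply: rsch_conv => //; [exact: rsch_rd|rewrite normr1].
have i1 k g : rschwartz k -> rschwartz g -> integrable_rV (fun x => k x * L1 (translate g x)).
  by move=> ks gs; apply: rd_irv; apply: (rd_functional_translate l1 bl1) => //; exact: rsch_rd.
have i2 k g : rschwartz k -> rschwartz g -> integrable_rV (fun x => k x * L2 (translate g x)).
  by move=> ks gs; apply: rd_irv; apply: (rd_functional_translate l2 bl2) => //; exact: rsch_rd.
have -> : (fun y => cintegral (fun x => a x * b (x - y))) = fun y =>
    (kconv 1 (re_fun a) b1 y - kconv 1 (im_fun a) b2 y) +i*
    (kconv 1 (re_fun a) b2 y + kconv 1 (im_fun a) b1 y).
  apply/funext => y; rewrite cintegral_mulE//; last first.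
    apply/schwartzP; split; [have := rsch_translate y rb|have := rsch_translate y ib] => //.
  by rewrite /kconv; congr ((I _ - I _) +i* (I _ + I _)); apply/funext => x;
    rewrite /b1 /b2 scale1r opprB.
rewrite tempered_parts//; last first.
  apply/schwartzP; split; [apply: rschB|apply: rschD]; exact: cs.
rewrite [X in re_functional w X]/re_fun [X in im_functional w X]/im_fun /=.
rewrite (real_linearB l1) ?(real_linearB l2) ?(real_linearD l1) ?(real_linearD l2);
  try exact: cs.
rewrite -/L1 -/L2 !swap1 ?swap2//.
have wE x : w (fun y => b (x - y)) =
    (L1 (translate b1 x) - L2 (translate b2 x)) +i*
    (L2 (translate b1 x) + L1 (translate b2 x)).
  rewrite tempered_parts//; last exact: schwartz_sub.
  have E1 : re_fun (fun y => b (x - y)) = translate b1 x.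
    by apply/funext => y; rewrite /translate /b1 opprB.
  have E2 : im_fun (fun y => b (x - y)) = translate b2 x.
    by apply/funext => y; rewrite /translate /b2 opprB.
  by rewrite E1 E2.
apply: eq_complex_parts => /=.
  have iA := i1 _ _ ra sb1; have iB := i1 _ _ ia sb2.
  have iC := i2 _ _ ra sb2; have iD := i2 _ _ ia sb1.
  rewrite -(intB iA iB) -(intD iC iD) -(intB (irvB iA iB) (irvD iC iD)).
  congr I; apply/funext => x; rewrite wE /re_fun /im_fun; case: (a x) => ? ? /=; ring.
have iA := i2 _ _ ra sb1; have iB := i2 _ _ ia sb2.
have iC := i1 _ _ ra sb2; have iD := i1 _ _ ia sb1.
rewrite -(intB iA iB) -(intD iC iD) -(intD (irvB iA iB) (irvD iC iD)).
congr I; apply/funext => x; rewrite wE /re_fun /im_fun; case: (a x) => ? ? /=; ring.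
Qed.

End complex_convolution.

(** * Convolution with the mollifier *)

Section mollification.
Context (R : realType) (n : nat).
Implicit Types (f psi : 'rV[R]_n -> R[i]) (g k : 'rV[R]_n -> R) (x y z : 'rV[R]_n).
Local Notation I := (@integral_rV R n).
Variable phi : 'rV[R]_n -> R[i].
Hypothesis phi_mollifier : mollifier phi.
Let rho := re_fun phi.
Let sigma := im_fun phi.

Let phi_schwartz : schwartz phi. Proof. by case: phi_mollifier. Qed.
Let rho_rsch : rschwartz rho. Proof. by case: ((schwartzP phi).1 phi_schwartz). Qed.
Let sigma_rsch : rschwartz sigma. Proof. by case: ((schwartzP phi).1 phi_schwartz). Qed.
Let rho_rd : rapidly_decreasing rho. Proof. exact: rsch_rd. Qed.
Let sigma_rd : rapidly_decreasing sigma. Proof. exact: rsch_rd. Qed.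

Let int_rho : I rho = 1.
Proof. by case: phi_mollifier => _ /(congr1 (@complex.Re R)). Qed.

Let int_sigma : I sigma = 0.
Proof. by case: phi_mollifier => _ /(congr1 (@complex.Im R)). Qed.

Lemma monomial_count_index (s : seq 'I_n) x :
  monomial (count_index s) x = \prod_(i <- s) x 0 i.
Proof.
elim: s => [|i s IH].
  by rewrite big_nil /monomial big1// => i _; rewrite ffunE expr0.
rewrite big_cons -IH /monomial (bigD1 i)//= [in RHS](bigD1 i)//= mulrA.
rewrite !ffunE/= eqxx -exprS; congr (_ * _); apply: eq_bigr => j ji.
by rewrite !ffunE/= eq_sym (negPf ji).
Qed.

Let mollifier_moments (s : seq 'I_n) : s != [::] ->
  cintegral (fun x => (\prod_(i <- s) x 0 i)%:C * phi x) = 0.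
Proof.
move=> s0; case: phi_mollifier => _ _ /(_ (count_index s)) H.
under eq_fun do rewrite -monomial_count_index.
apply: H; apply/eqP => /ffunP H; case: s s0 H => // i s _ /(_ i).
by rewrite !ffunE/= eqxx.
Qed.

Let vanishing_rho : vanishing_moments rho.
Proof.
move=> s /mollifier_moments /(congr1 (@complex.Re R)) /= H; rewrite -[RHS]H.
congr I; apply/funext => x; rewrite /rho /re_fun; case: (phi x) => ? ? /=; ring.
Qed.

Let vanishing_sigma : vanishing_moments sigma.
Proof.
move=> s /mollifier_moments /(congr1 (@complex.Im R)) /= H; rewrite -[RHS]H.
congr I; apply/funext => x; rewrite /sigma /im_fun; case: (phi x) => ? ? /=; ring.
Qed.

Lemma re_cconv d f : d != 0 -> schwartz f ->
  re_fun (cconv d phi f) = fun x => kconv d rho (re_fun f) x - kconv d sigma (im_fun f) x.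
Proof. by move=> d0 sf; apply/funext => x; rewrite /re_fun cconvE. Qed.

Lemma im_cconv d f : d != 0 -> schwartz f ->
  im_fun (cconv d phi f) = fun x => kconv d rho (im_fun f) x + kconv d sigma (re_fun f) x.
Proof. by move=> d0 sf; apply/funext => x; rewrite /im_fun cconvE. Qed.

Lemma schwartz_cconv d f : d != 0 -> `|d| <= 1 -> schwartz f -> schwartz (cconv d phi f).
Proof.
move=> d0 d1 sf; have [rf jf] := (schwartzP f).1 sf; apply/schwartzP.
rewrite re_cconv// im_cconv//.
by split; [apply: rschB|apply: rschD]; exact: rsch_conv.
Qed.

Lemma bndB g1 g2 M s (C1 C2 : R) : smooth_real g1 -> smooth_real g2 ->
  weighted_bound g1 M s C1 -> weighted_bound g2 M s C2 ->
  weighted_bound (fun x => g1 x - g2 x) M s (C1 + C2).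
Proof.
move=> s1 s2 H1 H2; have := bnd_linear 1 (-1) s1 s2 H1 H2.
rewrite normrN1 normr1 !mul1r.
by under eq_fun do rewrite mul1r mulN1r.
Qed.

Lemma bndD g1 g2 M s (C1 C2 : R) : smooth_real g1 -> smooth_real g2 ->
  weighted_bound g1 M s C1 -> weighted_bound g2 M s C2 ->
  weighted_bound (fun x => g1 x + g2 x) M s (C1 + C2).
Proof.
move=> s1 s2 H1 H2; have := bnd_linear 1 1 s1 s2 H1 H2.
rewrite normr1 !mul1r.
by under eq_fun do rewrite !mul1r.
Qed.

Lemma bnd_cconv d f M s (C : R) : d != 0 -> `|d| <= 1 -> schwartz f ->
  weighted_bound (re_fun f) M s C -> weighted_bound (im_fun f) M s C ->
  weighted_bound (re_fun (cconv d phi f)) M s (C * moment rho M + C * moment sigma M) /\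
  weighted_bound (im_fun (cconv d phi f)) M s (C * moment rho M + C * moment sigma M).
Proof.
move=> d0 d1 sf H1 H2; have [rf jf] := (schwartzP f).1 sf.
have sc k g (kd : rapidly_decreasing k) (gs : rschwartz g) := (smooth_conv d kd gs).1.
rewrite re_cconv// im_cconv//; split.
  exact: (bndB (sc _ _ rho_rd rf) (sc _ _ sigma_rd jf)
    (bnd_conv rho_rd rf d1 H1) (bnd_conv sigma_rd jf d1 H2)).
exact: (bndD (sc _ _ rho_rd jf) (sc _ _ sigma_rd rf)
  (bnd_conv rho_rd jf d1 H2) (bnd_conv sigma_rd rf d1 H1)).
Qed.

(** The constant [A] is fixed before [d] and [f], because the function to be approximated will
    itself vary with [eps]. *)
Lemma cconv_approx K M : exists2 A, 0 <= A & forall d f s (B : R),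
  d != 0 -> `|d| <= 1 -> schwartz f -> 0 <= B ->
  (forall t, size t = K ->
     weighted_bound (re_fun f) M (t ++ s) B /\ weighted_bound (im_fun f) M (t ++ s) B) ->
  weighted_bound (re_fun (fun x => cconv d phi f x - f x)) M s (`|d| ^+ K * (A * B)) /\
  weighted_bound (im_fun (fun x => cconv d phi f x - f x)) M s (`|d| ^+ K * (A * B)).
Proof.
exists (2 * n%:R ^+ K * moment rho (M + K) + 2 * n%:R ^+ K * moment sigma (M + K)).
  by rewrite addr_ge0// !mulr_ge0 ?exprn_ge0 ?moment_ge0.
move=> d f s B d0 d1 sf B0 HB; have [rf jf] := (schwartzP f).1 sf.
have sc k g : rapidly_decreasing k -> rschwartz g -> smooth_real (fun x => kconv d k g x - I k * g x).
  move=> kd gs; apply: smoothB; first by case: (smooth_conv d kd gs).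
  by case: (rschZ (I k) gs).
have E : `|d| ^+ K * ((2 * n%:R ^+ K * moment rho (M + K) + 2 * n%:R ^+ K * moment sigma (M + K)) * B) =
  2 * `|d| ^+ K * n%:R ^+ K * B * moment rho (M + K) +
  2 * `|d| ^+ K * n%:R ^+ K * B * moment sigma (M + K) by ring.
have HB1 t : size t = K -> weighted_bound (re_fun f) M (t ++ s) B by move=> /HB[].
have HB2 t : size t = K -> weighted_bound (im_fun f) M (t ++ s) B by move=> /HB[].
rewrite E; split.
  rewrite (_ : re_fun _ = fun x => (kconv d rho (re_fun f) x - I rho * re_fun f x) -
     (kconv d sigma (im_fun f) x - I sigma * im_fun f x)).
    exact: (bndB (sc _ _ rho_rd rf) (sc _ _ sigma_rd jf)
      (bnd_conv_approx rho_rd rf vanishing_rho B0 HB1 d1)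
      (bnd_conv_approx sigma_rd jf vanishing_sigma B0 HB2 d1)).
  (* As [rho] has integral 1 and [sigma] integral 0, the subtracted terms reduce to the real part of
     [f]. *)
  apply/funext => x; rewrite int_rho int_sigma mul1r mul0r subr0.
  transitivity (complex.Re (cconv d phi f x - f x)); first by [].
  rewrite cconvE// -[re_fun f x]/(complex.Re (f x)); case: (f x) => ? ? /=.
  by rewrite addrAC.
rewrite (_ : im_fun _ = fun x => (kconv d rho (im_fun f) x - I rho * im_fun f x) +
   (kconv d sigma (re_fun f) x - I sigma * re_fun f x)).
  exact: (bndD (sc _ _ rho_rd jf) (sc _ _ sigma_rd rf)
    (bnd_conv_approx rho_rd jf vanishing_rho B0 HB2 d1)
    (bnd_conv_approx sigma_rd rf vanishing_sigma B0 HB1 d1)).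
apply/funext => x; rewrite int_rho int_sigma mul1r mul0r subr0.
transitivity (complex.Im (cconv d phi f x - f x)); first by [].
rewrite cconvE// -[im_fun f x]/(complex.Im (f x)); case: (f x) => ? ? /=.
by rewrite addrAC.
Qed.

Lemma mollifyE (eps : eps_index R) : mollify phi eps = rescale (val eps) phi.
Proof.
by apply/funext => x; rewrite /mollify /rescale gtr0_norm//; case/andP: (valP eps).
Qed.

Lemma eps_neq0 (eps : eps_index R) : val eps != 0.
Proof. by rewrite gt_eqF//; case/andP: (valP eps). Qed.

Lemma eps_norm_le1 (eps : eps_index R) : `|val eps| <= 1.
Proof. by rewrite gtr0_norm//; case/andP: (valP eps). Qed.

Section regular.
Variable w : ('rV[R]_n -> R[i]) -> R[i].
Hypothesis w_tempered : tempered w.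
Let h (eps : eps_index R) := convolution w (mollify phi eps).

(** Once [w] is taken out of the integrals, both sides apply [w] to the convolution of the two
    rescaled mollifiers at [x - y], as a function of [y]; the order of the factors is immaterial
    there. *)
Lemma cconv_convolutionC (eps del : eps_index R) :
  schwartz (h eps) -> schwartz (h del) ->
  cconv (val del) phi (h eps) = cconv (val eps) phi (h del).
Proof.
move=> se sd; apply/funext => x; rewrite !cconv_rescale ?eps_neq0//.
have se' := schwartz_rescale (eps_neq0 eps) phi_schwartz.
have sd' := schwartz_rescale (eps_neq0 del) phi_schwartz.
rewrite /h /convolution !mollifyE.
rewrite -(tempered_cintegral w_tempered (schwartz_sub x sd') se').
rewrite -(tempered_cintegral w_tempered (schwartz_sub x se') sd').
by congr w; apply/funext => y; exact: cintegral_reflect.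
Qed.

(** Taking [w] out of the pairing leaves the integral of [psi x] against the rescaled mollifier at
    [x - y]. As a convolution at [y] it has the mollifier reflected, whence the scale
    [- val eps]. *)
Lemma cconv_dual (eps : eps_index R) psi : schwartz psi ->
  w (cconv (- val eps) phi psi) = cintegral (fun x => psi x * h eps x).
Proof.
move=> sp; have se' := schwartz_rescale (eps_neq0 eps) phi_schwartz.
rewrite /h /convolution mollifyE -(tempered_cintegral w_tempered sp se').
congr w; apply/funext => y.
rewrite cconv_rescale ?oppr_eq0 ?eps_neq0//.
congr cintegral; apply/funext => u; rewrite mulrC /rescale normrN; congr (_ * (_ * phi _)).
by rewrite invrN scaleNr -scalerN opprB.
Qed.

End regular.

Lemma distribution_convolutionE f w : schwartz f ->
  (forall psi, schwartz psi -> w psi = cintegral (fun x => f x * psi x)) ->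
  forall eps, convolution w (mollify phi eps) = cconv (val eps) phi f.
Proof.
move=> sf wE eps; apply/funext => x; rewrite cconv_rescale ?eps_neq0//.
rewrite /convolution wE mollifyE.
  by congr cintegral; apply/funext => y; rewrite mulrC.
by apply: schwartz_sub; exact: schwartz_rescale (eps_neq0 eps) phi_schwartz.
Qed.

End mollification.

(** * Generalized functions *)

Section nets.
Context (R : realType) (n : nat).
Implicit Types (u v : net R n) (eps : eps_index R) (M : nat) (s : seq 'I_n).

Lemma sup_finiteP (F : eps_index R -> \bar R) :
  sup_finite F <-> exists C : R, forall eps, (F eps <= C%:E)%E.
Proof.
split=> [|[C HC]].
  rewrite /sup_finite => Foo.
  have H eps : (F eps <= ereal_sup (range F))%E by apply: ereal_sup_ubound; exists eps.
  case E : (ereal_sup (range F)) Foo => [r| |] // _; rewrite E in H.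
    by exists r.
  by exists 0 => eps; apply: le_trans (H eps) _; rewrite leNye.
apply: (@le_lt_trans _ _ C%:E); last exact: ltry.
by apply: ge_ereal_sup => _ [eps _ <-].
Qed.

Lemma eps_gt0 eps : 0 < val eps. Proof. by case/andP: (valP eps). Qed.

Lemma eps_le1 eps : val eps <= 1. Proof. by case/andP: (valP eps). Qed.

(** [N] comes before [M] and [s]: one power of [eps] serves all derivatives and weights.
    [moderate 0] means bounds uniform in [eps]. *)
Definition moderate (N : nat) u := forall M s, exists C : R, forall eps,
  weighted_bound (re_fun (u eps)) M s (C / val eps ^+ N) /\
  weighted_bound (im_fun (u eps)) M s (C / val eps ^+ N).

Lemma moderate_of_seminorms N u : E_net u ->
  (forall alpha beta, sup_finite (fun eps =>
     (((val eps ^+ N)%R)%:E * seminorm alpha beta (u eps))%E)) -> moderate N u.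
Proof.
move=> su H M s.
have sem alpha beta : exists C : R, forall eps,
    (seminorm alpha beta (u eps) <= (C / val eps ^+ N)%:E)%E.
  have /sup_finiteP[C HC] := H alpha beta; exists C => eps.
  have e0 : 0 < val eps ^+ N by rewrite exprn_gt0// eps_gt0.
  have := HC eps; have := seminorm_ge0 alpha beta (u eps).
  case: (seminorm _ _ _) => [r| |]//.
    by move=> _; rewrite -EFinM !lee_fin ler_pdivlMr// mulrC.
  by move=> _; rewrite gt0_muley ?lte_fin.
have [C0 HC0] := sem [ffun=> 0%N] (count_index s).
have [C HC] := fin_all_exists (fun i => sem (pure_index M i) (count_index s)).
exists ((1 + n%:R) ^+ M * (C0 + \sum_i C i)) => eps.
have := bnd_of_seminorms (su eps) (HC0 eps) (fun i => HC i eps).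
by rewrite -mulr_suml -mulrDl mulrA.
Qed.

Lemma moderate_uniform N u : moderate N u -> forall M k, exists C : R,
  forall s, (size s <= k)%N -> forall eps,
    weighted_bound (re_fun (u eps)) M s (C / val eps ^+ N) /\
    weighted_bound (im_fun (u eps)) M s (C / val eps ^+ N).
Proof.
move=> Hu M k; pose P s C := forall eps,
    weighted_bound (re_fun (u eps)) M s (C / val eps ^+ N) /\
    weighted_bound (im_fun (u eps)) M s (C / val eps ^+ N).
apply: (@uniform_over_seq _ _ P) => [s C D CD HC eps|]; last exact: Hu.
have CD' : C / val eps ^+ N <= D / val eps ^+ N.
  by rewrite ler_pM2r// invr_gt0 exprn_gt0// eps_gt0.
by have [H1 H2] := HC eps; split; exact: bnd_le CD' _.
Qed.

Lemma moderateB N u v : E_net u -> E_net v -> moderate N u -> moderate 0 v ->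
  moderate N (fun eps x => u eps x - v eps x).
Proof.
move=> su sv Hu Hv M s; have [C HC] := Hu M s; have [D HD] := Hv M s.
exists (C + D) => eps; have [c1 c2] := HC eps; have [d1 d2] := HD eps.
have D0 : 0 <= D by have := bnd_ge0 d1; rewrite expr0 divr1.
have le : C / val eps ^+ N + D / val eps ^+ 0 <= (C + D) / val eps ^+ N.
  rewrite mulrDl lerD2l expr0 divr1 ler_pdivlMr ?exprn_gt0 ?eps_gt0//.
  by rewrite ler_piMr// exprn_ile1 ?eps_le1// ltW// eps_gt0.
have E1 : re_fun (fun x => u eps x - v eps x) = fun x => re_fun (u eps) x - re_fun (v eps) x.
  by apply/funext => x; rewrite /re_fun; case: (u eps x) (v eps x) => [? ?] [? ?].
have E2 : im_fun (fun x => u eps x - v eps x) = fun x => im_fun (u eps) x - im_fun (v eps) x.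
  by apply/funext => x; rewrite /im_fun; case: (u eps x) (v eps x) => [? ?] [? ?].
rewrite E1 E2; split; apply: bnd_le le _.
  exact: (bndB (su eps).1 (sv eps).1 c1 d1).
exact: (bndB (su eps).2 (sv eps).2 c2 d2).
Qed.

Lemma smooth_net_diff u v : E_net u -> E_net (fun eps x => u eps x - v eps x) -> E_net v.
Proof.
move=> su sd eps; have [r1 i1] := su eps; have [r2 i2] := sd eps; split.
  have := smoothB r1 r2; congr smooth_real; apply/funext => x.
  by case: (u eps x) (v eps x) => [? ?] [? ?] /=; ring.
have := smoothB i1 i2; congr smooth_real; apply/funext => x.
by case: (u eps x) (v eps x) => [? ?] [? ?] /=; ring.
Qed.

Lemma moderate_schwartz N u eps : E_net u -> moderate N u -> schwartz (u eps).
Proof.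
move=> su Hu; have [sr si] := su eps; apply/schwartzP.
by split; split; [exact: sr| |exact: si|] => M s; have [C HC] := Hu M s;
  exists (C / val eps ^+ N); case: (HC eps).
Qed.

Lemma japanese_ge1 (x : 'rV[R]_n) : 1 <= japanese x.
Proof.
rewrite -[leLHS]sqrtr1 ler_sqrt ?lerDl ?sumr_ge0// => [i _|]; first exact: sqr_ge0.
by rewrite addr_ge0// sumr_ge0// => i _; exact: sqr_ge0.
Qed.

Lemma tau_seminorm_le N alpha (f : 'rV[R]_n -> R[i]) :
  (tau_seminorm N alpha f <= seminorm [ffun=> 0%N] alpha f)%E.
Proof.
apply: ge_ereal_sup => _ [x _ <-].
apply: (@le_trans _ _ (Normc.normc ((monomial [ffun=> 0%N] x)%:C * mderive alpha f x))%:E).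
  rewrite lee_fin monomial0 !normc_real normr1 ler_wpM2r ?normc_ge0//.
  have j1 := exprn_ege1 N (japanese_ge1 x).
  rewrite ger0_norm ?invr_ge0 ?(le_trans ler01)//.
  by rewrite invf_le1// (lt_le_trans ltr01).
by apply: ereal_sup_ubound; exists x.
Qed.

(** Lets a regular net belong to its own class, since [gclass] collects only members of [E_tau]. *)
Lemma E_S_infty_tau u : E_S_infty u -> E_tau u.
Proof.
move=> [su [N HN]]; split=> // alpha; exists N; apply/sup_finiteP.
have /sup_finiteP[C HC] := HN [ffun=> 0%N] alpha; exists C => eps.
apply: le_trans (HC eps); rewrite lee_pmul2l ?tau_seminorm_le//.
by rewrite lte_fin exprn_gt0// eps_gt0.
Qed.

Lemma N_S_self u : N_S (fun eps x => u eps x - u eps x).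
Proof.
have -> : (fun eps x => u eps x - u eps x) = (fun _ _ => 0) :> net R n.
  by apply/funext => eps; apply/funext => x; rewrite subrr.
have s0 := @schwartz0 R n.
split=> [eps|alpha beta q]; first exact: s0.1.
apply/sup_finiteP; exists 0 => eps.
have : (seminorm alpha beta (fun=> 0%R : R[i]) <= (0 + 0 : R)%:E)%E.
  have [_ E] := smooth_zero R n.
  have b0 : weighted_bound (fun=> 0) (\sum_i alpha i)%N (multi_seq beta) (0 : R).
    by move=> x; rewrite E normr0 mulr0.
  exact: (seminorm_of_bnd (f := fun=> 0 : R[i]) (leqnn _) b0 b0).
rewrite addr0 => H; apply: (@le_trans _ _ ((val eps ^- q)%:E * 0)%E); last by rewrite mule0.
by rewrite lee_pmul2l// lte_fin invr_gt0 exprn_gt0// eps_gt0.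
Qed.

End nets.

(** * The two implications *)

Section regularity.
Context (R : realType) (n : nat) (phi : 'rV[R]_n -> R[i]).
Hypothesis phi_mollifier : mollifier phi.
Variable w : ('rV[R]_n -> R[i]) -> R[i].
Hypothesis w_tempered : tempered w.
Local Notation I := (@integral_rV R n).
Let h : net R n := fun eps => convolution w (mollify phi eps).

Lemma schwartz_distribution_regular :
  is_schwartz_distribution w -> G_S_infty (embed phi w).
Proof.
move=> [f sf wE]; exists h => //.
have hE eps : h eps = cconv (val eps) phi f.
  exact: distribution_convolutionE.
split=> [eps|].
  rewrite /= hE; have [] // := schwartz_cconv phi_mollifier (eps_neq0 eps) (eps_norm_le1 eps) sf.
exists 0 => alpha beta; apply/sup_finiteP.
pose M := (\sum_i alpha i)%N.
have [[_ /(_ M (multi_seq beta))[C1 H1]] [_ /(_ M (multi_seq beta))[C2 H2]]] :=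
  (schwartzP f).1 sf.
pose C := C1 + C2.
have H1' : weighted_bound (re_fun f) M (multi_seq beta) C.
  by apply: bnd_le H1; rewrite lerDl (bnd_ge0 H2).
have H2' : weighted_bound (im_fun f) M (multi_seq beta) C.
  by apply: bnd_le H2; rewrite lerDr (bnd_ge0 H1).
pose D := C * moment (re_fun phi) M + C * moment (im_fun phi) M.
exists (D + D) => eps; rewrite expr0 mul1e hE.
have [b1 b2] := bnd_cconv phi_mollifier (eps_neq0 eps) (eps_norm_le1 eps) sf H1' H2'.
exact: (seminorm_of_bnd (leqnn _) b1 b2).
Qed.

(** A regular [u] with the same class lies in that class, so [u - h] is negligible. The case [q = 0]
    of negligibility already bounds it uniformly in [eps], and [h] is [u] minus this difference. *)
Lemma regular_moderate : G_S_infty (embed phi w) ->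
  E_net h /\ exists N, moderate N h.
Proof.
move=> [u [su [N HN]] uE].
have : gclass u u by split; [apply: E_S_infty_tau; split=> //; exists N|exact: N_S_self].
rewrite uE => -[_ [sd Hd]].
have sh : E_net h by exact: smooth_net_diff su sd.
split=> //; exists N.
have mu : moderate N u by exact: moderate_of_seminorms.
have md : moderate 0 (fun eps x => u eps x - h eps x).
  apply: (moderate_of_seminorms sd) => alpha beta.
  have /sup_finiteP[C HC] := Hd alpha beta 0%N; apply/sup_finiteP; exists C => eps.
  by have := HC eps; rewrite expr0 invr1.
have := moderateB su sd mu md; congr (moderate N _).
by apply/funext => eps; apply/funext => x; rewrite opprB addrCA subrr addr0.
Qed.

(** [(t / 2)^(N+1) / t^N = t / 2^(N+1)] and [t^(N+1) / (t / 2)^N = 2^N t]: one power of [t] survives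
    in each term, and [2 ^+ N] is the price of the ratio between the scales. *)
Lemma halving_bound (t A B : R) N : 0 < t -> 0 <= A -> 0 <= B ->
  (t / 2) ^+ N.+1 * (A * (B / t ^+ N)) + t ^+ N.+1 * (A * (B / (t / 2) ^+ N)) <=
  A * B * (2 ^+ N + 1) * t.
Proof.
move=> t0 A0 B0; have tn0 : t != 0 by rewrite gt_eqF.
have -> : (t / 2) ^+ N.+1 * (A * (B / t ^+ N)) = A * B * (t * (2 ^+ N.+1)^-1).
  by rewrite expr_div_n (exprS t); field; rewrite !expf_neq0.
have -> : t ^+ N.+1 * (A * (B / (t / 2) ^+ N)) = A * B * (t * 2 ^+ N).
  by rewrite expr_div_n (exprS t); field; rewrite !expf_neq0.
rewrite -mulrDr -[leRHS]mulrA; apply: ler_wpM2l; first exact: mulr_ge0.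
rewrite [leRHS]mulrC -mulrDr; apply: ler_wpM2l; first exact: ltW.
rewrite addrC; apply: lerD => //.
by rewrite invf_le1 ?exprn_gt0// exprn_ege1// ler1n.
Qed.

Definition dyadic (j : nat) : eps_index R.
Proof.
exists (2 ^- j); rewrite invr_gt0 exprn_gt0//=.
by rewrite invf_le1 ?exprn_gt0// exprn_ege1// ler1n.
Defined.

Lemma moderate_geometric N : E_net h -> moderate N h -> forall M s, exists C : R, forall j,
  weighted_bound (fun x => re_fun (h (dyadic j.+1)) x - re_fun (h (dyadic j)) x) M s (C / 2 ^+ j) /\
  weighted_bound (fun x => im_fun (h (dyadic j.+1)) x - im_fun (h (dyadic j)) x) M s (C / 2 ^+ j).
Proof.
move=> sh mh M s.
have hS eps : schwartz (h eps) by exact: moderate_schwartz mh.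
have [A A0 HA] := cconv_approx phi_mollifier N.+1 M.
(* Approximation to order [N.+1] consumes that many derivatives beyond those in [s]; [B] serves all
   of them with the same [N]. *)
have [B HB] := moderate_uniform mh M (N.+1 + size s).
have B0 : 0 <= B.
  have [+ _] := HB [::] isT (dyadic 0) => /bnd_ge0.
  by rewrite /= invr1 expr1n divr1.
exists (A * B * (2 ^+ N + 1)) => j.
set e := dyadic j; set d := dyadic j.+1.
have e0 : 0 < val e by exact: eps_gt0.
have d0 : 0 < val d by exact: eps_gt0.
have bound (p q : eps_index R) := HA (val p) (h q) s (B / val q ^+ N)
  (eps_neq0 p) (eps_norm_le1 p) (hS q).
have [r1 i1] : weighted_bound (re_fun (fun x => cconv (val d) phi (h e) x - h e x)) M s
      (`|val d| ^+ N.+1 * (A * (B / val e ^+ N))) /\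
    weighted_bound (im_fun (fun x => cconv (val d) phi (h e) x - h e x)) M s
      (`|val d| ^+ N.+1 * (A * (B / val e ^+ N))).
  apply: bound; first by rewrite divr_ge0// exprn_ge0// ltW.
  by move=> t tN; apply: HB; rewrite size_cat tN.
have [r2 i2] : weighted_bound (re_fun (fun x => cconv (val e) phi (h d) x - h d x)) M s
      (`|val e| ^+ N.+1 * (A * (B / val d ^+ N))) /\
    weighted_bound (im_fun (fun x => cconv (val e) phi (h d) x - h d x)) M s
      (`|val e| ^+ N.+1 * (A * (B / val d ^+ N))).
  apply: bound; first by rewrite divr_ge0// exprn_ge0// ltW.
  by move=> t tN; apply: HB; rewrite size_cat tN.
have comm := cconv_convolutionC phi_mollifier w_tempered (hS e) (hS d).
rewrite -comm in r2 i2.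
have ce : schwartz (cconv (val d) phi (h e)).
  exact: schwartz_cconv (eps_neq0 d) (eps_norm_le1 d) (hS e).
have [re1 ie1] := (schwartzP _).1 (schwartzB ce (hS e)).
have [re2 ie2] := (schwartzP _).1 (schwartzB ce (hS d)).
have le : `|val d| ^+ N.+1 * (A * (B / val e ^+ N)) +
    `|val e| ^+ N.+1 * (A * (B / val d ^+ N)) <= A * B * (2 ^+ N + 1) / 2 ^+ j.
  rewrite (gtr0_norm e0) (gtr0_norm d0).
  have dE : val d = val e / 2 by rewrite /= exprS invfM mulrC.
  by rewrite dE; exact: halving_bound.
(* By [comm], both approximations contain the same double convolution, which cancels in their
   difference. *)
have E1 : (fun x => re_fun (h d) x - re_fun (h e) x) = fun x =>
    re_fun (fun x => cconv (val d) phi (h e) x - h e x) x -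
    re_fun (fun x => cconv (val d) phi (h e) x - h d x) x.
  apply/funext => x; rewrite /re_fun.
  by case: (h e x) (h d x) (cconv _ _ _ _) => [? ?] [? ?] [? ?] /=; ring.
have E2 : (fun x => im_fun (h d) x - im_fun (h e) x) = fun x =>
    im_fun (fun x => cconv (val d) phi (h e) x - h e x) x -
    im_fun (fun x => cconv (val d) phi (h e) x - h d x) x.
  apply/funext => x; rewrite /im_fun.
  by case: (h e x) (h d x) (cconv _ _ _ _) => [? ?] [? ?] [? ?] /=; ring.
rewrite E1 E2; split; apply: bnd_le le _.
  exact: (bndB re1.1 re2.1 r1 r2).
exact: (bndB ie1.1 ie2.1 i1 i2).
Qed.

Lemma int_geometric (p : 'rV[R]_n -> R) f (g : nat -> 'rV[R]_n -> R) (C : R) :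
  rschwartz p -> rschwartz f -> (forall j, rschwartz (g j)) ->
  (forall j, weighted_bound (fun x => f x - g j x) 0 [::] (C / 2 ^+ j)) ->
  forall j, `|I (fun x => p x * f x) - I (fun x => p x * g j x)| <=
    C * moment p 0 / 2 ^+ j.
Proof.
move=> ps fs gs H j; rewrite -intB; [|exact: rsch_irvM..].
under eq_fun do rewrite -mulrBr.
rewrite mulrAC; apply: int_le_moment.
- exact: rsch_rd.
- by apply: mrvB; exact: rsch_mrv.
- by move=> x; have := H j x; rewrite mul1r expr0 mulr1.
Qed.

Lemma regular_schwartz_distribution :
  G_S_infty (embed phi w) -> is_schwartz_distribution w.
Proof.
move=> /regular_moderate[sh [N mh]].
have hS eps : schwartz (h eps) by exact: moderate_schwartz mh.
have geo := moderate_geometric sh mh.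
pose g1 j := re_fun (h (dyadic j)); pose g2 j := im_fun (h (dyadic j)).
have g1s j : rschwartz (g1 j) by have [] := (schwartzP _).1 (hS (dyadic j)).
have g2s j : rschwartz (g2 j) by have [] := (schwartzP _).1 (hS (dyadic j)).
have [f1 f1s Hf1] : exists2 f, rschwartz f & forall M s, exists C, forall j,
    weighted_bound (fun x => f x - g1 j x) M s (C / 2 ^+ j).
  apply: rsch_limit => // M s; have [C HC] := geo M s; exists C => j.
  by have [] := HC j.
have [f2 f2s Hf2] : exists2 f, rschwartz f & forall M s, exists C, forall j,
    weighted_bound (fun x => f x - g2 j x) M s (C / 2 ^+ j).
  apply: rsch_limit => // M s; have [C HC] := geo M s; exists C => j.
  by have [] := HC j.
pose f x := f1 x +i* f2 x.
have fS : schwartz f by apply/schwartzP.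
exists f => // psi sp; have [p1 p2] := (schwartzP psi).1 sp.
have [m [Cw [Cw0 HCw]]] := tempered_bound w_tempered.
(* Order 1 is enough: [psi] is fixed and only convergence is at stake. The weight [m] matches the
   order of [w], and [m.+1] derivatives allow one for the approximation. *)
have [A A0 HA] := cconv_approx phi_mollifier 1 m.
have [B1 HB1] := rsch_uniform p1 m m.+1; have [B2 HB2] := rsch_uniform p2 m m.+1.
have B10 : 0 <= B1 by exact: bnd_ge0 (HB1 [::] isT).
have B20 : 0 <= B2 by exact: bnd_ge0 (HB2 [::] isT).
have err1 j : Normc.normc (w (cconv (- val (dyadic j)) phi psi) - w psi) <=
    Cw * (A * (B1 + B2)) / 2 ^+ j.
  have dn0 : - val (dyadic j) != 0 by rewrite oppr_eq0 eps_neq0.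
  have dn1 : `|- val (dyadic j)| <= 1 by rewrite normrN eps_norm_le1.
  have sc := schwartz_cconv phi_mollifier dn0 dn1 sp.
  rewrite -(temperedB w_tempered sc sp) -mulrA.
  apply: HCw; first exact: schwartzB.
  move=> s sm; have := HA _ psi s (B1 + B2) dn0 dn1 sp (addr_ge0 B10 B20).
  rewrite expr1 normrN gtr0_norm ?eps_gt0// [_ * (A * _)]mulrC; apply.
  move=> t t1; have ts : (size (t ++ s) <= m.+1)%N by rewrite size_cat t1.
  by split; [apply: bnd_le (HB1 _ ts)|apply: bnd_le (HB2 _ ts)];
    rewrite ?lerDl ?lerDr.
(* For the integrals against [psi], uniform convergence of the functions themselves suffices: weight
   0 and no derivative. *)
have [C1 HC1] := Hf1 0 [::]; have [C2 HC2] := Hf2 0 [::].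
have dual j : w (cconv (- val (dyadic j)) phi psi) =
    (I (fun x => re_fun psi x * g1 j x) - I (fun x => im_fun psi x * g2 j x)) +i*
    (I (fun x => re_fun psi x * g2 j x) + I (fun x => im_fun psi x * g1 j x)).
  rewrite (cconv_dual phi_mollifier w_tempered _ sp).
  exact: (cintegral_mulE sp (hS (dyadic j))).
have -> : cintegral (fun x => f x * psi x) =
    (I (fun x => re_fun psi x * f1 x) - I (fun x => im_fun psi x * f2 x)) +i*
    (I (fun x => re_fun psi x * f2 x) + I (fun x => im_fun psi x * f1 x)).
  rewrite -(cintegral_mulE sp fS); congr cintegral.
  by apply/funext => x; rewrite mulrC.
have q11 := int_geometric p1 f1s g1s HC1; have q22 := int_geometric p2 f2s g2s HC2.
have q12 := int_geometric p1 f2s g2s HC2; have q21 := int_geometric p2 f1s g1s HC1.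
have triD (a P Q p q : R) : `|a - (P + Q)| <= `|p + q - a| + (`|P - p| + `|Q - q|).
  have -> : a - (P + Q) = - (p + q - a) - ((P - p) + (Q - q)) by ring.
  by apply: le_trans (ler_normB _ _) _; rewrite normrN lerD2l ler_normD.
have triB (a P Q p q : R) : `|a - (P - Q)| <= `|p - q - a| + (`|P - p| + `|Q - q|).
  have -> : a - (P - Q) = - (p - q - a) - ((P - p) - (Q - q)) by ring.
  by apply: le_trans (ler_normB _ _) _; rewrite normrN lerD2l ler_normB.
(* For every [j], each part of [w psi] is within a constant times [2 ^- j] of its counterpart for
   [f]: one error comes from [err1], the others from the two integrals. *)
apply: eq_complex_parts => /=; apply/eqP; rewrite -subr_eq0 -normr_le0.
  apply: (@geometric_squeeze _ _ _ (Cw * (A * (B1 + B2)) +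
    (C1 * moment (re_fun psi) 0 + C2 * moment (im_fun psi) 0))) => j.
  have := le_trans (normc_Re _) (err1 j); rewrite dual.
  case: (w psi) => a b /= e1; rewrite add0r !mulrDl.
  apply: le_trans (lerD e1 (lerD (q11 j) (q22 j))); exact: triB.
apply: (@geometric_squeeze _ _ _ (Cw * (A * (B1 + B2)) +
  (C2 * moment (re_fun psi) 0 + C1 * moment (im_fun psi) 0))) => j.
have := le_trans (normc_Im _) (err1 j); rewrite dual.
case: (w psi) => a b /= e1; rewrite add0r !mulrDl.
apply: le_trans (lerD e1 (lerD (q12 j) (q21 j))); exact: triD.
Qed.

End regularity.

Theorem theorem2p1 (R : realType) (n : nat) (phi : 'rV[R]_n -> R[i])
    (phi_mollifier : mollifier phi) :
  @G_S_infty R n `&` [set embed phi w | w in @tempered R n] =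
    [set embed phi w | w in @tempered R n `&` @is_schwartz_distribution R n] /\
  forall w : ('rV[R]_n -> R[i]) -> R[i], tempered w ->
    (G_S_infty (embed phi w) <-> is_schwartz_distribution w).
Proof.
have main w : tempered w -> (G_S_infty (embed phi w) <-> is_schwartz_distribution w).
  move=> wt; split; first exact: regular_schwartz_distribution.
  exact: schwartz_distribution_regular.
split=> //; apply/seteqP; split=> [F [GF [w wt wF]]|_ [w [wt ws] <-]].
  by exists w => //; split=> //; apply/(main w wt); rewrite wF.
by split; [apply/(main w wt)|exists w].
Qed.
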